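(* Let $q\in(0,1)$ and $n\in\mathbb{N}$. The *-representations of $\mathcal{O}(\mathbb{C}_q^n)$ of the standard form described in the context are unitarily equivalent to a direct sum of representations of the following form. Set $I_q:=\{q^{-m}:m\in\mathbb{N}\}$ and $X_{q,k}:=I_q^{k-1}\times[0,\infty)=I_q\times\cdots\times I_q\times[0,\infty)$. Let $\nu$ be a $q$-invariant Borel measure on $[0,\infty)$, i.e. $\nu(qM)=\nu(M)$ for all Borel measurable sets $M\subset[0,\infty)$. Consider the product measure $\mu_k:=\delta\otimes\cdots\otimes\delta\otimes\nu$ on $X_{q,k}$, where $\delta$ denotes the counting measure on $I_q$, and define $$D_k:=\{f\in L_2(X_{q,k},\mu_k):\ \mathrm{supp}(f)\subset I_q^{k-1}\times(0,\infty)\ \text{is compact}\}.$$ For $k\in\{1,\ldots,n\}$, the operators $z_1,\ldots,z_n$ act on $h\in D_k$ by $$z_{k+1}=\cdots=z_n=0\quad\text{if }k<n,$$ $$(z_kh)(t_1,\ldots,t_{k-1},t_k)=q\,t_k\,h(t_1,\ldots,t_{k-1},q\,t_k),$$ $$(z_jh)(t_1,\ldots,t_j,\ldots,t_k)=\sqrt{(qt_j)^2-1}\;t_{j+1}\cdots t_k\,h(t_1,\ldots,q\,t_j,\ldots,t_k),\qquad j<k.$$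
   Context: $\mathbb{N}=\{1,2,3,\ldots\}$. $\mathcal{O}(\mathbb{C}_q^n)$ is the complex *-algebra generated by $z_1,\ldots,z_n$ with relations $$z_jz_i=q\,z_iz_j\ (j>i),\qquad z_jz_i^*=q\,z_i^*z_j\ (j\neq i),$$ $$z_iz_i^*=q^2z_i^*z_i-(1-q^2)\sum_{j>i}z_j^*z_j\ (i=1,\ldots,n-1),\qquad z_nz_n^*=q^2z_n^*z_n .$$ A *-representation is given by densely defined closed operators $z_1,\ldots,z_n$ which together with their adjoints satisfy these relations on a common dense domain; the same letter denotes a generator, the closed operator representing it, and the restriction of that operator to the common dense domain. Standard form of a *-representation of $\mathcal{O}(\mathbb{C}_q^n)$: $\mathcal{H}=\mathcal{H}_0\oplus\cdots\oplus\mathcal{H}_n$ is an orthogonal sum of reducing subspaces; $z_1=\cdots=z_n=0$ on $\mathcal{H}_0$; and for $k=1,\ldots,n$ there are a Hilbert space $\mathcal{K}_k$ and a bounded self-adjoint operator $A_k$ on $\mathcal{K}_k$ with $\mathrm{spec}(A_k)\subset[q,1]$ and $q$ not an eigenvalue of $A_k$ such that $$\mathcal{H}_k=\bar\bigoplus_{i_1,\ldots,i_{k-1}\in\mathbb{N}}\ \bar\bigoplus_{i_k\in\mathbb{Z}}\ \mathcal{G}_{i_1,\ldots,i_k},\qquad \mathcal{G}_{i_1,\ldots,i_k}=\mathcal{K}_k$$ (completed orthogonal sum), and, writing $h_{i_1,\ldots,i_k}$ for $h\in\mathcal{K}_k$ regarded as an element of $\mathcal{G}_{i_1,\ldots,i_k}$,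 the action on $\mathcal{H}_k$ is $$z_{k+1}=\cdots=z_n=0\ \text{ if }k<n,\qquad z_k\,h_{i_1,\ldots,i_k}=q^{-i_k}(A_kh)_{i_1,\ldots,i_{k-1},i_k+1},$$ $$z_j\,h_{i_1,\ldots,i_k}=\sqrt{q^{-2i_j}-1}\;q^{-(i_{j+1}+\cdots+i_k)}(A_kh)_{i_1,\ldots,i_j+1,\ldots,i_k},\quad j=1,\ldots,k-1.$$ The common dense domain is the algebraic direct sum of $\mathcal{H}_0$ and, over all $k\ge1$, of the spaces $\mathcal{G}_{i_1,\ldots,i_k}$. Reading convention for the formula for $z_jh$ with $j<k$: for $t_j=q^{-1}$ the coefficient $\sqrt{(qt_j)^2-1}$ is $0$, and the right-hand side is read as $0$.
   Formalization: The direct sum carries one extra summand, the zero representation on the space H_0 of the standard form: since supp(f) lies in I_q^{k-1}×(0,∞), no listed representation with dense D_k covers H_0 ≠ 0; for H_0 = 0 the claim is as stated. *)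

(* Defs.v *)
From HB Require Import structures.
From mathcomp Require Import all_boot all_order all_algebra.
From mathcomp Require Import complex.
From mathcomp Require Import ring lra.
From mathcomp Require Import all_classical all_reals all_analysis measurable_realfun.
Set Implicit Arguments.
Unset Strict Implicit.
Unset Printing Implicit Defensive.
Import Order.TTheory GRing.Theory Num.Theory.
Import numFieldNormedType.Exports.
Local Open Scope classical_set_scope.
Local Open Scope ring_scope.

(* Complex inner products, linear in the first argument. *)
HB.mixin Record NormedModule_isInnerProduct (R : realType) V
    & NormedModule R[i] V := {
  dotp : V -> V -> R[i];
  dotpDl : forall (a : R[i]) (x y z : V),
    dotp (a *: x + y) z = a * dotp x z + dotp y z;
  dotpC : forall x y : V, dotp x y = Num.conj (dotp y x);
  dotpxx : forall x : V, dotp x x = `|x| ^+ 2 }.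

#[short(type="innerProductType")]
HB.structure Definition InnerProduct (R : realType) :=
  {V of NormedModule R[i] V & NormedModule_isInnerProduct R V}.

#[short(type="hilbertType")]
HB.structure Definition Hilbert (R : realType) :=
  {V of InnerProduct R V & Complete V}.

HB.factory Record Lmodule_isInnerProduct (R : realType) V
    & GRing.Lmodule R[i] V := {
  form : V -> V -> R[i];
  formDl : forall (a : R[i]) (x y z : V),
    form (a *: x + y) z = a * form x z + form y z;
  formC : forall x y : V, form x y = Num.conj (form y x);
  form_ge0 : forall x : V, 0 <= form x x;
  form_eq0 : forall x : V, form x x = 0 -> x = 0 }.

HB.builders Context R V & Lmodule_isInnerProduct R V.

Lemma form0l z : form 0 z = 0.
Proof.
by have /eqP := formDl 1 0 0 z; rewrite scaler0 addr0 mul1r -subr_eq subrr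
  => /eqP <-.
Qed.
Lemma formZl a x z : form (a *: x) z = a * form x z.
Proof. by have := formDl a x 0 z; rewrite addr0 form0l addr0. Qed.
Lemma formAl x y z : form (x + y) z = form x z + form y z.
Proof. by have := formDl 1 x y z; rewrite scale1r mul1r. Qed.
Lemma formZr a x z : form x (a *: z) = Num.conj a * form x z.
Proof. by rewrite formC formZl rmorphM/= -formC. Qed.
Lemma formAr x y z : form x (y + z) = form x y + form x z.
Proof. by rewrite formC formAl rmorphD/= -!formC. Qed.

Lemma cauchy_schwarz x y : `|form x y| ^+ 2 <= form x x * form y y.
Proof.
have [/form_eq0 ->|y0] := eqVneq (form y y) 0.
  by rewrite formC !form0l conjC0 normr0 expr0n/= mulr0.
have yp : 0 < form y y by rewrite lt_def y0 form_ge0.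
have := form_ge0 (form y y *: x - form x y *: y).
rewrite -scaleNr formAl !formAr !formZl !formZr.
rewrite (formC y x) (CrealP (ger0_real (form_ge0 y))) rmorphN/=.
set a := form x x; set b := form y y; set c := form x y.
rewrite (_ : _ + _ = b * (a * b - `|c| ^+ 2)); last first.
  rewrite normCK; ring.
by rewrite pmulr_rge0// subr_ge0.
Qed.

Definition nrm x := sqrtC (form x x).

Lemma nrmD x y : nrm (x + y) <= nrm x + nrm y.
Proof.
rewrite -ler_sqr ?nnegrE ?addr_ge0 ?sqrtC_ge0 ?form_ge0//.
rewrite sqrrD /nrm !sqrtCK formAl !formAr (formC y x).
set a := form x x; set b := form y y; set c := form x y.
rewrite (_ : a + c + (_ + b) = a + (c + Num.conj c) + b); last by ring.
rewrite lerD2r lerD2l.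
have cs : `|c| <= sqrtC a * sqrtC b.
  rewrite -ler_sqr ?nnegrE ?mulr_ge0 ?sqrtC_ge0 ?form_ge0//.
  by rewrite exprMn !sqrtCK cauchy_schwarz.
rewrite -mulr_natr.
apply: (@le_trans _ _ (`|c| * 2)); last by rewrite ler_pM2r.
have -> : c + Num.conj c = 'Re c * 2.
  by rewrite ReE -mulrA mulVf ?mulr1// pnatr_eq0.
rewrite ler_pM2r//; exact: (leif_Re_Creal c).
Qed.

Lemma nrmZ a x : nrm (a *: x) = `|a| * nrm x.
Proof.
rewrite /nrm formZl formZr mulrA -normCK sqrtCM ?nnegrE ?form_ge0 ?exprn_ge0//.
by rewrite sqrCK.
Qed.

Lemma nrm_eq0 x : nrm x = 0 -> x = 0.
Proof. by move=> /eqP; rewrite sqrtC_eq0 => /eqP/form_eq0. Qed.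

HB.instance Definition _ := Lmodule_isNormed.Build R[i] V nrmD nrmZ nrm_eq0.

Lemma form_norm x : form x x = `|x| ^+ 2.
Proof. by rewrite [`|x|]/(nrm x) sqrtCK. Qed.

HB.instance Definition _ :=
  NormedModule_isInnerProduct.Build R V formDl formC form_norm.
HB.end.

Section square_integrable.
Context d (T : measurableType d) (R : realType).
Variable mu : {measure set T -> \bar R}.
Implicit Types (f g : T -> R[i]) (u v : T -> R).

Definition square_integrable f :=
  [/\ measurable_fun setT (fun t => complex.Re (f t)),
      measurable_fun setT (fun t => complex.Im (f t)) &
      (\int[mu]_t ((complex.Re (f t)) ^+ 2 + (complex.Im (f t)) ^+ 2)%:E
         < +oo)%E].

Definition l2fun_pred : {pred T -> R[i]} := fun f => `[< square_integrable f >].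

Let sq_int u := measurable_fun setT u /\ mu.-integrable setT (fun t => (u t ^+ 2)%:E).

Let sq_intP f : square_integrable f <->
  sq_int (fun t => complex.Re (f t)) /\ sq_int (fun t => complex.Im (f t)).
Proof.
split=> [[mr mi fi]|[[mr ri] [mi ii]]].
- have ifin : mu.-integrable setT (fun t =>
      ((complex.Re (f t)) ^+ 2 + (complex.Im (f t)) ^+ 2)%:E).
    apply/integrableP; split.
      by apply/measurable_EFinP; apply: measurable_funD;
        apply: measurable_funX.
    under eq_integral do rewrite gee0_abs ?lee_fin ?addr_ge0 ?sqr_ge0//.
    exact: fi.
  split; split => //; apply: le_integrable ifin => //.
  + exact/measurable_EFinP/measurable_funX.
  + move=> t _ /=; rewrite !lee_fin !ger0_norm ?addr_ge0 ?sqr_ge0//.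
    by rewrite lerDl sqr_ge0.
  + exact/measurable_EFinP/measurable_funX.
  + move=> t _ /=; rewrite !lee_fin !ger0_norm ?addr_ge0 ?sqr_ge0//.
    by rewrite lerDr sqr_ge0.
- split=> //.
  have /integrableP[_] := integrableD measurableT ri ii.
  congr (_ < _)%E; apply: eq_integral => t _ /=.
  by rewrite ger0_norm ?addr_ge0 ?sqr_ge0.
Qed.

Let sq_intM u v : sq_int u -> sq_int v ->
  mu.-integrable setT (EFin \o (fun t => u t * v t)).
Proof.
move=> [mu_ iu] [mv iv].
apply: (le_integrable measurableT _ _ (integrableD measurableT iu iv)).
  by apply/measurable_EFinP; exact: measurable_funM.
move=> t _ /=; rewrite lee_fin [leRHS]ger0_norm ?addr_ge0 ?sqr_ge0// ler_norml.
by apply/andP; split; nra.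
Qed.

Let sq_intD u v : sq_int u -> sq_int v -> sq_int (fun t => u t + v t).
Proof.
move=> su sv; have iuv := sq_intM su sv; have ivu := sq_intM sv su.
case: su => mu_ iu; case: sv => mv iv.
split; first exact: measurable_funD.
have := integrableD measurableT (integrableD measurableT iu iv)
  (integrableD measurableT iuv ivu).
apply: eq_integrable => // t _ /=; rewrite -!EFinD; congr EFin; ring.
Qed.

Let sq_intZ (a : R) u : sq_int u -> sq_int (fun t => a * u t).
Proof.
move=> [mu_ iu]; split; first exact: measurable_funM.
have := integrableZl measurableT (a ^+ 2) iu.
by apply: eq_integrable => // t _ /=; rewrite -EFinM exprMn.
Qed.

Lemma square_integrable_lin (a : R[i]) f g :
  square_integrable f -> square_integrable g ->
  square_integrable (fun t => a * f t + g t).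
Proof.
move=> /sq_intP[fr fi] /sq_intP[gr gi]; apply/sq_intP; split.
- have := sq_intD (sq_intD (sq_intZ (complex.Re a) fr)
    (sq_intZ (- complex.Im a) fi)) gr.
  congr sq_int; apply/funext => t.
  by case: a (f t) (g t) => ? ? [? ?] [? ?] /=; ring.
- have := sq_intD (sq_intD (sq_intZ (complex.Re a) fi)
    (sq_intZ (complex.Im a) fr)) gi.
  congr sq_int; apply/funext => t.
  by case: a (f t) (g t) => ? ? [? ?] [? ?] /=; ring.
Qed.

Lemma square_integrable0 : square_integrable (fun=> 0).
Proof.
split; [exact: measurable_cst | exact: measurable_cst |].
rewrite integral0_eq ?ltry// => t _ /=.
by rewrite expr0n/= addr0.
Qed.

Let ReM f g t : complex.Re (f t * (g t)^*%C) =
  complex.Re (f t) * complex.Re (g t) + complex.Im (f t) * complex.Im (g t).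
Proof. by case: (f t) (g t) => ? ? [? ?] /=; ring. Qed.

Let ImM f g t : complex.Im (f t * (g t)^*%C) =
  complex.Im (f t) * complex.Re (g t) + - (complex.Re (f t) * complex.Im (g t)).
Proof. by case: (f t) (g t) => ? ? [? ?] /=; ring. Qed.

Let intRe f g : square_integrable f -> square_integrable g ->
  mu.-integrable setT (EFin \o (fun t => complex.Re (f t * (g t)^*%C))).
Proof.
move=> /sq_intP[fr fi] /sq_intP[gr gi].
have := integrableD measurableT (sq_intM fr gr) (sq_intM fi gi).
by apply: eq_integrable => // t _; rewrite /= ReM.
Qed.

Let intIm f g : square_integrable f -> square_integrable g ->
  mu.-integrable setT (EFin \o (fun t => complex.Im (f t * (g t)^*%C))).
Proof.
move=> /sq_intP[fr fi] /sq_intP[gr gi].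
have := integrableB measurableT (sq_intM fi gr) (sq_intM fr gi).
by apply: eq_integrable => // t _; rewrite /= ImM.
Qed.

Definition l2form f g : R[i] :=
  Complex (\int[mu]_t complex.Re (f t * (g t)^*%C))
          (\int[mu]_t complex.Im (f t * (g t)^*%C)).

Lemma l2form_lin (a : R[i]) f g h : square_integrable f ->
  square_integrable g -> square_integrable h ->
  l2form (fun t => a * f t + g t) h = a * l2form f h + l2form g h.
Proof.
move=> sf sg sh.
have RiZ r v : mu.-integrable setT (EFin \o v) ->
    mu.-integrable setT (EFin \o (fun t => r * v t)).
  move=> iv; have := integrableZl measurableT r iv.
  by apply: eq_integrable => // t _ /=; rewrite EFinM.
have RiD v w : mu.-integrable setT (EFin \o v) ->
    mu.-integrable setT (EFin \o w) ->
    mu.-integrable setT (EFin \o (fun t => v t + w t)).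
  move=> iv iw; have := integrableD measurableT iv iw.
  by apply: eq_integrable => // t _ /=; rewrite EFinD.
rewrite /l2form.
rewrite (_ : (fun t => complex.Re _) = (fun t =>
    (complex.Re a * complex.Re (f t * (h t)^*%C) +
     - complex.Im a * complex.Im (f t * (h t)^*%C)) +
    complex.Re (g t * (h t)^*%C))); last first.
  apply/funext => t.
  by case: a (f t) (g t) (h t) => ? ? [? ?] [? ?] [? ?] /=; ring.
rewrite (_ : (fun t => complex.Im (_ * _)) = (fun t =>
    (complex.Re a * complex.Im (f t * (h t)^*%C) +
     complex.Im a * complex.Re (f t * (h t)^*%C)) +
    complex.Im (g t * (h t)^*%C))); last first.
  apply/funext => t.
  by case: a (f t) (g t) (h t) => ? ? [? ?] [? ?] [? ?] /=; ring.
have ifr := intRe sf sh; have ifi := intIm sf sh.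
have igr := intRe sg sh; have igi := intIm sg sh.
rewrite !RintegralD//; do ?[exact: RiZ | apply: RiD => //; exact: RiZ].
rewrite !RintegralZl//.
by case: a => ar ai /=; apply/eqP; rewrite eq_complex/= mulNr !eqxx.
Qed.

Lemma l2formC f g : square_integrable f -> square_integrable g ->
  l2form f g = Num.conj (l2form g f).
Proof.
move=> sf sg; apply/eqP; rewrite eq_complex/=; apply/andP; split; apply/eqP.
  apply: eq_Rintegral => t _.
  by case: (f t) (g t) => ? ? [? ?] /=; ring.
rewrite -[RHS]mulN1r -RintegralZl//; last exact: intIm.
apply: eq_Rintegral => t _.
by case: (f t) (g t) => ? ? [? ?] /=; ring.
Qed.

Lemma l2formxx f : l2form f f =
  (\int[mu]_t ((complex.Re (f t)) ^+ 2 + (complex.Im (f t)) ^+ 2))%:C%C.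
Proof.
apply/eqP; rewrite eq_complex/=; apply/andP; split; apply/eqP.
  by apply: eq_Rintegral => t _; rewrite ReM -!expr2.
rewrite /Rintegral integral0_eq// => t _.
by rewrite ImM mulrC subrr.
Qed.

Lemma l2form_ge0 f : 0 <= l2form f f.
Proof.
by rewrite l2formxx lecR Rintegral_ge0// => t _; rewrite addr_ge0 ?sqr_ge0.
Qed.

Lemma l2form_eq0 f : square_integrable f -> l2form f f = 0 ->
  {ae mu, forall t, f t = 0}.
Proof.
move=> [mr mi fi]; rewrite l2formxx => -[f0].
pose w t := (complex.Re (f t)) ^+ 2 + (complex.Im (f t)) ^+ 2.
have w0 t : 0 <= w t by rewrite addr_ge0 ?sqr_ge0.
have mw : measurable_fun setT (EFin \o w).
  by apply/measurable_EFinP; apply: measurable_funD; apply: measurable_funX.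
have : (\int[mu]_t `|(EFin \o w) t| = 0)%E.
  under eq_integral do rewrite gee0_abs ?lee_fin//.
  have wfin : (\int[mu]_t (w t)%:E \is a fin_num)%E.
    by rewrite ge0_fin_numE// integral_ge0// => t _; rewrite lee_fin.
  by rewrite /= -(fineK wfin); congr EFin; exact: f0.
move/(ae_eq_integral_abs _ measurableT mw); apply: filterS => t /(_ I) /= [].
move=> /eqP; rewrite paddr_eq0 ?sqr_ge0// !sqrf_eq0 => /andP[/eqP r0 /eqP i0].
by apply/eqP; rewrite eq_complex r0 i0 !eqxx.
Qed.

Lemma l2form_ae f g h : square_integrable f -> square_integrable g ->
  square_integrable h -> {ae mu, forall t, f t = g t} ->
  l2form f h = l2form g h.
Proof.
move=> sf sg sh fg; rewrite /l2form /Rintegral.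
congr (Complex (fine _) (fine _)); apply: ae_eq_integral => //;
  try exact: measurable_int (intRe _ _); try exact: measurable_int (intIm _ _).
  by apply: filterS fg => t fgt _; rewrite fgt.
by apply: filterS fg => t fgt _; rewrite fgt.
Qed.

End square_integrable.

Section L2_space.
Context d (T : measurableType d) (R : realType).
Variable mu : {measure set T -> \bar R}.

(* The complex space L_2(mu): square-integrable functions up to mu-almost
   everywhere equality. An element coerces to a representative function, so
   only its almost everywhere properties are meaningful. *)
Record l2fun := L2Fun {
  l2fun_val : T -> R[i] ; l2funP : square_integrable mu l2fun_val }.

HB.instance Definition _ := gen_eqMixin l2fun.
HB.instance Definition _ := gen_choiceMixin l2fun.

Definition l2fun_eq (f g : l2fun) :=
  `[< {ae mu, forall t, l2fun_val f t = l2fun_val g t} >].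

Let l2fun_eq_refl : reflexive l2fun_eq.
Proof. by move=> f; apply/asboolP; apply: aeW. Qed.

Let l2fun_eq_sym : symmetric l2fun_eq.
Proof.
by move=> f g; apply/asboolP/asboolP; apply: filterS => t ->.
Qed.

Let l2fun_eq_trans : transitive l2fun_eq.
Proof.
move=> f g h /asboolP gf /asboolP fh; apply/asboolP.
by apply: filterS2 gf fh => t -> ->.
Qed.

Canonical l2fun_equiv :=
  EquivRel l2fun_eq l2fun_eq_refl l2fun_eq_sym l2fun_eq_trans.

Local Open Scope quotient_scope.

Definition L2 : Type := {eq_quot l2fun_eq}.
HB.instance Definition _ := Choice.on L2.
HB.instance Definition _ := EqQuotient.on L2.

Definition L2_fun (f : L2) : T -> R[i] := l2fun_val (repr f).
Coercion L2_fun : L2 >-> Funclass.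

Definition toL2 (f : T -> R[i]) (sf : square_integrable mu f) : L2 :=
  \pi_L2 (L2Fun sf).

Lemma L2P (f : L2) : square_integrable mu f.
Proof. exact: l2funP. Qed.

Lemma L2_eqP (f g : L2) : {ae mu, forall t, f t = g t} <-> f = g.
Proof.
split=> [fg|->]; last exact: aeW.
rewrite -[f]reprK -[g]reprK; apply/eqP; rewrite eqmodE; exact/asboolP.
Qed.

Lemma toL2E f (sf : square_integrable mu f) :
  {ae mu, forall t, toL2 sf t = f t}.
Proof.
have /eqP := reprK (toL2 sf).
by rewrite /toL2 eqmodE => /asboolP; apply: filterS => t.
Qed.

Let ae_and (P Q : T -> Prop) : {ae mu, forall t, P t} ->
  {ae mu, forall t, Q t} -> {ae mu, forall t, P t /\ Q t}.
Proof. by move=> p q; apply: filterS2 p q => t. Qed.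

Let lin_subproof (a : R[i]) (f g : L2) :
  square_integrable mu (fun t => a * f t + g t).
Proof. exact: square_integrable_lin (L2P f) (L2P g). Qed.

Definition L2_lin a f g := toL2 (lin_subproof a f g).
Definition L2_zero := toL2 (@square_integrable0 _ T R mu).
Definition L2_add := L2_lin 1.
Definition L2_scale a f := L2_lin a f L2_zero.
Definition L2_opp := L2_scale (-1).

Lemma L2_zeroE : {ae mu, forall t, L2_zero t = 0}.
Proof. exact: toL2E. Qed.

Lemma L2_addE f g : {ae mu, forall t, L2_add f g t = f t + g t}.
Proof. by apply: filterS (toL2E (lin_subproof 1 f g)) => t ->; rewrite mul1r. Qed.

Lemma L2_scaleE a f : {ae mu, forall t, L2_scale a f t = a * f t}.
Proof.
by apply: filterS2 (toL2E (lin_subproof a f L2_zero)) L2_zeroE => t -> ->;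
  rewrite addr0.
Qed.

Let addA : associative L2_add.
Proof.
move=> f g h; apply/L2_eqP.
have P := ae_and (L2_addE f (L2_add g h)) (L2_addE (L2_add f g) h).
apply: filterS3 P (L2_addE g h) (L2_addE f g) => t [-> ->] -> ->.
exact: addrA.
Qed.

Let addC : commutative L2_add.
Proof.
move=> f g; apply/L2_eqP.
by apply: filterS2 (L2_addE f g) (L2_addE g f) => t -> ->; exact: addrC.
Qed.

Let add0 : left_id L2_zero L2_add.
Proof.
move=> f; apply/L2_eqP.
by apply: filterS2 (L2_addE L2_zero f) L2_zeroE => t -> ->; exact: add0r.
Qed.

Let addN : left_inverse L2_zero L2_opp L2_add.
Proof.
move=> f; apply/L2_eqP.
apply: filterS3 (L2_addE (L2_opp f) f) (L2_scaleE (-1) f) L2_zeroE.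
by move=> t -> -> ->; rewrite mulN1r addNr.
Qed.

HB.instance Definition _ := GRing.isZmodule.Build L2 addA addC add0 addN.

Let scaleA a b f : L2_scale a (L2_scale b f) = L2_scale (a * b) f.
Proof.
apply/L2_eqP.
apply: filterS3 (L2_scaleE a (L2_scale b f)) (L2_scaleE b f) (L2_scaleE (a * b) f).
by move=> t -> -> ->; rewrite mulrA.
Qed.

Let scale1 : left_id 1 L2_scale.
Proof.
by move=> f; apply/L2_eqP; apply: filterS (L2_scaleE 1 f) => t ->; rewrite mul1r.
Qed.

Let scaleDr : right_distributive L2_scale +%R.
Proof.
move=> a f g; apply/L2_eqP.
have P := ae_and (L2_scaleE a (L2_add f g)) (L2_addE f g).
have Q := ae_and (L2_scaleE a f) (L2_scaleE a g).
apply: filterS3 P Q (L2_addE (L2_scale a f) (L2_scale a g)).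
by move=> t [-> ->] [e1 e2] ->; rewrite e1 e2 mulrDr.
Qed.

Let scaleDl f : {morph L2_scale^~ f : a b / a + b}.
Proof.
move=> a b; apply/L2_eqP.
have Q := ae_and (L2_scaleE a f) (L2_scaleE b f).
apply: filterS3 (L2_scaleE (a + b) f) Q (L2_addE (L2_scale a f) (L2_scale b f)).
by move=> t -> [e1 e2] ->; rewrite e1 e2 mulrDl.
Qed.

HB.instance Definition _ := GRing.Zmodule_isLmodule.Build R[i] L2
  scaleA scale1 scaleDr scaleDl.

Lemma L2_0E : {ae mu, forall t, (0 : L2) t = 0}.
Proof. exact: L2_zeroE. Qed.

Lemma L2_linE (a : R[i]) (f g : L2) :
  {ae mu, forall t, (a *: f + g : L2) t = a * f t + g t}.
Proof.
apply: filterS2 (L2_addE (a *: f) g) (L2_scaleE a f).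
by move=> t -> <-.
Qed.

Definition L2_form (f g : L2) := l2form mu f g.

Let L2_formDl a f g h : L2_form (a *: f + g) h = a * L2_form f h + L2_form g h.
Proof.
rewrite -(l2form_lin a (L2P f) (L2P g) (L2P h)).
by apply: l2form_ae; [exact: L2P | exact: lin_subproof | exact: L2P | exact: L2_linE].
Qed.

Let L2_formC f g : L2_form f g = Num.conj (L2_form g f).
Proof. exact: l2formC (L2P f) (L2P g). Qed.

Let L2_form_ge0 f : 0 <= L2_form f f.
Proof. exact: l2form_ge0. Qed.

Let L2_form_eq0 f : L2_form f f = 0 -> f = 0.
Proof.
move=> /(l2form_eq0 (L2P f)) f0; apply/L2_eqP.
by apply: filterS2 f0 L2_0E => t -> ->.
Qed.

HB.instance Definition _ := Lmodule_isInnerProduct.Build R L2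
  L2_formDl L2_formC L2_form_ge0 L2_form_eq0.

End L2_space.
Arguments L2 {d T R} mu.

Lemma product_sigma_finite d1 d2 (T1 : measurableType d1)
    (T2 : measurableType d2) (R : realType)
    (m1 : {sigma_finite_measure set T1 -> \bar R})
    (m2 : {sigma_finite_measure set T2 -> \bar R}) :
  sigma_finite setT (m1 \x m2)%E.
Proof.
have /sigma_finiteP[F [TF ndF Foo]] := sigma_finiteT m1.
have /sigma_finiteP[G [TG ndG Goo]] := sigma_finiteT m2.
exists (fun n => F n `*` G n).
  rewrite -setXTT TF TG predeqE => -[x y]; split.
    move=> [/= [n _ Fnx] [k _ Gky]]; exists (maxn n k) => //; split.
    - by move: x Fnx; exact/subsetPset/ndF/leq_maxl.
    - by move: y Gky; exact/subsetPset/ndG/leq_maxr.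
  by move=> [n _ []/= ? ?]; split; exists n.
move=> k; have [? ?] := Foo k; have [? ?] := Goo k.
split; first exact: measurableX.
by rewrite product_measure1E// lte_mul_pinfty// ge0_fin_numE.
Qed.

Section tuple_product_measure.
Context d (T : measurableType d) (R : realType).

Definition tuple_cons n (p : T * n.-tuple T) : n.+1.-tuple T :=
  [tuple of p.1 :: p.2].

Let measurable_tuple_cons n : measurable_fun setT (@tuple_cons n).
Proof. exact: (@measurable_cons _ _ (T * n.-tuple T)%type T fst n snd). Qed.

Section cons_measure.
Variables (n : nat) (m1 : {sigma_finite_measure set T -> \bar R}).
Variable (m2 : {sigma_finite_measure set (n.-tuple T) -> \bar R}).

Definition cons_measure := pushforward (m1 \x m2)%E (@tuple_cons n).

Let cons_measure0 : (cons_measure set0 = 0)%E.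
Proof. by rewrite /cons_measure /pushforward preimage_set0 measure0. Qed.

Let mpre A : measurable A -> measurable (@tuple_cons n @^-1` A).
Proof. by move=> mA; rewrite -[X in measurable X]setTI; exact: measurable_tuple_cons. Qed.

Let cons_measure_ge0 A : (0 <= cons_measure A)%E.
Proof. exact: (measure_ge0 (m1 \x m2)%E). Qed.

Let cons_measure_sigma_additive : semi_sigma_additive cons_measure.
Proof.
move=> F mF tF mUF; rewrite /cons_measure /pushforward preimage_bigcup.
apply: measure_semi_sigma_additive.
- by move=> k; exact: mpre.
- apply/trivIsetP => /= i j _ _ ij; rewrite -preimage_setI.
  by move/trivIsetP : tF => /(_ _ _ _ _ ij) ->//; rewrite preimage_set0.
- by rewrite -preimage_bigcup; exact: mpre.
Qed.

HB.instance Definition _ := isMeasure.Build _ _ _ cons_measure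
  cons_measure0 cons_measure_ge0 cons_measure_sigma_additive.

Let cons_measure_sigma_finite : sigma_finite setT cons_measure.
Proof.
have [F TF mF] := product_sigma_finite m1 m2.
pose g (t : n.+1.-tuple T) : T * n.-tuple T := (thead t, [tuple of behead t]).
have mg : measurable_fun setT g.
  apply/measurable_fun_pairP; split; last exact: measurable_behead.
  exact: measurable_tnth.
exists (fun k => g @^-1` F k).
  by rewrite -preimage_bigcup -TF preimage_setT.
move=> k; split.
  by rewrite -[X in measurable X]setTI; apply: mg => //; case: (mF k).
rewrite /cons_measure /pushforward.
rewrite (_ : _ @^-1` _ = F k); first by case: (mF k).
suff gK p : g (tuple_cons p) = p by apply/seteqP; split => p /=; rewrite gK.
by case: p => x t; rewrite /g theadE; congr pair; exact: val_inj.
Qed.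

HB.instance Definition _ := @isSigmaFinite.Build _ _ _ cons_measure cons_measure_sigma_finite.
HB.instance Definition _ := @isSFinite.Build _ _ _ cons_measure (sfinite_measure_sigma_finite cons_measure_sigma_finite).
End cons_measure.

(* The product of sigma-finite measures m_0, ..., m_(n-1). *)
Fixpoint tuple_measure n : ('I_n -> {sigma_finite_measure set T -> \bar R}) ->
    {sigma_finite_measure set (n.-tuple T) -> \bar R} :=
  match n with
  | 0 => fun=> \d_([tuple])
  | n'.+1 => fun m => cons_measure (m ord0) (tuple_measure (fun i => m (lift ord0 i)))
  end.
End tuple_product_measure.

Section Iq.
Context (R : realType) (q : R).

Definition Iq : set R := [set q ^- m | m in [set m | (0 < m)%N]].

Let measurable_Iq : measurable (Iq : set (measurableTypeR R)).
Proof.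
apply: countable_measurable; first exact: measurable_set1.
by apply: card_le_trans (card_image_le _ _) _; exact: countableP.
Qed.

(* The counting measure on I_q, as a Borel measure on the line carried by I_q. *)
Definition Iq_counting : set (measurableTypeR R) -> \bar R :=
  mrestr counting measurable_Iq.

HB.instance Definition _ := Measure.on Iq_counting.

Let Iq_counting_sigma_finite : sigma_finite setT Iq_counting.
Proof.
pose J (k : nat) : set R := [set q ^- m | m in [set m | (m <= k)%N]].
have fJ k : finite_set (J k).
  apply: finite_image; apply: (@sub_finite_set _ _ `I_k.+1) => // m.
exists (fun k => ~` Iq `|` J k).
  apply/seteqP; split => // x _.
  have [[m _ <-]|nI] := pselect (Iq x); last by exists 0%N => //; left.
  by exists m => //; right; exists m => //=.
move=> k; split.
  apply: measurableU; first exact: measurableC.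
  by apply: countable_measurable (finite_set_countable (fJ k)); exact: measurable_set1.
rewrite /Iq_counting /mrestr.
have fin : finite_set ((~` Iq `|` J k) `&` Iq).
  by apply: sub_finite_set (fJ k) => x [[nI /nI//|Jx _]].
by rewrite /counting asboolT// ltry.
Qed.

HB.instance Definition _ := @Measure_isSigmaFinite.Build _ _ _ Iq_counting Iq_counting_sigma_finite.
End Iq.

Local Open Scope complex_scope.

Section operators.
Context {R : realType}.

Definition lin_span (V : lmodType R[i]) (A : set V) : set V :=
  [set x | exists s : seq (R[i] * V),
     (forall p, p \in s -> A p.2) /\ x = \sum_(p <- s) p.1 *: p.2].

Definition linear_subspace (V : lmodType R[i]) (A : set V) :=
  A 0 /\ forall (a : R[i]) x y, A x -> A y -> A (a *: x + y).

(* A possibly unbounded operator on H is represented by its graph. *)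
Definition operator_graph (H : innerProductType R) (S : set (H * H)) :=
  linear_subspace S /\ forall x y z, S (x, y) -> S (x, z) -> y = z.

Definition adjoint (H : innerProductType R) (S : set (H * H)) : set (H * H) :=
  [set p | forall w, S w -> dotp w.2 p.1 = dotp w.1 p.2].

Definition spectrum (K : innerProductType R) (A : {linear K -> K}) : set R[i] :=
  [set l | ~ exists B : {linear K -> K}, [/\ continuous B,
     forall x, B (A x - l *: x) = x & forall x, A (B x) - l *: B x = x]].

Definition eigenvalue (K : innerProductType R) (A : {linear K -> K}) (l : R[i]) :=
  exists x, x <> 0 /\ A x = l *: x.

(* H is the completed orthogonal sum of the E a, embedded through iota. *)
Definition orthogonal_sum (H : innerProductType R) (I : Type)
    (E : I -> innerProductType R) (iota : forall a, {linear E a -> H}) :=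
  [/\ forall a x y, dotp (iota a x) (iota a y) = dotp x y,
      forall a b x y, a <> b -> dotp (iota a x) (iota b y) = 0 &
      dense (lin_span (\bigcup_a range (iota a)))].

(* z is a tuple of closed operators; Z i and Zs i are the restrictions of z i
   and of its adjoint to the common invariant dense domain D, on which the
   relations of O(C_q^n) hold. The last relation also covers the last
   generator, for which the sum is empty. *)
Definition star_representation (q : R) n (H : innerProductType R)
    (z : 'I_n -> set (H * H)) (D : set H) :=
  [/\ linear_subspace D, dense D,
      forall i, operator_graph (z i) /\ closed (z i) &
      exists Z Zs : 'I_n -> H -> H,
        (forall i x, D x -> [/\ z i (x, Z i x), adjoint (z i) (x, Zs i x),
                                D (Z i x) & D (Zs i x)]) /\
        forall x, D x -> [/\
          forall i j : 'I_n, (i < j)%N -> Z j (Z i x) = q%:C *: Z i (Z j x),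
          forall i j : 'I_n, j != i -> Z j (Zs i x) = q%:C *: Zs i (Z j x) &
          forall i : 'I_n, Z i (Zs i x) = (q ^+ 2)%:C *: Zs i (Z i x)
            - (1 - q ^+ 2)%:C *: \sum_(j < n | (i < j)%N) Zs j (Z j x)]].

Record opfamily n := OpFamily {
  opspace :> innerProductType R ;
  ops : 'I_n -> set (opspace * opspace) }.
Arguments ops {n}.

Definition zero_ops (H : innerProductType R) n : opfamily n :=
  @OpFamily n H (fun=> [set p | p.2 = 0]).

(* The direct sum of closed operators: (x, y) is in the graph exactly when, for
   each summand, the component of x is in the domain of the operator of that
   summand, which maps it to the component of y. Components are the orthogonal
   projections on the ranges of iota. *)
Definition is_direct_sum n (H : hilbertType R) (z : 'I_n -> set (H * H))
    (I : Type) (F : I -> opfamily n) :=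
  exists iota : forall a, {linear F a -> H}, orthogonal_sum iota /\
    forall j, z j = [set p | forall a, exists w : F a * F a,
      [/\ ops (F a) j w,
          forall y, dotp (p.1 - iota a w.1) (iota a y) = 0 &
          forall y, dotp (p.2 - iota a w.2) (iota a y) = 0]].

Definition unitarily_equivalent n (H H' : hilbertType R)
    (z : 'I_n -> set (H * H)) (z' : 'I_n -> set (H' * H')) :=
  exists U : {linear H -> H'}, [/\ bijective U,
    forall x y, dotp (U x) (U y) = dotp x y &
    forall j x y, z j (x, y) <-> z' j (U x, U y)].

End operators.
Arguments ops {R n} _ _.

Section standard_form.
Context {R : realType} (q : R) {n : nat}.

(* k : 'I_n is the 0-based version of the index k + 1 in 1, ..., n. The indices
   (i_1, ..., i_k, i_(k+1)) of the summand with index k are encoded as a pair i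
   with i_(l+1) = i.1 l + 1 >= 1 for l < k and with i_(k+1) = i.2 in Z. *)
Definition multi_index (k : nat) := ({ffun 'I_k -> nat} * int)%type.

Definition incr_index k (l : 'I_k) (i : multi_index k) : multi_index k :=
  ([ffun m => if m == l then (i.1 m).+1 else i.1 m], i.2).

Definition incr_last k (i : multi_index k) : multi_index k := (i.1, i.2 + 1).

Definition std_index := option {k : 'I_n & multi_index k}.

(* The summand H_0 is None; the copy of K k with indices i is Some (k, i). *)
Definition std_summand (H0 : hilbertType R) (K : 'I_n -> hilbertType R)
    (a : std_index) : hilbertType R :=
  if a is Some b then K (tag b) else H0.

Variables (H H0 : hilbertType R) (K : 'I_n -> hilbertType R).
Variable (A : forall k, {linear K k -> K k}).
Variable (iota : forall a, {linear std_summand H0 K a -> H}).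

Definition std_vec (k : 'I_n) (i : multi_index k) (h : K k) : H :=
  iota (Some (Tagged (fun k : 'I_n => multi_index k) i)) h.

Definition std_coef k (l : 'I_k) (i : multi_index k) : R :=
  Num.sqrt (q ^ (- 2 * (i.1 l).+1%:Z) - 1) *
  q ^ (- (\sum_(m < k | (l < m)%N) (i.1 m).+1%:Z + i.2)).

(* std_action j x y states that z_j maps x to y, for x in one of the summands. *)
Inductive std_action (j : 'I_n) : H -> H -> Prop :=
| Std_zero (h : H0) : std_action j (iota None h) 0
| Std_gt (k : 'I_n) (i : multi_index k) (h : K k) : (k < j)%N ->
    std_action j (std_vec i h) 0
| Std_eq (i : multi_index j) (h : K j) :
    std_action j (std_vec i h) ((q ^ (- i.2))%:C *: std_vec (incr_last i) (A j h))
| Std_lt (k : 'I_n) (l : 'I_k) (i : multi_index k) (h : K k) : l = j :> nat ->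
    std_action j (std_vec i h)
      ((std_coef l i)%:C *: std_vec (incr_index l i) (A k h)).

Definition std_domain : set H := lin_span (\bigcup_a range (iota a)).

Definition standard_form (z : 'I_n -> set (H * H)) :=
  [/\ orthogonal_sum iota,
      forall k, [/\ continuous (A k),
        forall x y, dotp (A k x) y = dotp x (A k y),
        forall l, spectrum (A k) l -> exists2 r : R, l = r%:C & q <= r <= 1 &
        ~ eigenvalue (A k) q%:C] &
      forall j, z j = closure (lin_span [set p | std_action j p.1 p.2])].

End standard_form.

Section model.
Context {R : realType} (q : R).

(* Borel measures on [0, oo[ are Borel measures on the line carried by [0, oo[. *)
Definition q_invariant (nu : set (measurableTypeR R) -> \bar R) :=
  nu [set x : R | x < 0] = 0%E /\
  forall M : set (measurableTypeR R), measurable M -> M `<=` [set x : R | 0 <= x] ->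
    nu [set q * x | x in (M : set R)] = nu M.

(* mu_(k+1) is carried by X_(q,k+1) = I_q^k * [0, oo[ inside R^(k+1), so that
   L_2(X_(q,k+1), mu_(k+1)) is L2 (model_measure k nu). *)
Definition model_measure k
    (nu : {sigma_finite_measure set (measurableTypeR R) -> \bar R}) :
    {sigma_finite_measure set (k.+1.-tuple (measurableTypeR R)) -> \bar R} :=
  tuple_measure (fun m : 'I_k.+1 =>
    if m == ord_max then nu
    else (Iq_counting q : {sigma_finite_measure set _ -> \bar R})).

(* The support of the class of f in L_2(mu), for mu a Borel measure on R^k. *)
Definition ess_supp k (mu : set (k.-tuple (measurableTypeR R)) -> \bar R)
    (f : k.-tuple (measurableTypeR R) -> R[i]) : set 'rV[R]_k :=
  [set v | forall U, nbhs v U ->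
     ~ {ae mu, forall t, U (\row_m tnth t m) -> f t = 0}].

Definition scale_coord k (l : 'I_k) (t : k.-tuple R) : k.-tuple R :=
  [tuple if m == l then q * tnth t m else tnth t m | m < k].

Definition model_action k (l : 'I_k.+1) (h : k.+1.-tuple R -> R[i])
    (t : k.+1.-tuple R) : R[i] :=
  if l == ord_max then (q * tnth t l)%:C * h (scale_coord l t)
  else (Num.sqrt ((q * tnth t l) ^+ 2 - 1) *
        \prod_(m < k.+1 | (l < m)%N) tnth t m)%:C * h (scale_coord l t).

Variables (n : nat) (k : 'I_n).
Variable nu : {sigma_finite_measure set (measurableTypeR R) -> \bar R}.
Let mu := model_measure k nu.

Definition model_domain : set (L2 mu) :=
  [set f : L2 mu | compact (ess_supp mu f) /\
    ess_supp mu f `<=` [set v | (forall m, m != ord_max -> Iq q (v 0 m)) /\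
                                0 < v 0 ord_max]].

Definition model_core (j : 'I_n) : set (L2 mu * L2 mu) :=
  [set p : L2 mu * L2 mu | [/\ model_domain p.1,
     (k < j)%N -> p.2 = 0 &
     forall l : 'I_k.+1, l = j :> nat ->
       {ae mu, forall t, p.2 t = model_action l p.1 t}]].

Definition model : opfamily n :=
  @OpFamily R n (L2 mu) (fun j => closure (model_core j)).

End model.
Arguments model_domain {R} q {n} k nu _.
Arguments model_core {R} q {n} k nu j _.
Arguments model {R} q {n} k nu.

(* Main.v *)
Require Import Defs.
From HB Require Import structures.
From mathcomp Require Import all_boot all_order all_algebra.
From mathcomp Require Import complex.
From mathcomp Require Import ring lra zify.
From mathcomp Require Import all_classical all_reals all_analysis measurable_realfun.
Set Implicit Arguments.
Unset Strict Implicit.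
Unset Printing Implicit Defensive.
Import Order.TTheory GRing.Theory Num.Theory.
Import numFieldNormedType.Exports.
Local Open Scope classical_set_scope.
Local Open Scope ring_scope.
Local Open Scope complex_scope.

(* A maximal family of vectors of K_k with mutually orthogonal cyclic subspaces under A_k
   decomposes K_k. On the cyclic subspace of x, A_k is multiplication by the variable on
   L_2(sigma), where sigma is the measure with moments <A_k^m x, x>; it is carried by ]q, 1],
   because spec(A_k) is contained in [q, 1] and q is not an eigenvalue. Since ]q, 1] is a
   fundamental domain for the dilation by q, sigma extends to a q-invariant measure nu on
   [0, oo[. Up to a null set, the model space is the disjoint union of the shells
   {(q^-i_1, ..., q^-i_k, q^-i_(k+1) s) : q < s <= 1}, each a copy of (]q, 1], sigma), and
   D_k consists of the functions that vanish on all but finitely many of them. Sending the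
   functions on the shell i to the cyclic subspace in the i-th copy of K_k intertwines the
   generators: the shell coordinate s contributes A_k, the other factors are constants.
   The direct sum is realized inside H itself, and the unitary is the identity. *)

(** * Inner product spaces *)

(** Of the spectral measure of a vector only the moments enter. They define a functional on
    polynomials that is positive on [q, 1], because a self-adjoint operator that is bounded below
    after the subtraction of any negative number has a nonnegative numerical range. The measure is
    rebuilt from the functional through a distribution function, and a uniqueness statement for
    functionals with the same distribution function shows that its moments are the prescribed ones.
    The obstacle is that the operators are unbounded and every model must itself be a
    *-representation. The relations are not computed in the model: an isometry [T] from a model
    space into H carries the model operators into the graphs of the z_j, the adjoints of the z_j map
    the image of the model domain into itself, and the relations are pulled back along [T]. The
    range of [T] reduces every z_j, so the component of a pair of the graph lies in the closed graph
    of the model operator, as the direct sum demands. The spaces K_k need not be separable, so the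
    family of summands may be uncountable; vectors of H are approximated by sums of finitely many
    components. *)

Section real_norm.
Context {R : realType}.

(** Norms over [R[i]] are values in [R[i]]; the real part brings them into the ordered field [R],
    where estimates are linear arithmetic. *)
Definition rnorm (V : normedZmodType R[i]) (x : V) : R := complex.Re `|x|.

Section normed_zmod.
Context {V : normedZmodType R[i]}.
Implicit Types x y : V.

Lemma rnormE x : `|x| = (rnorm x)%:C.
Proof. by have := normr_ge0 x; rewrite /rnorm; case: `|x| => a b; rewrite lecE/= => /andP[/eqP ->]. Qed.

Lemma rnorm_ge0 x : 0 <= rnorm x.
Proof. by rewrite -lecR -rnormE normr_ge0. Qed.

Lemma rnormD x y : rnorm (x + y) <= rnorm x + rnorm y.
Proof. by rewrite -lecR rmorphD/= -!rnormE ler_normD. Qed.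

Lemma rnormN x : rnorm (- x) = rnorm x.
Proof. by rewrite /rnorm normrN. Qed.

Lemma rnormB x y : rnorm (x - y) = rnorm (y - x).
Proof. by rewrite -rnormN opprB. Qed.

Lemma rnorm0 : rnorm (0 : V) = 0.
Proof. by rewrite /rnorm normr0. Qed.

Lemma rnorm_le0 x : rnorm x <= 0 -> x = 0.
Proof. by rewrite -lecR -rnormE normr_le0 => /eqP. Qed.

Lemma rnorm_dist x y z : rnorm (x - z) <= rnorm (x - y) + rnorm (y - z).
Proof. by apply: le_trans (rnormD _ _); rewrite addrA subrK. Qed.

Lemma eq_of_rnorm x y : (forall e : R, 0 < e -> rnorm (x - y) < e) -> x = y.
Proof.
move=> h; apply/eqP; rewrite -subr_eq0; apply/eqP/rnorm_le0.
by apply/ler_addgt0Pl => e /h /ltW; rewrite addr0.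
Qed.
End normed_zmod.

Lemma rnormZ (V : normedModType R[i]) (a : R[i]) (x : V) :
  rnorm (a *: x) = rnorm a * rnorm x.
Proof.
have : `|a *: x| = `|a| * `|x| by rewrite normrZ.
by rewrite !rnormE -rmorphM/= => -[].
Qed.

Lemma rnormM (a b : R[i]) : rnorm (a * b) = rnorm a * rnorm b.
Proof. by have := normrM a b; rewrite !rnormE -rmorphM/= => -[]. Qed.

Lemma rnormC (a : R) : rnorm a%:C = `|a|.
Proof. by rewrite /rnorm normc_def/= expr0n/= addr0 sqrtr_sqr. Qed.

Lemma Re_le_rnorm (a : R[i]) : `|complex.Re a| <= rnorm a.
Proof.
case: a => a b; rewrite /rnorm normc_def/= -(sqrtr_sqr a) ler_wsqrtr//.
by rewrite lerDl sqr_ge0.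
Qed.
End real_norm.

Section seq_closure.
Context {R : realType}.

Definition seq_cvg (V : normedZmodType R[i]) (u : nat -> V) (l : V) :=
  forall e : R, 0 < e -> exists N, forall n, (N <= n)%N -> rnorm (u n - l) < e.

Definition seq_cauchy (V : normedZmodType R[i]) (u : nat -> V) :=
  forall e : R, 0 < e -> exists N, forall m n, (N <= m)%N -> (N <= n)%N ->
    rnorm (u m - u n) < e.

(** A property of sequences rather than a structure, so that it covers both Hilbert types and
    [L2 mu], which is only an [innerProductType] and is shown complete in [L2_complete]. *)
Definition seq_complete (V : normedZmodType R[i]) :=
  forall u : nat -> V, seq_cauchy u -> exists l, seq_cvg u l.

Lemma gt0_realC (e : R[i]) : 0 < e -> exists2 r : R, 0 < r & e = r%:C.
Proof.
by case: e => a b; rewrite ltcE/= => /andP[/eqP -> a0]; exists a.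
Qed.

Lemma ltCR (x y : R) : (x%:C < y%:C :> R[i]) = (x < y).
Proof. by rewrite ltcE/= eqxx. Qed.

Lemma closureP (V : normedModType R[i]) (A : set V) x :
  closure A x <-> forall e : R, 0 < e -> exists2 y, A y & rnorm (x - y) < e.
Proof.
split=> [cA e e0|h B /nbhs_ballP[e /= /gt0_realC[r r0 ->]] eB].
  have e0' : 0 < e%:C :> R[i] by rewrite ltCR.
  have [y [Ay]] := cA _ (nbhsx_ballx x _ e0').
  by rewrite -ball_normE/= rnormE ltCR => xy; exists y.
have [y Ay xy] := h _ r0; exists y; split => //; apply: eB.
by rewrite -ball_normE/= rnormE ltCR.
Qed.

Lemma closure_pairP (V W : normedModType R[i]) (A : set (V * W)) x :
  closure A x <-> forall e : R, 0 < e ->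
    exists2 y, A y & rnorm (x.1 - y.1) < e /\ rnorm (x.2 - y.2) < e.
Proof.
split=> [cA e e0|h B /nbhs_ballP[e /= /gt0_realC[r r0 ->]] eB].
  have e0' : 0 < e%:C :> R[i] by rewrite ltCR.
  have [y [Ay]] := cA _ (nbhsx_ballx x _ e0').
  case=> /=; rewrite -!ball_normE/= !rnormE !ltCR => xy1 xy2.
  by exists y.
have [y Ay [xy1 xy2]] := h _ r0; exists y; split => //; apply: eB.
by split => /=; rewrite -ball_normE/= rnormE ltCR.
Qed.

Lemma denseP (V : normedModType R[i]) (A : set V) :
  dense A <-> forall x (e : R), 0 < e -> exists2 y, A y & rnorm (x - y) < e.
Proof.
split=> [dA x e e0|h W [x Wx] oW].
  have e0' : 0 < e%:C :> R[i] by rewrite ltCR.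
  have := nbhsx_ballx x _ e0'; rewrite nbhsE => -[W [oW Wx] We].
  have [y [Wy Ay]] := dA W (ex_intro _ x Wx) oW.
  by exists y => //; have := We _ Wy; rewrite -ball_normE/= rnormE ltCR.
have /closureP : forall e : R, 0 < e -> exists2 y, A y & rnorm (x - y) < e by exact: h.
move=> /(_ W (open_nbhs_nbhs (conj oW Wx))) [y [Ay Wy]].
by exists y.
Qed.

Lemma complete_seq (V : completeNormedModType R[i]) : seq_complete V.
Proof.
move=> u cu.
have : cauchy (u @ \oo).
  apply/cauchy_ballP => e /= /gt0_realC[r r0 ->].
  have [N hN] := cu _ r0.
  exists (u @` [set n | (N <= n)%N], u @` [set n | (N <= n)%N]).
    by split; exists N => //= n nN; exists n.
  move=> [_ _] /= [[m mN <-] [n nN <-]].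
  by rewrite -ball_normE/= rnormE ltCR; exact: hN.
move/cauchy_cvg => /cvg_ex[l ul]; exists l => e e0.
have e0' : 0 < e%:C :> R[i] by rewrite ltCR.
have [N _ hN] := ul _ (nbhsx_ballx l _ e0').
by exists N => n /hN; rewrite -ball_normE/= rnormE ltCR rnormB.
Qed.

End seq_closure.

Section inner_product.
Context {R : realType} {V : innerProductType R}.
Implicit Types x y z : V.

Lemma dotp0l z : dotp (0 : V) z = 0.
Proof. by have /eqP := dotpDl 1 (0 : V) 0 z; rewrite scaler0 addr0 mul1r -subr_eq subrr => /eqP <-. Qed.
Lemma dotpZl a x z : dotp (a *: x) z = a * dotp x z.
Proof. by rewrite -[a *: x]addr0 dotpDl dotp0l addr0. Qed.
Lemma dotpAl x y z : dotp (x + y) z = dotp x z + dotp y z.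
Proof. by rewrite -[x]scale1r dotpDl mul1r scale1r. Qed.
Lemma dotpNl x z : dotp (- x) z = - dotp x z.
Proof. by rewrite -scaleN1r dotpZl mulN1r. Qed.
Lemma dotpBl x y z : dotp (x - y) z = dotp x z - dotp y z.
Proof. by rewrite dotpAl dotpNl. Qed.
Lemma dotpZr a x z : dotp x (a *: z) = Num.conj a * dotp x z.
Proof. by rewrite dotpC dotpZl rmorphM/= -dotpC. Qed.
Lemma dotpAr x y z : dotp x (y + z) = dotp x y + dotp x z.
Proof. by rewrite dotpC dotpAl rmorphD/= -!dotpC. Qed.
Lemma dotpNr x z : dotp x (- z) = - dotp x z.
Proof. by rewrite dotpC dotpNl rmorphN/= -dotpC. Qed.
Lemma dotpBr x y z : dotp x (y - z) = dotp x y - dotp x z.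
Proof. by rewrite dotpAr dotpNr. Qed.
Lemma dotp0r z : dotp z (0 : V) = 0.
Proof. by rewrite dotpC dotp0l conjC0. Qed.
Lemma dotp_suml (I : Type) (s : seq I) (F : I -> V) z :
  dotp (\sum_(i <- s) F i) z = \sum_(i <- s) dotp (F i) z.
Proof. by elim/big_rec2 : _ => [|i u v _ <-]; rewrite ?dotp0l ?dotpAl. Qed.
Lemma dotp_sumr (I : Type) (s : seq I) (F : I -> V) z :
  dotp z (\sum_(i <- s) F i) = \sum_(i <- s) dotp z (F i).
Proof. by elim/big_rec2 : _ => [|i u v _ <-]; rewrite ?dotp0r ?dotpAr. Qed.

Lemma dotp_eq0C x y : dotp x y = 0 -> dotp y x = 0.
Proof. by move=> h; rewrite dotpC h conjC0. Qed.

Lemma dotp_rnorm x : dotp x x = (rnorm x ^+ 2)%:C.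
Proof. by rewrite dotpxx rnormE rmorphXn. Qed.

Lemma dotp_self_eq0 x : dotp x x = 0 -> x = 0.
Proof.
rewrite dotp_rnorm => -[/eqP]; rewrite sqrf_eq0 => /eqP x0.
by apply: rnorm_le0; rewrite x0.
Qed.

Lemma rnorm_sqrD x y :
  rnorm (x + y) ^+ 2 = rnorm x ^+ 2 + 2 * complex.Re (dotp x y) + rnorm y ^+ 2.
Proof.
have := dotp_rnorm (x + y).
rewrite dotpAl !dotpAr !dotp_rnorm (dotpC y x).
by case: (dotp x y) => a b [<- _]; rewrite /=; ring.
Qed.

Lemma rnorm_sqrB x y :
  rnorm (x - y) ^+ 2 = rnorm x ^+ 2 - 2 * complex.Re (dotp x y) + rnorm y ^+ 2.
Proof. by rewrite rnorm_sqrD rnormN dotpNr; case: dotp => a b /=; ring. Qed.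

Lemma pythagoras x y : dotp x y = 0 ->
  rnorm (x + y) ^+ 2 = rnorm x ^+ 2 + rnorm y ^+ 2.
Proof. by move=> xy; rewrite rnorm_sqrD xy /= mulr0 addr0. Qed.

Lemma dotp_CS x y : rnorm (dotp x y) <= rnorm x * rnorm y.
Proof.
have [->|y0] := eqVneq y 0; first by rewrite dotp0r !rnorm0 mulr0.
have ny0 : 0 < rnorm y.
  by rewrite lt_neqAle rnorm_ge0 andbT eq_sym; apply: contra_neq y0 => y0;
    apply: rnorm_le0; rewrite y0.
rewrite -(@ler_pXn2r _ 2)// ?nnegrE ?mulr_ge0 ?rnorm_ge0//.
pose c := dotp x y; pose b := rnorm y ^+ 2.
have b0 : 0 < b by rewrite exprn_gt0.
have := sqr_ge0 (rnorm (b%:C *: x - c *: y)).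
rewrite rnorm_sqrB !rnormZ dotpZl dotpZr -/c rnormC (ger0_norm (ltW b0)).
have -> : complex.Re (b%:C * (Num.conj c * c)) = b * rnorm c ^+ 2.
  have -> : Num.conj c * c = (rnorm c ^+ 2)%:C.
    by rewrite mulrC -normCK rnormE rmorphXn.
  by rewrite -rmorphM.
rewrite !exprMn -/b.
set n := rnorm c ^+ 2; set a := rnorm x ^+ 2 => h.
by rewrite -(ler_pM2l b0); nra.
Qed.

Lemma dotp_closure0 (A : set V) x y : (forall z, A z -> dotp z y = 0) ->
  closure A x -> dotp x y = 0.
Proof.
move=> h /closureP cx; apply: eq_of_rnorm => e e0; rewrite subr0.
have y1 : 0 < rnorm y + 1 by rewrite ltr_wpDl ?rnorm_ge0.
have [z Az xz] := cx (e / (rnorm y + 1)) (divr_gt0 e0 y1).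
have -> : dotp x y = dotp (x - z) y by rewrite dotpBl (h _ Az) subr0.
apply: le_lt_trans (dotp_CS _ _) _.
rewrite ltr_pdivlMr// in xz; apply: le_lt_trans xz.
by rewrite ler_wpM2l ?rnorm_ge0// lerDl.
Qed.

Lemma closure_subspace (A : set V) : linear_subspace A -> linear_subspace (closure A).
Proof.
move=> [A0 AD]; split; first exact: subset_closure.
move=> a x y /closureP cx /closureP cy; apply/closureP => e e0.
have a1 : 0 < rnorm a + 1 by rewrite ltr_wpDl ?rnorm_ge0.
have a2 : 0 < 2 * (rnorm a + 1) by rewrite mulr_gt0.
have e2 : 0 < e / 2 by rewrite divr_gt0.
have [x' Ax' xx'] := cx _ (divr_gt0 e0 a2).
have [y' Ay' yy'] := cy _ e2.
exists (a *: x' + y'); first exact: AD.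
rewrite opprD addrACA -scalerBr.
apply: le_lt_trans (rnormD _ _) _; rewrite rnormZ.
rewrite ltr_pdivlMr// in xx'; rewrite ltr_pdivlMr// in yy'.
have := rnorm_ge0 a; have := rnorm_ge0 (x - x'); nra.
Qed.

End inner_product.

Section lin_span.
Context {R : realType}.
Implicit Types V W : lmodType R[i].

Lemma lin_span_subspace V (A : set V) : linear_subspace (lin_span A).
Proof.
split; first by exists [::]; split => //; rewrite big_nil.
move=> a _ _ [s [sA ->]] [t [tA ->]].
exists ([seq (a * p.1, p.2) | p <- s] ++ t); split.
  move=> p; rewrite mem_cat => /orP[/mapP[r rs ->]/=|]; [exact: sA|exact: tA].
rewrite big_cat big_map scaler_sumr; congr (_ + _).
by apply: eq_bigr => i _; rewrite scalerA.
Qed.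

Lemma subspaceZ V (A : set V) a x : linear_subspace A -> A x -> A (a *: x).
Proof. by move=> [A0 AD] Ax; rewrite -[_ *: _]addr0; exact: AD. Qed.
Lemma subspaceD V (A : set V) x y : linear_subspace A -> A x -> A y -> A (x + y).
Proof. by move=> [A0 AD] Ax Ay; rewrite -[x]scale1r; exact: AD. Qed.
Lemma subspace_sum V (A : set V) (I : eqType) (s : seq I) (F : I -> V) :
  linear_subspace A -> (forall i, i \in s -> A (F i)) -> A (\sum_(i <- s) F i).
Proof.
move=> hA hF; rewrite big_seq; elim/big_ind : _ => //; first by case: hA.
by move=> x y; exact: subspaceD.
Qed.

Lemma sub_lin_span V (A : set V) : A `<=` lin_span A.
Proof.
move=> x Ax; exists [:: (1, x)]; split; last by rewrite big_seq1 scale1r.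
by move=> p; rewrite inE => /eqP ->.
Qed.

Lemma lin_span_min V (A B : set V) : linear_subspace B -> A `<=` B -> lin_span A `<=` B.
Proof.
move=> hB AB _ [s [sA ->]]; apply: subspace_sum => // p ps.
by apply: subspaceZ => //; exact/AB/sA.
Qed.

Lemma lin_span_mono V (A B : set V) : A `<=` B -> lin_span A `<=` lin_span B.
Proof.
by move=> AB; apply: lin_span_min; [exact: lin_span_subspace|move=> x /AB; exact: sub_lin_span].
Qed.

Lemma preimage_subspace V W (f : {linear V -> W}) (A : set W) :
  linear_subspace A -> linear_subspace (f @^-1` A).
Proof.
by move=> [A0 AD]; split=> [|a x y] /=; rewrite ?linear0 ?linearP//; exact: AD.
Qed.

Lemma range_subspace V W (f : {linear V -> W}) : linear_subspace (range f).
Proof.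
split; first by exists 0; rewrite ?linear0.
by move=> a _ _ [x _ <-] [y _ <-]; exists (a *: x + y); rewrite ?linearP.
Qed.
End lin_span.

Lemma closure_pair_subspace (R : realType) (V : innerProductType R)
  (A : set (V * V)) : linear_subspace A -> linear_subspace (closure A).
Proof.
move=> [A0 AD]; split; first exact: subset_closure.
move=> a x y /closure_pairP cx /closure_pairP cy; apply/closure_pairP => e e0.
have a1 : 0 < rnorm a + 1 by rewrite ltr_wpDl ?rnorm_ge0.
have a2 : 0 < 2 * (rnorm a + 1) by rewrite mulr_gt0.
have e2 : 0 < e / 2 by rewrite divr_gt0.
have [x' Ax' [xx1 xx2]] := cx _ (divr_gt0 e0 a2).
have [y' Ay' [yy1 yy2]] := cy _ e2.
have H (u u' v v' : V) : rnorm (u - u') < e / (2 * (rnorm a + 1)) ->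
    rnorm (v - v') < e / 2 -> rnorm (a *: u + v - (a *: u' + v')) < e.
  move=> uu vv; rewrite opprD addrACA -scalerBr.
  apply: le_lt_trans (rnormD _ _) _; rewrite rnormZ.
  rewrite ltr_pdivlMr// in uu; rewrite ltr_pdivlMr// in vv.
  have := rnorm_ge0 a; have := rnorm_ge0 (u - u'); nra.
by exists (a *: x' + y'); [exact: AD|split; exact: H].
Qed.

Lemma inv_natS_lt (R : realType) (e : R) : 0 < e ->
  exists N, forall n, (N <= n)%N -> n.+1%:R^-1 < e.
Proof.
move=> e0; have [N _ hN] := near_infty_natSinv_lt (PosNum e0).
by exists N => n /hN.
Qed.

Lemma dense_family (R : realType) (V : innerProductType R) (A : set V) x :
  closure A x -> exists2 u : nat -> V, (forall n, A (u n)) & seq_cvg u x.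
Proof.
move=> /closureP cx.
have /choice[u hu] : forall n : nat, exists y, A y /\ rnorm (x - y) < n.+1%:R^-1.
  by move=> n; have [|y Ay xy] := cx (n.+1%:R^-1); [rewrite invr_gt0|exists y].
exists u => [n|e e0]; first by case: (hu n).
have [N hN] := inv_natS_lt e0; exists N => n /hN; apply: lt_trans.
by rewrite rnormB; case: (hu n).
Qed.

(** * Orthogonal projections and isometries *)

Section projection.
Context {R : realType} {V : innerProductType R}.
Variables (M : set V) (sM : linear_subspace M) (p : V).

Let d2 : set R := [set rnorm (p - y) | y in M].
Let d := inf d2.

Let has_inf_d2 : has_inf d2.
Proof.
split; first by exists (rnorm (p - 0)), 0 => //; case: sM.
by exists 0 => _ [y _ <-]; exact: rnorm_ge0.
Qed.

Let d_le y : M y -> d <= rnorm (p - y).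
Proof. by move=> My; apply: ge_inf; [case: has_inf_d2|exists y]. Qed.

Let d_ge0 : 0 <= d.
Proof. by apply: lb_le_inf; [case: has_inf_d2|move=> _ [y _ <-]; exact: rnorm_ge0]. Qed.

Let minimizing_cauchy (u : nat -> V) : (forall n, M (u n)) ->
  (forall n, rnorm (p - u n) < d + n.+1%:R^-1) -> seq_cauchy u.
Proof.
move=> Mu hu e e0.
(* parallelogram law: |u-v|^2 <= 2|p-u|^2 + 2|p-v|^2 - 4 d^2 *)
have key m n : rnorm (u m - u n) ^+ 2 <=
    2 * rnorm (p - u m) ^+ 2 + 2 * rnorm (p - u n) ^+ 2 - 4 * d ^+ 2.
  have M2 : M ((2^-1)%:C *: (u m + u n)) by apply: (subspaceZ _ sM); apply: (subspaceD sM).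
  have := d_le M2.
  have -> : p - (2^-1)%:C *: (u m + u n) = (2^-1)%:C *: ((p - u m) + (p - u n)).
    rewrite addrACA -opprD scalerBr -[X in (X + X)]scale1r -scalerDl scalerA.
    by rewrite -[1 + 1]/(2%:R) -(rmorph_nat (@real_complex R)) -rmorphM mulVf ?pnatr_eq0// scale1r.
  rewrite rnormZ rnormC ger0_norm ?invr_ge0// => dl.
  have := rnorm_sqrD (p - u m) (p - u n).
  have := rnorm_sqrB (p - u m) (p - u n).
  have -> : p - u m - (p - u n) = u n - u m by rewrite opprB addrC addrA subrK.
  rewrite (rnormB (u n)) => -> h2.
  have h3 : (2 * d) ^+ 2 <= rnorm (p - u m + (p - u n)) ^+ 2.
    by rewrite ler_pXn2r// ?nnegrE ?mulr_ge0 ?rnorm_ge0//; lra.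
  move: h2 h3; rewrite !expr2; lra.
(* [key] and [aux] bound the squared distance by [2 (2 d + 1) (s + t)], where [s] and [t] are the
   reciprocals of [m.+1] and [n.+1]. With both below [e^2 / (8 d + 5)] this is less than [e^2]. *)
have c0 : 0 < e ^+ 2 / (8 * d + 5).
  by rewrite divr_gt0 ?exprn_gt0// ltr_wpDl ?mulr_ge0.
have [N hN] := inv_natS_lt c0; exists N => m n mN nN.
rewrite -(@ltr_pXn2r _ 2)// ?nnegrE ?rnorm_ge0// ?ltW//.
apply: le_lt_trans (key m n) _.
have aux k : (N <= k)%N -> rnorm (p - u k) ^+ 2 <= d ^+ 2 + (2 * d + 1) * k.+1%:R^-1.
  move=> kN; have := hu k; have := rnorm_ge0 (p - u k).
  have : k.+1%:R^-1 <= 1 :> R by rewrite invf_le1// ler1n.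
  have : 0 < k.+1%:R^-1 :> R by rewrite invr_gt0.
  set t := _^-1; set r := rnorm _ => t0 t1 r0 rd.
  have : r ^+ 2 <= (d + t) ^+ 2 by rewrite ler_pXn2r// ?nnegrE; [exact: ltW|apply: addr_ge0 => //; exact: ltW].
  have : t * t <= t * 1 by rewrite ler_pM2l.
  by rewrite !expr2; lra.
have am := aux _ mN; have an := aux _ nN.
have := hN _ mN; have := hN _ nN.
have dd : 0 < 8 * d + 5 by rewrite ltr_wpDl ?mulr_ge0.
rewrite !ltr_pdivlMr//.
move: am an; set s := m.+1%:R^-1; set t := n.+1%:R^-1 => am an ht hs.
have s0 : 0 < s by rewrite invr_gt0.
have t0 : 0 < t by rewrite invr_gt0.
nra.
Qed.

(** [w] is the limit of a minimizing sequence, which is Cauchy by the parallelogram law. Moving [w]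
    along [y] by [c / |y|^2], with [c] the inner product of [p - w] and [y], would lower the squared
    distance by [|c|^2 / |y|^2], so [c = 0]. *)
Lemma projection : seq_complete V ->
  exists2 w, closure M w & forall y, M y -> dotp (p - w) y = 0.
Proof.
move=> cV.
have /choice[u hu] : forall n : nat, exists y, M y /\ rnorm (p - y) < d + n.+1%:R^-1.
  move=> n; have n0 : 0 < n.+1%:R^-1 :> R by rewrite invr_gt0.
  have [_ [y My <-] hy] := inf_adherent n0 has_inf_d2.
  by exists y.
have [w hw] := cV u (minimizing_cauchy (fun n => (hu n).1) (fun n => (hu n).2)).
have cw : closure M w.
  apply/closureP => e /hw[N /(_ N (leqnn N))]; rewrite rnormB => hN.
  by exists (u N) => //; exact: (hu N).1.
exists w => // y My.
have dw z : closure M z -> d <= rnorm (p - z).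
  move=> /closureP cz; apply/ler_addgt0Pl => e /cz[x Mx zx].
  apply: le_trans (d_le Mx) _; apply: le_trans (rnorm_dist p z x) _.
  by rewrite addrC lerD2r ltW.
have wd : rnorm (p - w) <= d.
  apply/ler_addgt0Pl => e e0; have e2 : 0 < e / 2 by rewrite divr_gt0.
  have [N1 h1] := hw _ e2; have [N2 h2] := inv_natS_lt e2.
  have {}h1 := h1 _ (leq_maxl N1 N2); have {}h2 := h2 _ (leq_maxr N1 N2).
  have := (hu (maxn N1 N2)).2; have := rnorm_dist p (u (maxn N1 N2)) w.
  by move: h2; set t := _^-1; lra.
have [y0|y0] := eqVneq y 0; first by rewrite y0 dotp0r.
have ny0 : 0 < rnorm y.
  rewrite lt_neqAle rnorm_ge0 andbT eq_sym; apply: contra_neq y0 => y0.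
  by apply: rnorm_le0; rewrite y0.
pose c := dotp (p - w) y; pose b := rnorm y ^+ 2.
have b0 : 0 < b by rewrite exprn_gt0.
have cz : closure M (w + (c / b%:C) *: y).
  have scM := closure_subspace sM.
  apply: (subspaceD scM) => //; apply: (subspaceZ _ scM); exact: subset_closure.
have := le_trans wd (dw _ cz).
rewrite -(@ler_pXn2r _ 2)// ?nnegrE ?rnorm_ge0// opprD addrA (rnorm_sqrB (p - w)) rnormZ dotpZr -/c.
have nc : rnorm (c / b%:C) = rnorm c / b.
  by rewrite rnormM -[b%:C^-1]fmorphV rnormC ger0_norm// invr_ge0 ltW.
have -> : complex.Re (Num.conj (c / b%:C) * c) = rnorm c ^+ 2 / b.
  have -> : Num.conj (c / b%:C) * c = (rnorm c ^+ 2)%:C * (b^-1)%:C.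
    rewrite rmorphM/= -fmorphV mulrAC; congr (_ * _); last first.
      by apply/eqP; rewrite eq_complex/= oppr0 !eqxx.
    by rewrite mulrC -normCK rnormE rmorphXn.
  by rewrite -rmorphM.
rewrite exprMn nc exprMn exprVn.
have -> : rnorm c ^+ 2 * (b ^+ 2)^-1 * rnorm y ^+ 2 = rnorm c ^+ 2 / b.
  by rewrite -/b; field; rewrite gt_eqF.
rewrite -addrA lerDl => h.
have : rnorm c ^+ 2 / b <= 0 by lra.
rewrite pmulr_lle0 ?invr_gt0// => c0.
apply: rnorm_le0; have := rnorm_ge0 c; rewrite -/c; nra.
Qed.

End projection.

(** The difference of [x] and its projection on the span is orthogonal to [A], hence zero. Every
    density statement about an L_2 space below is reduced to a trivial orthogonal complement in this
    way. *)
Lemma orthogonal_dense (R : realType) (V : innerProductType R) (A : set V) :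
  seq_complete V -> (forall x, (forall y, A y -> dotp x y = 0) -> x = 0) ->
  forall x : V, closure (lin_span A) x.
Proof.
move=> cV hA x.
have [w cw xw] := projection (lin_span_subspace A) x cV.
have /eqP := hA (x - w) (fun y Ay => xw y (sub_lin_span Ay)).
by rewrite subr_eq0 => /eqP ->.
Qed.

Section isometry.
Context {R : realType}.
Implicit Types V W : innerProductType R.

Definition isometric V W (T : V -> W) := forall x y, dotp (T x) (T y) = dotp x y.

Lemma isometric_rnorm V W (T : V -> W) x : isometric T -> rnorm (T x) = rnorm x.
Proof.
move=> iT; have := iT x x; rewrite !dotp_rnorm => -[/eqP].
by rewrite eqrXn2 ?rnorm_ge0// => /eqP.
Qed.

(** Polarization: norms of sums give the real parts of inner products, and replacing [x] by
    ['i *: x] gives the imaginary parts. *)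
Lemma isometric_of_rnorm V W (T : {linear V -> W}) :
  (forall x, rnorm (T x) = rnorm x) -> isometric T.
Proof.
move=> hT x y.
have Re_eq v w : complex.Re (dotp (T v) (T w)) = complex.Re (dotp v w).
  have := rnorm_sqrD (T v) (T w); rewrite -linearD /= !hT.
  by rewrite rnorm_sqrD => /addIr/addrI/(mulfI _); rewrite pnatr_eq0 => /(_ isT).
apply/eqP; rewrite eq_complex Re_eq eqxx/=.
have := Re_eq ('i *: x) y; rewrite linearZ !dotpZl -complexiE.
by case: (dotp (T x) (T y)) (dotp x y) => ? ? [? ?] /=; rewrite !mul0r !mul1r !sub0r => /oppr_inj ->.
Qed.

Lemma isometric_inj V W (T : {linear V -> W}) : isometric T -> injective T.
Proof.
move=> iT x y xy; apply/eqP; rewrite -subr_eq0; apply/eqP/rnorm_le0.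
by rewrite -(isometric_rnorm _ iT) linearB/= xy subrr rnorm0.
Qed.

Lemma isometric_closure V W (T : {linear V -> W}) : isometric T ->
  seq_complete V -> closure (range T) `<=` range T.
Proof.
move=> iT cV w /dense_family[u Au uw].
have /choice[v hv] : forall n, exists x, T x = u n by move=> n; case: (Au n) => x _; exists x.
have : seq_cauchy v.
  move=> e e0; have [N hN] := uw _ (divr_gt0 e0 (ltr0n _ 2)).
  exists N => m n mN nN; rewrite -(isometric_rnorm _ iT) linearB !hv.
  apply: le_lt_trans (rnorm_dist _ w _) _; rewrite (rnormB w).
  have := hN _ mN; have := hN _ nN; lra.
move=> /cV[l vl]; exists l => //; apply: eq_of_rnorm => e e0.
have e2 := divr_gt0 e0 (ltr0n R 2).
have [N1 h1] := uw _ e2; have [N2 h2] := vl _ e2.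
have {}h1 := h1 _ (leq_maxl N1 N2); have {}h2 := h2 _ (leq_maxr N1 N2).
apply: le_lt_trans (rnorm_dist _ (u (maxn N1 N2)) _) _.
rewrite -{1}hv -linearB isometric_rnorm// (rnormB l); lra.
Qed.

(** The vector [x] is the adjoint of [T] applied to [p]. The range of [T] is closed since [V] is
    complete, so the projection of [p] is attained in it. *)
Lemma isometric_projection V W (T : {linear V -> W}) : isometric T ->
  seq_complete V -> seq_complete W ->
  forall p, exists x, forall y, dotp (p - T x) (T y) = 0.
Proof.
move=> iT cV cW p.
have [w cw pw] := projection (range_subspace T) p cW.
have [x _ xw] := isometric_closure iT cV cw.
by exists x => y; rewrite xw; apply: pw; exists y.
Qed.

End isometry.

(** * Isometries determined by Gram matrices *)

Section gram.
Context {R : realType} {V W : innerProductType R}.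
Variables (J : Type) (g : J -> V) (u : J -> W).
Hypothesis gram : forall i j, dotp (u i) (u j) = dotp (g i) (g j).
Hypothesis g_dense : forall x : V, closure (lin_span (range g)) x.
Hypothesis cW : seq_complete W.

(** The assignment of [u j] to [g j] on formal combinations. The [g j] may be linearly dependent, so
    it is kept as a relation; that it is single-valued follows from [G_rnorm]. *)
Let G : set (V * W) := [set p | exists s : seq (R[i] * J),
  p.1 = \sum_(c <- s) c.1 *: g c.2 /\ p.2 = \sum_(c <- s) c.1 *: u c.2].

Let G_lin a p p' : G p -> G p' -> G (a *: p.1 + p'.1, a *: p.2 + p'.2).
Proof.
move=> [s [-> ->]] [t [-> ->]].
exists ([seq (a * c.1, c.2) | c <- s] ++ t); split => /=; rewrite big_cat big_map/= scaler_sumr; congr (_ + _);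
  by apply: eq_bigr => i _; rewrite scalerA.
Qed.

Let G_dotp p p' : G p -> G p' -> dotp p.2 p'.2 = dotp p.1 p'.1.
Proof.
move=> [s [-> ->]] [t [-> ->]]; rewrite !dotp_suml; apply: eq_bigr => i _.
rewrite !dotp_sumr; apply: eq_bigr => j _.
by rewrite !dotpZl !dotpZr gram.
Qed.

Let G_rnorm p p' : G p -> G p' -> rnorm (p.2 - p'.2) = rnorm (p.1 - p'.1).
Proof.
move=> Gp Gp'; have Gd : G (p.1 - p'.1, p.2 - p'.2).
  by have := G_lin (-1) Gp' Gp; rewrite !scaleN1r ![- _ + _]addrC.
have := G_dotp Gd Gd; rewrite !dotp_rnorm /= => -[/eqP].
by rewrite eqrXn2 ?rnorm_ge0// => /eqP.
Qed.

Let G_dense x : closure [set y | exists z, G (y, z)] x.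
Proof.
have sub : lin_span (range g) `<=` [set y | exists z, G (y, z)].
  apply: lin_span_min => [|_ [j _ <-]].
    split; first by exists 0, [::]; rewrite !big_nil.
    move=> a y y' [z Gz] [z' Gz']; exists (a *: z + z').
    exact: (G_lin a Gz Gz').
  by exists (u j), [:: (1, j)]; rewrite !big_seq1 !scale1r.
exact: (closureS sub (@g_dense x)).
Qed.

Let ext x y := forall e : R, 0 < e ->
  exists2 p, G p & rnorm (x - p.1) < e /\ rnorm (y - p.2) < e.

Let ext_ex x : exists y, ext x y.
Proof.
have [v hv vx] := dense_family (@G_dense x).
have /choice[w hw] : forall n, exists z, G (v n, z) by [].
have : seq_cauchy w.
  move=> e e0; have [N hN] := vx _ (divr_gt0 e0 (ltr0n _ 2)).
  exists N => m n mN nN; rewrite (G_rnorm (hw m) (hw n)).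
  apply: le_lt_trans (rnorm_dist _ x _) _; rewrite (rnormB x).
  have := hN _ mN; have := hN _ nN; lra.
move=> /cW[y wy]; exists y => e e0.
have [N1 h1] := vx _ e0; have [N2 h2] := wy _ e0.
exists (v (maxn N1 N2), w (maxn N1 N2)) => //=.
split; rewrite rnormB; [exact: h1 (leq_maxl N1 N2)|exact: h2 (leq_maxr N1 N2)].
Qed.

Let ext_uniq x y y' : ext x y -> ext x y' -> y = y'.
Proof.
move=> h h'; apply: eq_of_rnorm => e e0.
have e4 := divr_gt0 e0 (ltr0n R 4).
have [p Gp [p1 p2]] := h _ e4; have [p' Gp' [p1' p2']] := h' _ e4.
have := G_rnorm Gp Gp'; have := rnorm_dist p.1 x p'.1.
have := rnorm_dist y p.2 y'; have := rnorm_dist p.2 p'.2 y'.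
rewrite (rnormB p.1 x) (rnormB p'.2 y'); lra.
Qed.

Let ext_lin a x y x' y' : ext x y -> ext x' y' -> ext (a *: x + x') (a *: y + y').
Proof.
move=> h h' e e0.
have a1 : 0 < rnorm a + 1 by rewrite ltr_wpDl ?rnorm_ge0.
have a2 : 0 < 2 * (rnorm a + 1) by rewrite mulr_gt0.
have [p Gp [p1 p2]] := h _ (divr_gt0 e0 a2).
have [p' Gp' [p1' p2']] := h' _ (divr_gt0 e0 (ltr0n R 2)).
exists (a *: p.1 + p'.1, a *: p.2 + p'.2); first exact: G_lin.
have H (U : innerProductType R) (v v' w w' : U) :
    rnorm (v - v') < e / (2 * (rnorm a + 1)) ->
    rnorm (w - w') < e / 2 -> rnorm (a *: v + w - (a *: v' + w')) < e.
  move=> uu vv; rewrite opprD addrACA -scalerBr.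
  apply: le_lt_trans (rnormD _ _) _; rewrite rnormZ.
  rewrite ltr_pdivlMr// in uu; rewrite ltr_pdivlMr// in vv.
  have := rnorm_ge0 a; have := rnorm_ge0 (v - v'); nra.
by split; exact: H.
Qed.

Let ext_rnorm x y : ext x y -> rnorm y = rnorm x.
Proof.
move=> h; apply/eqP; rewrite eq_le; apply/andP; split; apply/ler_addgt0Pl => e e0;
  have [p Gp [p1 p2]] := h _ (divr_gt0 e0 (ltr0n R 2));
  have G0 : G (0, 0) by exists [::]; rewrite !big_nil.
all: have := G_rnorm Gp G0; rewrite /= !subr0.
  have := rnorm_dist y p.2 0; have := rnorm_dist p.1 x 0.
  by rewrite !subr0 (rnormB p.1); lra.
have := rnorm_dist x p.1 0; have := rnorm_dist p.2 y 0.
by rewrite !subr0 (rnormB p.2); lra.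
Qed.

(** Equal Gram matrices make the relation [G] isometric, hence single-valued. Density of the span
    and completeness of [W] extend it to all of [V]: [ext] is the closure of [G]. *)
Lemma gram_extension : exists T : {linear V -> W}, isometric T /\ forall j, T (g j) = u j.
Proof.
have /choice[T hT] := ext_ex.
have lT : linear T by move=> a x y; apply: ext_uniq (hT _) _; exact: ext_lin.
pose Tm := GRing.isLinear.Build _ _ _ _ T lT.
pose TL : {linear V -> W} := HB.pack T Tm.
exists TL; split=> [|j]; first by apply: (@isometric_of_rnorm _ _ _ TL) => x; exact: ext_rnorm (hT x).
apply: ext_uniq (hT _) _ => e e0; exists (g j, u j); last by rewrite /= !subrr !rnorm0.
by exists [:: (1, j)]; rewrite !big_seq1 !scale1r.
Qed.
End gram.

(** * Positivity of polynomials in a self-adjoint operator *)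

Section bounded_operator.
Context {R : realType}.

Definition bounded_op (V W : normedZmodType R[i]) (T : V -> W) :=
  exists2 C : R, 0 < C & forall x, rnorm (T x) <= C * rnorm x.

Lemma continuous_bounded_op (V W : innerProductType R) (T : {linear V -> W}) :
  continuous T -> bounded_op T.
Proof.
move=> cT.
have e1 : (0 : R[i]) < 1%:C by rewrite ltCR.
have := cT 0 _ (nbhsx_ballx (T 0) _ e1).
rewrite /= => /nbhs_ballP[d /= /gt0_realC[r r0 ->]] hr.
have hr' x : rnorm x < r -> rnorm (T x) < 1.
  move=> xr; have : ball (0 : V) r%:C x.
    by rewrite -ball_normE/= rnormE ltCR sub0r rnormN.
  by move=> /hr /=; rewrite -ball_normE/= rnormE ltCR linear0 sub0r rnormN.
exists (2 / r); first by rewrite divr_gt0.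
move=> x; have [->|x0] := eqVneq x 0; first by rewrite linear0 !rnorm0 mulr0.
have nx0 : 0 < rnorm x.
  rewrite lt_neqAle rnorm_ge0 andbT eq_sym; apply: contra_neq x0 => x0.
  by apply: rnorm_le0; rewrite x0.
pose a : R := r / (2 * rnorm x).
have a0 : 0 < a by rewrite divr_gt0 ?mulr_gt0.
have := hr' (a%:C *: x); rewrite linearZ !rnormZ rnormC (gtr0_norm a0).
have -> : a * rnorm x = r / 2 by rewrite /a; field; rewrite gt_eqF.
move=> /(_ ltac:(lra)) aT.
have -> : 2 / r * rnorm x = a^-1 by rewrite /a; field; rewrite !gt_eqF.
by rewrite -(ler_pM2l a0) mulfV ?gt_eqF// ltW.
Qed.

End bounded_operator.

Section numerical_range.
Context {R : realType} {V : innerProductType R}.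
Variable B : V -> V.
Hypothesis linB : linear B.
Hypothesis bB : bounded_op B.
Hypothesis sB : forall x y, dotp (B x) y = dotp x (B y).

Let N x := complex.Re (dotp (B x) x).

(* If m < 0 is the infimum of the numerical range, then
   |(B - m) x|^2 <= M <(B - m) x, x>, so that B - m is not bounded below. *)
Lemma numerical_range_ge0 :
  (forall l : R, l < 0 -> exists c : R, forall x, rnorm x <= c * rnorm (B x - l%:C *: x)) ->
  forall x, 0 <= N x.
Proof.
move=> hB x0; rewrite leNgt; apply/negP => Nx0.
have [b b0 hb] := bB.
have NZ (a : R) x : N (a%:C *: x) = a ^+ 2 * N x.
  have linB0 : B 0 = 0.
    by have /eqP := linB 1 0 0; rewrite !scale1r addr0 -subr_eq subrr => /eqP <-.
  rewrite /N; have -> : B (a%:C *: x) = a%:C *: B x by rewrite -[_ *: x]addr0 linB linB0 addr0.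
  rewrite dotpZl dotpZr; case: (dotp (B x) x) => u v /=; ring.
have Nb x : `|N x| <= b * rnorm x ^+ 2.
  apply: le_trans (Re_le_rnorm _) _; apply: le_trans (dotp_CS _ _) _.
  by rewrite expr2 mulrA ler_wpM2r ?rnorm_ge0.
pose S := [set N x | x in [set x | rnorm x = 1]].
have x00 : 0 < rnorm x0.
  rewrite lt_neqAle rnorm_ge0 andbT eq_sym; apply: contraTneq Nx0 => h.
  by have := Nb x0; rewrite h expr0n/= mulr0 normr_le0 => /eqP ->; rewrite ltxx.
have S0 : S (N ((rnorm x0)^-1%:C *: x0)).
  by exists ((rnorm x0)^-1%:C *: x0) => //=; rewrite rnormZ rnormC gtr0_norm ?invr_gt0// mulVf ?gt_eqF.
have iS : has_inf S.
  split; first by eexists; exact: S0.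
  exists (- b) => _ [x /= x1 <-].
  by have := Nb x; rewrite x1 expr1n mulr1 ler_norml => /andP[].
pose m := inf S.
have m0 : m < 0.
  apply: le_lt_trans (ge_inf iS.2 S0) _; rewrite NZ pmulr_rlt0//.
  by rewrite exprn_gt0// invr_gt0.
have Nm x : m * rnorm x ^+ 2 <= N x.
  have [->|xn0] := eqVneq x 0.
    by rewrite rnorm0 expr0n mulr0 /N dotp0r.
  have nx0 : 0 < rnorm x.
    rewrite lt_neqAle rnorm_ge0 andbT eq_sym; apply: contra_neq xn0 => h.
    by apply: rnorm_le0; rewrite h.
  have : m <= N ((rnorm x)^-1%:C *: x).
    apply: ge_inf; first exact: iS.2.
    by eexists; last reflexivity; rewrite /= rnormZ rnormC gtr0_norm ?invr_gt0// mulVf ?gt_eqF.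
  by rewrite NZ exprVn ler_pdivlMl ?exprn_gt0// mulrC.
pose B' x := B x - m%:C *: x.
(* [M] bounds the form of [B - m] from above: [N y - m |y|^2 <= M |y|^2]. *)
pose M := b - m.
have M0 : 0 < M by rewrite subr_gt0 (lt_trans m0).
have key x : rnorm (B' x) ^+ 2 <= M * (N x - m * rnorm x ^+ 2).
  have [y yE] : exists y, y = B' x by exists (B' x).
  have e1 : rnorm y ^+ 2 = complex.Re (dotp (B x) y) - m * complex.Re (dotp x y).
    have := dotp_rnorm y; rewrite {1}yE /B' dotpBl dotpZl.
    by case: (dotp (B x) y) (dotp x y) => [? ?] [? ?] [<- _] /=; ring.
  (* The form of [B - m] is nonnegative at [x + t y], where [y = B' x]. Its value there is at most
     [N x - m |x|^2 + 2 t |y|^2 + t^2 M |y|^2], and this bound is least at [t = - 1 / M]. *)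
  rewrite -yE; pose t : R := - M^-1.
  have := Nm (x + t%:C *: y).
  have -> : N (x + t%:C *: y) = N x + 2 * t * complex.Re (dotp (B x) y) + t ^+ 2 * N y.
    rewrite /N; have -> : B (x + t%:C *: y) = t%:C *: B y + B x by rewrite addrC linB.
    rewrite dotpAl !dotpAr !dotpZl !dotpZr (sB y x) (dotpC y (B x)).
    case: (dotp (B x) x) (dotp (B y) y) (dotp (B x) y) => [? ?] [? ?] [? ?] /=; ring.
  have -> : rnorm (x + t%:C *: y) ^+ 2 =
      rnorm x ^+ 2 + 2 * t * complex.Re (dotp x y) + t ^+ 2 * rnorm y ^+ 2.
    rewrite rnorm_sqrD rnormZ rnormC exprMn real_normK ?num_real// dotpZr.
    case: (dotp x y) => ? ? /=; ring.
  have := Nb y; rewrite ler_norml => /andP[_].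
  rewrite -/y; set g := rnorm y ^+ 2 => Ny h.
  have g0 : 0 <= g by rewrite exprn_ge0 ?rnorm_ge0.
  have h1 : 0 <= (N x - m * rnorm x ^+ 2) + 2 * t * g + t ^+ 2 * (M * g).
    have : t ^+ 2 * (N y - m * g) <= t ^+ 2 * (M * g) by rewrite ler_wpM2l ?sqr_ge0// /M; lra.
    by move: h; rewrite -/g in e1 *; rewrite e1; lra.
  have h2 : t ^+ 2 * (M * g) = - t * g by rewrite /t; field; rewrite gt_eqF.
  have h3 : g / M <= N x - m * rnorm x ^+ 2.
    by rewrite h2 in h1; move: h1; rewrite /t; lra.
  by rewrite -ler_pdivrMl// mulrC.
have [c hc] := hB _ m0.
have c0 : 0 < c.
  have := hc x0; rewrite -/(B' x0) => h; rewrite ltNge; apply/negP => c0.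
  by have := le_trans h (mulr_le0_ge0 c0 (rnorm_ge0 (B' x0))); rewrite leNgt x00.
(* A unit vector with [N x < m + 1 / (c^2 M)] satisfies [|B' x| < 1 / c] by [key], against the lower
   bound [1 <= c |B' x|]. *)
have cM : 0 < (c ^+ 2 * M)^-1 by rewrite invr_gt0 mulr_gt0 ?exprn_gt0.
have [_ [x /= x1 <-] hx] := inf_adherent cM iS.
have := key x; rewrite x1 expr1n mulr1 => k1.
have := hc x; rewrite -/(B' x) x1 => k2.
have k3 : 1 <= c ^+ 2 * rnorm (B' x) ^+ 2.
  by rewrite -exprMn -(expr1n _ 2) ler_pXn2r// ?nnegrE// mulr_ge0 ?rnorm_ge0// ltW.
move: hx; rewrite -/m -ltrBlDl -[ltRHS]mul1r ltr_pdivlMr ?mulr_gt0 ?exprn_gt0//.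
rewrite ltNge => /negP; apply; apply: le_trans k3 _.
by rewrite [leRHS]mulrC -[leRHS]mulrA ler_pM2l ?exprn_gt0.
Qed.

End numerical_range.

Section polynomial_calculus.
Context {R : realType} {V : innerProductType R} (A : {linear V -> V}).
Implicit Types p r : {poly R[i]}.

Definition polyop p (x : V) : V := \sum_(i < size p) p`_i *: iter i A x.

Lemma polyopE n p x : (size p <= n)%N -> polyop p x = \sum_(i < n) p`_i *: iter i A x.
Proof.
move=> pn; rewrite /polyop (big_ord_widen n (fun i => p`_i *: iter i A x))//.
rewrite big_mkcond; apply: eq_bigr => i _.
by case: ltnP => // /leq_sizeP -> //; rewrite scale0r.
Qed.

Lemma polyopD p r x : polyop (p + r) x = polyop p x + polyop r x.
Proof.
pose n := maxn (size p) (size r).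
rewrite !(@polyopE n) ?size_polyD ?leq_maxl ?leq_maxr// -big_split/=.
by apply: eq_bigr => i _; rewrite coefD scalerDl.
Qed.

Lemma polyopZ c p x : polyop (c *: p) x = c *: polyop p x.
Proof.
rewrite (@polyopE (size p)) ?size_scale_leq// /polyop scaler_sumr.
by apply: eq_bigr => i _; rewrite coefZ scalerA.
Qed.

Lemma polyopC c x : polyop c%:P x = c *: x.
Proof. by rewrite (@polyopE 1) ?size_polyC_leq1// big_ord1 coefC. Qed.

Lemma polyopMX p x : polyop (p * 'X) x = A (polyop p x).
Proof.
rewrite (@polyopE (size p).+1) ?(leq_trans (size_polyMleq _ _))// ?size_polyX ?addn2//.
rewrite big_ord_recl coefMX scale0r add0r linear_sum.
by apply: eq_bigr => i _; rewrite coefMX/= linearZ.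
Qed.

Lemma polyop_linear p : linear (polyop p).
Proof.
move=> a x y; elim/poly_ind : p => [|p c IH]; first by rewrite !polyopC !scale0r scaler0 addr0.
rewrite !polyopD !polyopMX !polyopC IH linearP !scalerDr !scalerA (mulrC c).
by rewrite -!addrA; congr (_ + _); rewrite addrCA.
Qed.

Lemma polyopM p r x : polyop (p * r) x = polyop p (polyop r x).
Proof.
elim/poly_ind : p x => [|p c IH] x; first by rewrite mul0r !polyopC !scale0r.
rewrite mulrDl !polyopD mul_polyC polyopZ polyopC; congr (_ + _).
by rewrite mulrAC !polyopMX IH.
Qed.

Lemma polyop_bounded p : bounded_op A -> bounded_op (polyop p).
Proof.
move=> [b b0 hb]; elim/poly_ind : p => [|p c [d d0 hd]].
  by exists 1 => // x; rewrite polyopC scale0r rnorm0 mul1r rnorm_ge0.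
exists (b * d + rnorm c); first by rewrite ltr_wpDr ?rnorm_ge0 ?mulr_gt0.
move=> x; rewrite polyopD polyopMX polyopC; apply: le_trans (rnormD _ _) _.
rewrite mulrDl rnormZ lerD2r; apply: le_trans (hb _) _.
by rewrite -mulrA ler_pM2l.
Qed.

Local Notation realpoly := (map_poly (@real_complex R)).

Lemma polyop_selfadjoint (p : {poly R}) : (forall x y, dotp (A x) y = dotp x (A y)) ->
  forall x y, dotp (polyop (realpoly p) x) y = dotp x (polyop (realpoly p) y).
Proof.
move=> sA; elim/poly_ind : p => [|p c IH] x y.
  by rewrite rmorph0 !polyopC !scale0r dotp0l dotp0r.
have comm z : A (polyop (realpoly p) z) = polyop (realpoly p) (A z).
  have := polyopM (realpoly p) 'X z; rewrite polyopMX => ->.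
  by rewrite -['X]mul1r polyopMX polyopC scale1r.
rewrite rmorphD rmorphM/= map_polyX map_polyC/= !polyopD !polyopMX !polyopC.
rewrite dotpAl dotpAr dotpZl dotpZr sA IH; congr (_ + _); last first.
  by congr (_ * _); apply/eqP; rewrite eq_complex/= oppr0 !eqxx.
by rewrite -comm.
Qed.

Lemma spectrum_bounded_below (l : R[i]) : ~ spectrum A l ->
  exists2 c : R, 0 < c & forall x, rnorm x <= c * rnorm (A x - l *: x).
Proof.
move=> /contrapT[B [cB BA _]]; have [c c0 hc] := continuous_bounded_op cB.
by exists c => // x; rewrite -{1}(BA x).
Qed.

(** Over the algebraically closed field [R[i]] the polynomial splits into linear factors, and each
    factor [A - z] is bounded below because it has a continuous left inverse. *)
Lemma polyop_bounded_below p : p != 0 -> (forall z, root p z -> ~ spectrum A z) ->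
  exists2 c : R, 0 < c & forall x, rnorm x <= c * rnorm (polyop p x).
Proof.
move=> p0; have [s ps] := closed_field_poly_normal p.
have lc : lead_coef p != 0 by rewrite lead_coef_eq0.
have lc0 : 0 < rnorm (lead_coef p).
  rewrite lt_neqAle rnorm_ge0 andbT eq_sym; apply: contra_neq lc => h.
  by apply: rnorm_le0; rewrite h.
move=> hroot.
have {}hroot z : z \in s -> ~ spectrum A z.
  move=> zs; apply: hroot; rewrite ps rootZ//.
  by rewrite root_prod_XsubC.
suff [c c0 hc] : exists2 c : R, 0 < c &
    forall x, rnorm x <= c * rnorm (polyop (\prod_(z <- s) ('X - z%:P)) x).
  exists (c / rnorm (lead_coef p)); first by rewrite divr_gt0.
  move=> x; rewrite [X in polyop X]ps polyopZ rnormZ.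
  by rewrite mulrA divfK ?gt_eqF.
elim: s hroot {ps} => [_|z s IH hroot].
  by exists 1 => // x; rewrite big_nil polyopC scale1r mul1r.
have [|c c0 hc] := IH; first by move=> y ys; apply: hroot; rewrite inE ys orbT.
have [d d0 hd] := spectrum_bounded_below (hroot z (mem_head _ _)).
exists (c * d); first by rewrite mulr_gt0.
move=> x; rewrite big_cons polyopM; set y := polyop _ x.
have -> : polyop ('X - z%:P) y = A y - z *: y.
  by rewrite -polyCN polyopD polyopC scaleNr -['X]mul1r polyopMX polyopC scale1r.
by apply: le_trans (hc x) _; rewrite -/y -mulrA ler_pM2l.
Qed.

(* p - l has no zero in the spectrum when p >= 0 there and l < 0. *)
Lemma polyop_ge0 (a b : R) (p : {poly R}) : a <= b -> continuous A ->
  (forall x y, dotp (A x) y = dotp x (A y)) ->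
  (forall l, spectrum A l -> exists2 r : R, l = r%:C & a <= r <= b) ->
  (forall t : R, a <= t <= b -> 0 <= p.[t]) ->
  forall x, 0 <= complex.Re (dotp (polyop (realpoly p) x) x).
Proof.
move=> ab cA sA spA p0; apply: numerical_range_ge0.
- exact: polyop_linear.
- exact/polyop_bounded/continuous_bounded_op.
- exact: polyop_selfadjoint.
- move=> l l0.
  have [pl|pl] := eqVneq (realpoly (p - l%:P)) 0; last first.
    have [|c c0 hc] := polyop_bounded_below pl.
      move=> z; rewrite /root => /eqP pz /spA[r zr rab].
      move: pz; rewrite zr horner_map hornerD hornerN hornerC /= => -[] /eqP.
      by rewrite subr_eq0 => /eqP pr; have := p0 _ rab; rewrite pr leNgt l0.
    exists c => x; have := hc x.
    by rewrite rmorphB/= map_polyC/= -polyCN polyopD polyopC scaleNr.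
  (* The remaining case is that [p] is the constant [l < 0], which contradicts [p >= 0] at the point
     [a] of the interval. *)
  have := p0 a; rewrite lexx ab => /(_ isT).
  move: pl => /(congr1 (fun u => u.[a%:C])); rewrite horner_map horner0 hornerD hornerN hornerC/= => -[] /eqP.
  by rewrite subr_eq0 => /eqP ->; rewrite leNgt l0.
Qed.

End polynomial_calculus.

(** * Measures with prescribed moments *)

Section ramp.
Context {R : realType}.
Implicit Types p r : {poly R}.

Lemma expr_lt (z e : R) : 0 <= z < 1 -> 0 < e -> exists n, z ^+ n.+1 < e.
Proof.
move=> /andP[z0 z1] e0.
have : (fun n => z ^+ n) @ \oo --> 0 by apply: cvg_expr; rewrite ger0_norm.
move=> /cvgrPdist_lt/(_ _ e0)[N _ /(_ N.+1 (leqnSn _))] /=.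
by rewrite sub0r normrN ger0_norm ?exprn_ge0// => h; exists N.
Qed.

Lemma Bernoulli (u : R) m : 0 <= u <= 1 -> 1 - m%:R * u <= (1 - u) ^+ m.
Proof.
move=> /andP[u0 u1]; elim: m => [|m IH]; first by rewrite expr0 mul0r subr0.
have u1' : 0 <= 1 - u by rewrite subr_ge0.
rewrite exprS -natr1; apply: le_trans (ler_wpM2l u1' IH).
have : 0 <= m%:R * u * u by rewrite !mulr_ge0.
lra.
Qed.

Lemma expr_onem_le (u : R) m : 0 <= u <= 1 -> (1 - u) ^+ m * (m%:R * u) <= 1.
Proof.
move=> /andP[u0 u1].
have u1' : 0 <= 1 - u by rewrite subr_ge0.
apply: (@le_trans _ _ ((1 - u) ^+ m * (1 + u) ^+ m)).
  apply: ler_wpM2l; first exact: exprn_ge0.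
  elim: m => [|m IH]; first by rewrite mul0r ler01.
  rewrite exprS -natr1 mulrDl mul1r [leRHS]mulrDl mul1r; apply: lerD => //.
  by rewrite ler_peMr// exprn_ege1// lerDl.
rewrite -exprMn exprn_ile1//; first by apply: mulr_ge0; lra.
nra.
Qed.

(** The polynomial is [(1 - X^n)^m] with [m] close to [c^-n] for some [c] between [a] and [b]. For
    [x <= a], Bernoulli's inequality gives at least [1 - m x^n], where [m x^n <= 2 (a / c)^n]. For
    [x >= b], [(1 - u)^m <= 1 / (m u)] gives at most [(c / b)^n]. *)
Lemma ramp_poly (a b e : R) : 0 <= a -> a < b -> 0 < e ->
  exists r, forall x, 0 <= x <= 1 ->
    [/\ 0 <= r.[x] <= 1, x <= a -> 1 - e <= r.[x] & b <= x -> r.[x] <= e].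
Proof.
(* For [b > 1] no point of [0, 1] lies beyond [b], and the constant 1 serves. *)
move=> a0 ab e0; have [b1|b1] := lerP b 1; last first.
  exists 1 => x /andP[x0 x1]; rewrite hornerC ler01 lexx; split => //.
  - by move=> _; rewrite lerBlDr lerDl ltW.
  - by move=> bx; have := lt_le_trans b1 (le_trans bx x1); rewrite ltxx.
have [c ac cb] : exists2 c, a < c & c < b by exists ((a + b) / 2); lra.
have c0 : 0 < c by exact: le_lt_trans ac.
have b0 : 0 < b by exact: lt_trans cb.
pose z := Num.max (a / c) (c / b).
have z01 : 0 <= z < 1.
  rewrite le_max divr_ge0 ?(ltW c0)//= gt_max.
  by apply/andP; split; rewrite ltr_pdivrMr// mul1r.
have [n zn] := expr_lt z01 (divr_gt0 e0 (ltr0n _ 2)).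
pose m := (Num.truncn (c ^- n.+1)).+1.
have cn0 : 0 < c ^+ n.+1 by rewrite exprn_gt0.
have m1 : 1 <= m%:R * c ^+ n.+1.
  by rewrite -ler_pdivrMr// div1r ltW// truncnS_gt.
have m2 : m%:R * c ^+ n.+1 <= 2.
  rewrite -ler_pdivlMr// /m -natr1.
  have c1 : 1 <= c ^- n.+1.
    by rewrite invf_ge1// exprn_ile1 ?(ltW c0)//; lra.
  have : (Num.truncn (c ^- n.+1))%:R <= c ^- n.+1 by rewrite truncn_le// ltW// (lt_le_trans ltr01).
  lra.
exists ((1 - 'X^(n.+1)) ^+ m) => x /andP[x0 x1].
rewrite horner_exp hornerD hornerN hornerC hornerXn.
have u01 : 0 <= x ^+ n.+1 <= 1 by rewrite exprn_ge0//= exprn_ile1.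
have u1 : 0 <= 1 - x ^+ n.+1 by rewrite subr_ge0; case/andP: u01.
split.
- by rewrite exprn_ge0//= exprn_ile1// lerBlDr lerDl exprn_ge0.
- move=> xa; apply: le_trans (Bernoulli m u01); rewrite lerD2l lerN2.
  have : (x / c) ^+ n.+1 <= z ^+ n.+1.
    rewrite ler_pXn2r ?nnegrE ?divr_ge0 ?(ltW c0)//; last by case/andP: z01.
    by rewrite le_max ler_pM2r ?invr_gt0// xa.
  rewrite expr_div_n ler_pdivrMr// => xz.
  have m0 : 0 <= m%:R :> R by [].
  have := ler_wpM2l m0 xz.
  have zn0 : 0 <= z ^+ n.+1 by rewrite exprn_ge0//; case/andP: z01.
  nra.
- move=> bx.
  have : (c / b) ^+ n.+1 <= z ^+ n.+1.
    rewrite ler_pXn2r ?nnegrE ?divr_ge0 ?(ltW c0) ?(ltW b0)//; last by case/andP: z01.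
    by rewrite le_max lexx orbT.
  have bn0 : 0 < b ^+ n.+1 by rewrite exprn_gt0.
  rewrite expr_div_n ler_pdivrMr// => cbz.
  have bxn : b ^+ n.+1 <= x ^+ n.+1 by rewrite ler_pXn2r// nnegrE// ltW.
  have := expr_onem_le m u01.
  set y := (1 - _) ^+ m; have y0 : 0 <= y by rewrite exprn_ge0.
  set X := x ^+ n.+1; set B := b ^+ n.+1; set C := c ^+ n.+1.
  move=> h.
  have m0 : 0 <= m%:R :> R by [].
  (* y <= y m C <= y m z^n b^n <= z^n (y m x^n) <= z^n *)
  have zn0 : 0 <= z ^+ n.+1 by rewrite exprn_ge0//; case/andP: z01.
  have h1 : y * 1 <= y * (m%:R * C) by rewrite ler_wpM2l.
  have h2 : y * (m%:R * C) <= y * (m%:R * (z ^+ n.+1 * X)).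
    rewrite ler_wpM2l// ler_wpM2l//; apply: le_trans cbz _.
    by rewrite ler_wpM2l.
  have h3 : z ^+ n.+1 * (y * (m%:R * X)) <= z ^+ n.+1 * 1 by rewrite ler_wpM2l.
  lra.
Qed.

Lemma expr_sub_le (x y : R) m : 0 <= x -> x <= y -> y <= 1 -> y ^+ m - x ^+ m <= m%:R * (y - x).
Proof.
move=> x0 xy y1; rewrite subrXX mulrC ler_wpM2r ?subr_ge0//.
rewrite -[leRHS]mulr1 mulr_natl -[m in leRHS]card_ord -sumr_const; apply: ler_sum => i _.
have y0 := le_trans x0 xy; have x1 := le_trans xy y1.
by rewrite -[leRHS]mulr1 ler_pM// ?exprn_ge0// exprn_ile1.
Qed.

End ramp.

Section distribution_function.
Context {R : realType}.
Implicit Types p r : {poly R}.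

(* F t is squeezed between the values of L on polynomials below and above the
   indicator function of (-oo, t] on [0, 1]. *)
Definition has_distribution (F : R -> R) (L : {poly R} -> R) :=
  [/\ {homo F : x y / x <= y} /\ linear (L : {poly R} -> R^o),
      forall p, (forall x, 0 <= x <= 1 -> 0 <= p.[x]) -> 0 <= L p,
      forall t p, (forall x, 0 <= x <= 1 -> 0 <= p.[x] /\ (x <= t -> 1 <= p.[x])) -> F t <= L p &
      forall t p, (forall x, 0 <= x <= 1 -> p.[x] <= 1 /\ (t < x -> p.[x] <= 0)) -> L p <= F t].

Section functional.
Variables (F : R -> R) (L : {poly R} -> R).
Hypothesis FL : has_distribution F L.

Lemma distL_D p r : L (p + r) = L p + L r.
Proof. by case: FL => -[_ lL] _ _ _; rewrite -[p]scale1r lL !scale1r. Qed.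
Lemma distL_Z (c : R) p : L (c *: p) = c * L p.
Proof.
case: FL => -[_ lL] _ _ _; have L0 : L 0 = 0.
  by have /eqP := lL 1 0 0; rewrite !scale1r addr0 -subr_eq subrr => /eqP <-.
by rewrite -[c *: p]addr0 lL L0 addr0.
Qed.
Lemma distL_B p r : L (p - r) = L p - L r.
Proof. by rewrite distL_D -scaleN1r distL_Z mulN1r. Qed.
Lemma distL_C (c : R) : L c%:P = c * L 1.
Proof. by rewrite -[c%:P]mulr1 mul_polyC distL_Z. Qed.
Lemma distL_sum (I : Type) (s : seq I) (f : I -> {poly R}) :
  L (\sum_(i <- s) f i) = \sum_(i <- s) L (f i).
Proof.
elim/big_rec2 : _ => [|i u v _ <-]; last by rewrite distL_D.
by rewrite -(scale0r 0) distL_Z mul0r.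
Qed.
Lemma distL_le p r : (forall x, 0 <= x <= 1 -> p.[x] <= r.[x]) -> L p <= L r.
Proof.
move=> pr; rewrite -subr_ge0 -distL_B; case: FL => _ pL _ _; apply: pL => x /pr.
by rewrite hornerD hornerN subr_ge0.
Qed.
Lemma distL_near p r e : (forall x, 0 <= x <= 1 -> `|p.[x] - r.[x]| <= e) -> `|L p - L r| <= e * L 1.
Proof.
move=> pr; rewrite -distL_C -distL_B ler_norml.
rewrite -[- L _]mulN1r -distL_Z scaleN1r.
by apply/andP; split; apply: distL_le => x /pr; rewrite !(hornerD, hornerN, hornerC) ler_norml => /andP[].
Qed.
End functional.

(** On [0, 1], [1 - x^m] is uniformly close to a sum of ramps [r i] weighted by the increments [D i]
    of [x^m] over a fine grid. Both functionals take values on [r i] between [F (t i)] and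
    [F (t i.+1)], up to a small error. As all [D i] are at most [d], the weighted discrepancies
    telescope to a multiple of [d]. *)
Lemma distribution_unique F L L' : has_distribution F L -> has_distribution F L' ->
  L 1 = L' 1 -> L =1 L'.
Proof.
move=> FL FL' L1.
have [c0 hF0 hF1] : [/\ 0 <= L 1, 0 <= F 0 & F 1 <= L 1].
  case: (FL) => _ pL lF uF; split.
  - by apply: pL => x _; rewrite hornerC.
  - rewrite -(mul0r (L 1)) -(distL_C FL); apply: uF => x _; rewrite hornerC; split=> //.
  - by apply: lF => x _; rewrite hornerC.
suff mono m : L 'X^m = L' 'X^m.
  move=> p; rewrite -[p]coefK poly_def (distL_sum FL) (distL_sum FL').
  by apply: eq_bigr => i _; rewrite (distL_Z FL) (distL_Z FL') mono.
have [->|m0] := eqVneq m 0; first by rewrite expr0.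
apply/eqP; rewrite -subr_eq0 -normr_le0; apply/ler_addgt0Pl => e e0; rewrite addr0.
set c := L 1 in L1 c0 hF1.
(* The total error is [7 d c]: [2 d c] from each of the two uniform approximations and [3 d c] from
   comparing [L S] with [L' S]. The summand 1 covers [c = 0]. *)
pose d := e / (8 * (c + 1)).
have c1 : 0 < c + 1 by rewrite ltr_wpDl.
have d0 : 0 < d by rewrite divr_gt0 ?mulr_gt0.
(* A grid of mesh [1 / N] on which [x^m], having Lipschitz constant [m], varies by at most [d] per
   cell. *)
pose N := (Num.truncn (m%:R / d)).+1.
have N0 : 0 < N%:R :> R by rewrite ltr0n.
pose t i : R := i%:R / N%:R.
pose D i : R := t i.+1 ^+ m - t i ^+ m.
have t0 i : 0 <= t i by rewrite divr_ge0.
have tlt i : t i < t i.+1 by rewrite ltr_pM2r ?invr_gt0// ltr_nat.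
have t1 i : (i < N)%N -> t i.+1 <= 1 by move=> iN; rewrite ler_pdivrMr// mul1r ler_nat.
have D0 i : 0 <= D i by rewrite subr_ge0; apply: lerXn2r; rewrite ?nnegrE ?t0//; apply: ltW.
have Dd i : (i < N)%N -> D i <= d.
  move=> iN; apply: le_trans (expr_sub_le _ _ _ _) _ => //; [exact: ltW|exact: t1|].
  have -> : t i.+1 - t i = N%:R^-1 by rewrite /t -mulrBl -natr1 addrAC subrr add0r mul1r.
  by rewrite ler_pdivrMr// mulrC -ler_pdivrMr//; apply: ltW; exact: truncnS_gt.
have sumD : \sum_(i < N) D i = 1.
  rewrite -(big_mkord xpredT D) telescope_sumr// /t divff ?gt_eqF// expr1n mul0r.
  by rewrite expr0n (negbTE m0) subr0.
have /choice[r hr] : forall i, exists r, forall x, 0 <= x <= 1 ->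
    [/\ 0 <= r.[x] <= 1, x <= t i -> 1 - d <= r.[x] & t i.+1 <= x -> r.[x] <= d].
  by move=> i; exact: ramp_poly.
pose S := \sum_(i < N) D i *: r i.
pose chi (i : nat) (x : R) : R := if x <= t i then 1 else 0.
have near x : 0 <= x <= 1 -> `|(1 - 'X^m).[x] - S.[x]| <= 2 * d.
  move=> x01; have [x0 x1] := andP x01.
  rewrite hornerD hornerN hornerC hornerXn horner_sum.
  under eq_bigr do rewrite hornerZ.
  (* [1 - x^m] telescopes along [M], whose increment over a cell is [D i] if the cell lies to the
     right of [x] and 0 if it lies to the left. This encloses [1 - x^m] between the step functions
     of [lo] and [up]. *)
  pose M i := Num.max (t i) x ^+ m.
  have lo : \sum_(i < N) D i * chi i x <= 1 - x ^+ m.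
    have -> : 1 - x ^+ m = \sum_(i < N) (M i.+1 - M i).
      rewrite -(big_mkord xpredT (fun i => M i.+1 - M i)) telescope_sumr// /M.
      rewrite /t divff ?gt_eqF// mul0r (max_idPl x1) (max_idPr x0) expr1n//.
    apply: ler_sum => i _; rewrite /chi /M; case: ifPn => xt.
      by rewrite mulr1 (max_idPl (le_trans xt (ltW (tlt i)))) (max_idPl xt).
    rewrite mulr0 subr_ge0; apply: lerXn2r; rewrite ?nnegrE ?le_max ?x0 ?orbT//.
    rewrite !ge_max lexx andbT (ltW (tlt i)) /=.
    by case: (leP x (t i)) => [xt2|/ltW ->]; rewrite ?orbT// (le_trans xt2 (ltW (tlt i))).
  have up : 1 - x ^+ m <= \sum_(i < N) D i * chi i.+1 x.
    have -> : 1 - x ^+ m = \sum_(i < N) (M i.+1 - M i).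
      rewrite -(big_mkord xpredT (fun i => M i.+1 - M i)) telescope_sumr// /M.
      rewrite /t divff ?gt_eqF// mul0r (max_idPl x1) (max_idPr x0) expr1n//.
    apply: ler_sum => i _; rewrite /chi /M; case: ifPn => xt; last rewrite -ltNge in xt.
      by rewrite mulr1 (max_idPl xt) lerD2l lerN2; apply: lerXn2r; rewrite ?nnegrE ?le_max ?t0 ?lexx//.
    by rewrite (max_idPr (ltW xt)) (max_idPr (ltW (lt_trans (tlt i) xt))) subrr mulr0.
  (* The two step functions differ in at most one cell. *)
  have gap : \sum_(i < N) D i * chi i.+1 x - \sum_(i < N) D i * chi i x <= d.
    rewrite -sumrB; apply: (@le_trans _ _ (\sum_(i < N) d * (chi i.+1 x - chi i x))).
      apply: ler_sum => i _; rewrite -mulrBr ler_wpM2r//; last exact: Dd.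
      rewrite /chi subr_ge0; case: (boolP (x <= t i)) => [xt|_]; last by case: ifP.
      by rewrite (le_trans xt)// ltW.
    rewrite -mulr_sumr -(big_mkord xpredT (fun i => chi i.+1 x - chi i x)) telescope_sumr//.
    by rewrite -[leRHS]mulr1 ler_pM2l// /chi; do 2 case: ifP => _; lra.
  have Slo : \sum_(i < N) D i * chi i x - d <= \sum_(i < N) D i * (r i).[x].
    rewrite -[d]mul1r -sumD mulr_suml -sumrB; apply: ler_sum => i _.
    rewrite -mulrBr ler_wpM2l// /chi; have [/andP[r0 _] rt _] := hr i _ x01.
    by case: ifPn => [/rt //|_]; rewrite sub0r; lra.
  have Sup : \sum_(i < N) D i * (r i).[x] <= \sum_(i < N) D i * chi i.+1 x + d.
    rewrite -[X in _ + X]mul1r -sumD mulr_suml -big_split; apply: ler_sum => i _ /=.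
    rewrite -mulrDr ler_wpM2l// /chi; have [/andP[_ r1] _ rt] := hr i _ x01.
    by case: ifPn => [_|]; [lra|rewrite -ltNge => /ltW/rt; lra].
  rewrite ler_norml; lra.
have bounds L0 : has_distribution F L0 -> L0 1 = c -> forall i,
    F (t i) - d * c <= L0 (r i) <= F (t i.+1) + d * c.
  move=> FL0 L01 i; rewrite -L01 -(distL_C FL0); case: (FL0) => _ _ lF uF.
  rewrite lerBlDr -(distL_D FL0) -lerBlDr -(distL_B FL0).
  apply/andP; split; [apply: lF|apply: uF] => x x01;
    have [/andP[r0 r1] rl rg] := hr i _ x01;
    rewrite !(hornerD, hornerN, hornerC); split; lra.
have LS L0 : has_distribution F L0 -> L0 S = \sum_(i < N) D i * L0 (r i).
  move=> FL0; rewrite (distL_sum FL0); apply: eq_bigr => i _.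
  exact: (distL_Z FL0).
have LLS : `|L S - L' S| <= d * c + 2 * d * c.
  rewrite (LS L)// (LS L')// -sumrB; apply: le_trans (ler_norm_sum _ _ _) _.
  apply: (@le_trans _ _ (\sum_(i < N) (d * (F (t i.+1) - F (t i)) + D i * (2 * d * c)))).
    apply: ler_sum => i _; rewrite -mulrBr normrM (ger0_norm (D0 i)).
    have := bounds _ FL erefl i; have := bounds _ FL' (esym L1) i.
    move=> /andP[a1 a2] /andP[b1 b2].
    have FF : F (t i) <= F (t i.+1) by case: (FL) => -[mF _] _ _ _; apply: mF; exact: ltW.
    have : D i * `|L (r i) - L' (r i)| <= D i * (F (t i.+1) - F (t i) + 2 * d * c).
      rewrite ler_wpM2l// ler_norml; lra.
    have : D i * (F (t i.+1) - F (t i)) <= d * (F (t i.+1) - F (t i)).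
      by rewrite ler_wpM2r ?subr_ge0//; exact: Dd.
    lra.
  rewrite big_split /= -mulr_suml sumD mul1r lerD2r -mulr_sumr ler_pM2l//.
  rewrite -(big_mkord xpredT (fun i => F (t i.+1) - F (t i))) telescope_sumr//.
  by rewrite /t divff ?gt_eqF// mul0r; lra.
have h1 := distL_near FL near; have h2 := distL_near FL' near.
move: h1 h2; rewrite !(distL_B FL) !(distL_B FL') -L1 -/c.
have dc : d * c * 8 <= e.
  have -> : d * c * 8 = e * (c / (c + 1)) by rewrite /d; field; rewrite gt_eqF.
  rewrite -[leRHS]mulr1; apply: ler_wpM2l; first exact: ltW.
  by rewrite ler_pdivrMr// mul1r lerDl.
move: LLS; rewrite !ler_norml; lra.
Qed.

End distribution_function.

Section moment_measure.
Context {R : realType}.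
Implicit Types p r : {poly R}.
Variables (a : R) (L : {poly R} -> R).
Hypothesis a01 : 0 < a < 1.
Hypothesis linL : linear (L : {poly R} -> R^o).
Hypothesis posL : forall p, (forall x, a <= x <= 1 -> 0 <= p.[x]) -> 0 <= L p.

(** Polynomials above the indicator function of (-oo, t] on [a, 1]. Their infimum under [L] is the
    only candidate for the mass of (-oo, t]. *)
Let above (t : R) : set {poly R} :=
  [set p | forall x, a <= x <= 1 -> 0 <= p.[x] /\ (x <= t -> 1 <= p.[x])].
Let F (t : R) : R := inf [set L p | p in above t].

Let LD p r : L (p + r) = L p + L r.
Proof. by rewrite -[p]scale1r linL !scale1r. Qed.
Let L0 : L 0 = 0.
Proof. by have /eqP := linL 1 0 0; rewrite !scale1r addr0 -subr_eq subrr => /eqP <-. Qed.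
Let LZ (c : R) p : L (c *: p) = c * L p.
Proof. by rewrite -[c *: p]addr0 linL L0 addr0. Qed.
Let LB p r : L (p - r) = L p - L r.
Proof. by rewrite LD -scaleN1r LZ mulN1r. Qed.
Let LC (c : R) : L c%:P = c * L 1.
Proof. by rewrite -[c%:P]mulr1 mul_polyC LZ. Qed.
Let L_le p r : (forall x, a <= x <= 1 -> p.[x] <= r.[x]) -> L p <= L r.
Proof.
by move=> pr; rewrite -subr_ge0 -LB; apply: posL => x /pr; rewrite hornerD hornerN subr_ge0.
Qed.
Let L1_ge0 : 0 <= L 1.
Proof. by apply: posL => x _; rewrite hornerC. Qed.

Let hinf t : has_inf [set L p | p in above t].
Proof.
split; first by exists (L 1), 1 => // x _; rewrite hornerC.
by exists 0 => _ [p pt <-]; apply: posL => x /pt[].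
Qed.

Let F_le t p : above t p -> F t <= L p.
Proof. by move=> tp; apply: ge_inf; [case: (hinf t)|exists p]. Qed.

Let le_F t c : (forall p, above t p -> c <= L p) -> c <= F t.
Proof. by move=> h; apply: lb_le_inf; [case: (hinf t)|move=> _ [p tp <-]; exact: h]. Qed.

Let F_mono : {homo F : x y / x <= y}.
Proof.
move=> s t st; apply: le_F => p tp; apply: F_le => x /tp[p0 p1]; split=> // xs.
exact/p1/(le_trans xs).
Qed.

Let F_lt_a t : t < a -> F t = 0.
Proof.
move=> ta; apply/eqP; rewrite eq_le; apply/andP; split.
  rewrite -L0; apply: F_le => x /andP[ax _]; rewrite hornerC; split=> // xt.
  by have := le_lt_trans xt (lt_le_trans ta ax); rewrite ltxx.
by apply: le_F => p tp; apply: posL => x /tp[].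
Qed.

Let F_ge1 t : 1 <= t -> F t = L 1.
Proof.
move=> t1; apply/eqP; rewrite eq_le; apply/andP; split.
  by apply: F_le => x _; rewrite hornerC.
apply: le_F => p tp; apply: L_le => x ax; rewrite hornerC.
by apply: (tp x ax).2; apply: le_trans t1; case/andP: ax.
Qed.

(** A nearly optimal polynomial for [t], raised by a small constant [c], is by continuity still
    above 1 slightly to the right of [t], so it competes in the infimum for [t + d]. *)
Let F_right t e : 0 < e -> exists2 d, 0 < d & F (t + d) <= F t + e.
Proof.
move=> e0; have [ta|ta] := ltrP t a.
  exists ((a - t) / 2); first by rewrite divr_gt0 ?subr_gt0.
  by rewrite F_lt_a ?F_lt_a//; lra.
have [t1|t1] := lerP 1 t.
  by exists 1 => //; rewrite !F_ge1//; lra.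
have e2 : 0 < e / 2 by rewrite divr_gt0.
have [_ [p tp <-] hp] := inf_adherent e2 (hinf t).
pose c := e / (2 * (L 1 + 1)).
have c0 : 0 < c by rewrite divr_gt0// mulr_gt0// ltr_wpDl.
have := @continuous_horner _ p t => /cvgrPdist_lt/(_ _ c0).
rewrite -nbhs_nearE => /nbhs_ballP[d /= d0 hd].
exists (d / 2); first by rewrite divr_gt0.
apply: (@le_trans _ _ (L (p + c%:P))).
  apply: F_le => x ax; have [p0 p1] := tp _ ax; rewrite hornerD hornerC.
  split=> [|xt]; first by rewrite addr_ge0// ltW.
  have [/p1|tx] := lerP x t; first by lra.
  have : ball t d x by rewrite /ball/= ltr_norml; lra.
  move=> /hd /=; have := (tp t _).2 (lexx t); rewrite ta (ltW t1) => /(_ isT).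
  by rewrite ltr_norml; lra.
rewrite LD LC; have : c * L 1 <= e / 2.
  have -> : c * L 1 = e / 2 * (L 1 / (L 1 + 1)).
    by rewrite /c; field; rewrite gt_eqF// ltr_wpDl.
  rewrite -[leRHS]mulr1; apply: ler_wpM2l; first exact: ltW.
  by rewrite ler_pdivrMr ?mul1r ?lerDl// ltr_wpDl.
rewrite -/(F t) in hp; lra.
Qed.

Let F_rc : right_continuous F.
Proof.
move=> t; apply/cvgrPdist_le => e e0.
have [d d0 hd] := F_right t e0.
near=> x.
have tx : t <= x by apply: ltW; near: x; exact: nbhs_right_gt.
rewrite ler_norml; have := F_mono tx.
have : F x <= F (t + d).
  by apply: F_mono; near: x; apply: nbhs_right_le; rewrite ltrDl.
lra.
Unshelve. all: by end_near. Qed.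

Let Fm := isCumulative.Build R _ R F F_mono F_rc.
Let FC : cumulative R R := HB.pack F Fm.

Let D : set (measurableTypeR R) := `]0, 1]%classic.
Let mD : measurable D.
Proof. exact: measurable_itv. Qed.

Let LS := lebesgue_stieltjes_measure FC.
Let LSE (s t : R) : s <= t -> LS (`]s, t]%classic : set R) = (F t - F s)%:E.
Proof.
move=> st; rewrite /LS /lebesgue_stieltjes_measure /measure_extension measurable_mu_extE/=; last exact: is_ocitv.
by rewrite wlength_itv_bnd.
Qed.

Let sigma := mrestr LS mD.
HB.instance Definition _ := Measure.on sigma.
Let sigma_fin : fin_num_fun sigma.
Proof.
move=> U mU; rewrite ge0_fin_numE//; apply: (@le_lt_trans _ _ (LS D)).
  by apply: le_measure; rewrite ?inE//; exact: measurableI.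
by rewrite LSE// ltry.
Qed.
HB.instance Definition _ := @Measure_isFinite.Build _ _ _ sigma sigma_fin.

Let sigma_itv t : 0 <= t <= 1 -> sigma (`]-oo, t]%classic : set R) = (F t)%:E.
Proof.
move=> /andP[t0 t1]; rewrite /sigma /mrestr.
have -> : `]-oo, t]%classic `&` D = `]0, t]%classic.
  apply/seteqP; split=> x /=; rewrite /D/= !in_itv/=; first by move=> [? /andP[-> _]].
  by move=> /andP[-> xt]; split=> //; exact: le_trans t1.
rewrite LSE// (@F_lt_a 0) ?subr0//; by case/andP: a01.
Qed.

Let I p : R := \int[sigma]_(x in D) p.[x].

Let bounded_poly p : [bounded p.[x] | x in D].
Proof.
have [M [_ hM]] : bounded_set (horner p @` `[0, 1]%classic).
  apply: compact_bounded; apply: continuous_compact; last exact: segment_compact.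
  by apply: continuous_subspaceT; exact: continuous_horner.
exists M; split; first exact: num_real.
move=> y My x; rewrite /D/= in_itv/= => /andP[x0 x1].
by apply: (hM y My); exists x => //=; rewrite in_itv/= ltW.
Qed.

Let mpoly p : measurable_fun setT (fun x : measurableTypeR R => p.[x] : R).
Proof. exact: (continuous_measurable_fun (@continuous_horner _ p)). Qed.

Let integrable_poly p : sigma.-integrable D (EFin \o horner p).
Proof.
apply: measurable_bounded_integrable => //.
- by rewrite ltey_eq fin_num_measure.
- exact: measurable_funTS (mpoly p).
Qed.

Let I_itv t : exists E : set (measurableTypeR R), [/\ measurable E,
  (\int[sigma]_(x in D) \1_E x = F t),
  sigma.-integrable D (EFin \o \1_E) &
  forall x, D x -> E x <-> x <= t].
Proof.
(* [sigma] is known on (-oo, t] only for [t] in [0, 1]. Clipping [t] to this interval changes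
   neither [F t], as [F] is 0 below [a > 0] and constant beyond 1, nor the trace of the half-line on
   ]0, 1]. *)
pose t' := Num.max 0 (Num.min t 1).
have t'01 : 0 <= t' <= 1 by rewrite le_max lexx ge_max ge_min lexx ler01 orbT.
have Ft : F t = F t'.
  rewrite /t'; have [t1|t1] := leP t 1; last by rewrite (max_idPr _)// !F_ge1// ltW.
  have [t0|//] := ltP t 0; have [a0 _] := andP a01.
  by rewrite !F_lt_a// (lt_trans t0).
exists `]-oo, t']%classic; have mE : measurable (`]-oo, t']%classic : set (measurableTypeR R)) by exact: measurable_itv.
split => //.
- rewrite /Rintegral integral_indic// Ft -[RHS]/(fine (F t')%:E) -sigma_itv//.
  by congr (fine (LS _)); rewrite -setIA setIid.
- apply: measurable_bounded_integrable => //; first by rewrite ltey_eq fin_num_measure.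
  exists 1; split; first exact: num_real.
  by move=> y y1 x _ /=; rewrite ger0_norm// (le_trans _ (ltW y1))// indicE lern1; case: (_ \in _).
- move=> x; rewrite /D/= !in_itv/= => /andP[x0 x1].
  by rewrite /t' le_max le_min x1 andbT (lt_geF x0).
Qed.

Let I_dist : has_distribution F I.
Proof.
split.
- split; first exact: F_mono.
  move=> c p r; rewrite /I.
  have ip : sigma.-integrable D (EFin \o (fun x => c * p.[x])).
    have := integrable_poly (c *: p); apply: eq_integrable => //.
    by move=> x _ /=; rewrite hornerZ.
  transitivity (\int[sigma]_(x in D) (c * p.[x] + r.[x])).
    by apply: eq_Rintegral => x _; rewrite hornerD hornerZ.
  by have ir := integrable_poly r; rewrite RintegralD// RintegralZl.
- move=> p p0; apply: Rintegral_ge0 => x; rewrite /D/= in_itv/= => /andP[x0 x1].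
  by apply: p0; rewrite ltW.
- move=> t p tp; have [E [mE <- iE DE]] := I_itv t.
  apply: le_Rintegral => //.
  move=> x /[dup] Dx; rewrite /D/= in_itv/= => /andP[/ltW x0 x1].
  have [p0 p1] := tp x ltac:(by rewrite x0).
  rewrite indicE; have [|_ //] := boolP (x \in E).
  by rewrite inE => /(DE _ Dx)/p1.
- move=> t p tp; have [E [mE <- iE DE]] := I_itv t.
  apply: le_Rintegral => //.
  move=> x /[dup] Dx; rewrite /D/= in_itv/= => /andP[/ltW x0 x1].
  have [p0 p1] := tp x ltac:(by rewrite x0).
  rewrite indicE; have [//|] := boolP (x \in E).
  move=> /negP nE; apply: p1; rewrite ltNge; apply/negP => xt.
  by apply: nE; rewrite inE; exact/DE.
Qed.

Let L_dist : has_distribution F L.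
Proof.
split=> //.
- by move=> p p0; apply: posL => x /andP[ax x1]; apply: p0; rewrite x1 andbT (le_trans _ ax)// ltW//; case/andP: a01.
- move=> t p tp; apply: F_le => x /andP[ax x1]; apply: tp.
  by rewrite x1 andbT (le_trans _ ax)// ltW//; case/andP: a01.
- move=> t p tp; apply: le_F => r rt; apply: L_le => x xa.
  have [|p1 p2] := tp x.
    by case/andP: xa => xa ->; rewrite (le_trans _ xa)// ltW//; case/andP: a01.
  by have [r0 r1] := rt _ xa; have [/r1|/p2 px] := lerP x t; [exact: le_trans p1|exact: le_trans px r0].
Qed.

(** The measure is the Stieltjes measure of [F] on ]0, 1]. Integration against it and [L] both have
    the distribution function [F], so they agree on polynomials. No mass is lost at 0, because [F]
    vanishes below [a > 0]. *)
Lemma moment_measure : exists s : {finite_measure set (measurableTypeR R) -> \bar R},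
  [/\ s (~` `]0, 1]%classic) = 0%E,
      forall c, 0 <= c < a -> s `]0, c]%classic = 0%E,
      forall p, s.-integrable setT (EFin \o horner p) &
      forall p, \int[s]_x p.[x] = L p].
Proof.
exists sigma.
have s0 : sigma (~` D) = 0%E.
  by rewrite /sigma /mrestr setICl; exact: (measure0 (lebesgue_stieltjes_measure FC)).
have mDC := measurableC mD.
have int_poly p : sigma.-integrable setT (EFin \o horner p).
  apply: (negligible_integrable mDC measurableT _ s0).2; last first.
    by rewrite setTD setCK; exact: integrable_poly.
  by apply/measurable_EFinP; exact: mpoly.
split=> //.
- move=> c /andP[c0 ca]; have := @sigma_itv c.
  rewrite F_lt_a// c0 (ltW (lt_trans ca _)); last by case/andP: a01.
  move=> /(_ isT) c1; apply/eqP; rewrite -measure_le0.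
  apply: (@le_trans _ _ (sigma `]-oo, c]%classic)); last by rewrite c1.
  apply: le_measure; rewrite ?inE; try exact: measurable_itv.
  by move=> x /=; rewrite !in_itv/= => /andP[].
(* The side condition left by uniqueness is equality of the total masses: [F 1 - F 0 = L 1]. *)
- move=> p; rewrite -(distribution_unique I_dist L_dist).
    by rewrite /I /Rintegral (negligible_integral mDC measurableT (int_poly p) s0) setTD setCK.
  rewrite /I; under eq_Rintegral do rewrite hornerC.
  rewrite Rintegral_cst// mul1r -[RHS]/(fine (L 1)%:E); congr fine.
  transitivity (LS (D `&` D)); first by [].
  by rewrite setIid (LSE ler01) F_ge1// F_lt_a ?subr0//; case/andP: a01.
Qed.
End moment_measure.

(** * Spaces of square-integrable functions *)

Section sqmod.
Context {R : realType}.

Definition sqmod (c : R[i]) : R := complex.Re c ^+ 2 + complex.Im c ^+ 2.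

Lemma sqmod_ge0 c : 0 <= sqmod c.
Proof. by rewrite addr_ge0 ?sqr_ge0. Qed.

(** The increments are at most [sqrt C / 2^k], so the telescoping series converges absolutely. *)
Lemma geometric_cvgn (x : R ^nat) (C : R) :
  (forall k, (2 ^+ k * (x k.+1 - x k)) ^+ 2 <= C) -> cvgn x.
Proof.
move=> hx.
suff : cvgn (series (telescope x)).
  rewrite telescopeK => /cvg_ex[l hl].
  have := cvgP _ (cvgD hl (cvg_cst (x 0%N))).
  suff -> : [sequence x n - x 0%N]_n + cst (x 0%N) = x by apply.
  by apply/funext => n; rewrite /= -[X in X = _]/(x n - x 0%N + x 0%N) subrK.
apply: normed_cvg.
have h2 : `|2^-1 : R| < 1 by rewrite gtr0_norm; lra.
apply: (@series_le_cvg _ (fun n => `|telescope x n|) (geometric (Num.sqrt C) 2^-1)) => [n|n|n|]; rewrite /=.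
- by [].
- by rewrite mulr_ge0 ?sqrtr_ge0 ?exprn_ge0.
- have p2 : 0 < 2 ^+ n :> R by rewrite exprn_gt0.
  rewrite /geometric/= /telescope/= exprVn ler_pdivlMr// mulrC.
  rewrite -[2 ^+ n](gtr0_norm p2) -normrM -sqrtr_sqr; exact: ler_wsqrtr.
- exact: is_cvg_geometric_series.
Qed.

End sqmod.

Section L2_complete.
Context d (T : measurableType d) (R : realType) (mu : {measure set T -> \bar R}).

Lemma square_integrable_measurable (f : T -> R[i]) : square_integrable mu f ->
  measurable_fun setT (fun t => sqmod (f t)).
Proof. by move=> [mr mi _]; apply: measurable_funD; apply: measurable_funX. Qed.

Lemma L2_rnorm (f : L2 mu) : (\int[mu]_t (sqmod (f t))%:E = (rnorm f ^+ 2)%:E)%E.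
Proof.
have := dotp_rnorm f; rewrite [dotp f f]l2formxx => -[<-].
have [_ _ ffin] := L2P f.
rewrite /Rintegral fineK// ge0_fin_numE//.
by apply: integral_ge0 => t _; rewrite lee_fin sqmod_ge0.
Qed.

Lemma L2_linB (f g : L2 mu) : {ae mu, forall t, (f - g : L2 mu) t = f t - g t}.
Proof.
have := L2_linE (-1) g f; rewrite scaleN1r addrC.
by apply: filterS => t ->; rewrite mulN1r addrC.
Qed.

Lemma L2_rnormB (f g : L2 mu) :
  (\int[mu]_t (sqmod (f t - g t))%:E = (rnorm (f - g) ^+ 2)%:E)%E.
Proof.
rewrite -L2_rnorm; apply: ae_eq_integral => //.
- apply/measurable_EFinP/square_integrable_measurable.
  have -> : (fun t => f t - g t) = (fun t => (-1) * g t + f t).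
    by apply/funext => t; rewrite mulN1r addrC.
  exact: square_integrable_lin (L2P g) (L2P f).
- exact/measurable_EFinP/square_integrable_measurable/L2P.
- by apply: filterS (L2_linB f g) => t -> _.
Qed.

(** Riesz-Fischer: a rapidly converging subsequence converges pointwise almost everywhere, and
    Fatou's lemma turns the Cauchy bounds into norm bounds for the limit. *)
Lemma L2_complete : seq_complete (L2 mu).
Proof.
suff : forall u : nat -> L2 mu, seq_cauchy u -> exists l : L2 mu, seq_cvg u l by [].
move=> u cu.
have /choice[N hN] : forall k : nat, exists N, forall m n, (N <= m)%N -> (N <= n)%N ->
    rnorm (u m - u n) < (4 ^+ k.+1)^-1.
  by move=> k; apply: cu; rewrite invr_gt0 exprn_gt0.
(* An index beyond [k] and beyond [N j] for all [j <= k], so that both [M k] and [M k.+1] lie beyond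
   [N k]. *)
pose M k := (k + \sum_(j < k.+1) N j)%N.
have NM j k : (j <= k)%N -> (N j <= M k)%N.
  by move=> jk; rewrite /M (bigD1 (Ordinal (jk : (j < k.+1)%N)))//= addnCA leq_addr.
pose g k : L2 mu := u (M k).
(* The norm of [g k.+1 - g k] is below [4^-(k+1)], so even with the weight [4^k] the integrals are
   summable. Where the sum [W] is finite, the increments decay like [2^-k]. *)
pose w k (t : T) : \bar R := (4 ^+ k * sqmod (g k.+1 t - g k t))%:E.
have mB (f h : L2 mu) : measurable_fun setT (fun t => sqmod (f t - h t)).
  apply/square_integrable_measurable.
  have -> : (fun t => f t - h t) = (fun t => (-1) * h t + f t).
    by apply/funext => t; rewrite mulN1r addrC.
  exact: square_integrable_lin (L2P h) (L2P f).
have mw k : measurable_fun setT (w k).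
  by apply/measurable_EFinP; apply: measurable_funM => //; exact: mB.
have w0 k t : (0 <= w k t)%E by rewrite lee_fin mulr_ge0 ?sqmod_ge0// exprn_ge0.
pose W t := (\sum_(k <oo) w k t)%E.
have iW : mu.-integrable setT W.
  apply/integrableP; split; first by apply: ge0_emeasurable_sum => // k _; exact: mw.
  under eq_integral do rewrite gee0_abs ?nneseries_ge0//.
  rewrite integral_nneseries//.
  apply: (@le_lt_trans _ _ 1%:E); last by rewrite ltry.
  apply: le_trans (@epsilon_trick0 R 1 xpredT _) => //.
  apply: lee_nneseries => [k _ _|k _]; first exact: integral_ge0.
  rewrite /w; under eq_integral do rewrite EFinM.
  rewrite ge0_integralZl//; last 2 first.
  - exact/measurable_EFinP/mB.
  - by move=> t _; rewrite lee_fin sqmod_ge0.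
  rewrite L2_rnormB -EFinM lee_fin natrX.
  have h : rnorm (g k.+1 - g k) < (4 ^+ k.+1)^-1 by apply: hN; apply: NM.
  have p4 : 0 < 4 ^+ k.+1 :> R by rewrite exprn_gt0.
  have h2 : rnorm (g k.+1 - g k) ^+ 2 <= (4 ^+ k.+1)^-1 ^+ 2.
    by rewrite ler_pXn2r ?nnegrE ?rnorm_ge0 ?invr_ge0 ?(ltW p4)// ltW.
  apply: (@le_trans _ _ (4 ^+ k.+1 * (4 ^+ k.+1)^-1 ^+ 2)).
    apply: ler_pM => //; rewrite ?exprn_ge0 ?rnorm_ge0//.
    by apply: ler_weXn2l => //; rewrite ler1n.
  rewrite expr2 mulrA mulfV ?gt_eqF// mul1r div1r lef_pV2 ?posrE ?exprn_gt0//.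
  by apply: lerXn2r; rewrite ?nnegrE// ler_nat.
have := integrable_ae measurableT iW.
pose E := [set t | (W t < +oo)%E].
have mE : measurable E.
  have -> : E = setT `&` [set t | (W t < +oo)%E] by rewrite setTI.
  apply: emeasurable_fun_infty_o => //; exact: measurable_int iW.
move=> aeE.
have {}aeE : {ae mu, forall t, t \in E}.
  apply: filterS aeE => t /(_ I) /fin_numPlt/andP[_ Wt].
  by rewrite inE.
(* Setting the subsequence to 0 off [E] makes it converge everywhere, so that the limit is
   measurable. *)
pose h k t : R[i] := if t \in E then g k t else 0.
have mg k : measurable_fun setT (fun t => complex.Re (g k t)) /\ measurable_fun setT (fun t => complex.Im (g k t)).
  by case: (L2P (g k)).
have hE k : (fun t => complex.Re (h k t)) = (fun t => \1_E t * complex.Re (g k t)) /\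
            (fun t => complex.Im (h k t)) = (fun t => \1_E t * complex.Im (g k t)).
  by split; apply/funext => t; rewrite /h indicE; case: ifP => _; rewrite ?mul1r ?mul0r.
have mh k : measurable_fun setT (fun t => complex.Re (h k t)) /\ measurable_fun setT (fun t => complex.Im (h k t)).
  rewrite (hE k).1 (hE k).2; have [? ?] := mg k.
  by split; apply: measurable_funM => //; exact: measurable_indic.
have ch t : cvgn (fun k => complex.Re (h k t)) /\ cvgn (fun k => complex.Im (h k t)).
  rewrite /h; case: (boolP (t \in E)) => tE; last by split; exact: is_cvg_cst.
  have Wt : (W t < +oo)%E by move: tE; rewrite inE.
  have Wt0 : (0 <= W t)%E by apply: nneseries_ge0.
  have key k : 4 ^+ k * sqmod (g k.+1 t - g k t) <= fine (W t).
    rewrite -lee_fin fineK ?ge0_fin_numE//.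
    apply: le_trans (nneseries_lim_ge k.+1 _); last by move=> n _ _; exact: w0.
    rewrite big_mkord big_ord_recr/= leeDr//; apply: sume_ge0 => i _; exact: w0.
  have p k : 4 ^+ k = (2 ^+ k) ^+ 2 :> R by rewrite -exprM mulnC exprM; congr (_ ^+ _); rewrite expr2; lra.
  split; apply: (@geometric_cvgn _ _ (fine (W t))) => k; apply: le_trans (key k);
    rewrite exprMn p ler_wpM2l ?sqr_ge0// /sqmod;
    case: (g k.+1 t) (g k t) => a b [a' b'] /=; first by rewrite lerDl sqr_ge0.
  by rewrite lerDr sqr_ge0.
pose f t : R[i] := Complex (limn (fun k => complex.Re (h k t))) (limn (fun k => complex.Im (h k t))).
have mf : measurable_fun setT (fun t => complex.Re (f t)) /\ measurable_fun setT (fun t => complex.Im (f t)).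
  split.
    apply: (@measurable_fun_cvg _ _ _ setT (fun k t => complex.Re (h k t))).
      by move=> k; case: (mh k).
    by move=> t _; exact: (ch t).1.
  apply: (@measurable_fun_cvg _ _ _ setT (fun k t => complex.Im (h k t))).
    by move=> k; case: (mh k).
  by move=> t _; exact: (ch t).2.
have msq (a b : T -> R[i]) : (measurable_fun setT (fun t => complex.Re (a t)) /\ measurable_fun setT (fun t => complex.Im (a t))) ->
    (measurable_fun setT (fun t => complex.Re (b t)) /\ measurable_fun setT (fun t => complex.Im (b t))) ->
    measurable_fun setT (fun t => sqmod (a t - b t)).
  move=> [ar ai] [br bi].
  have -> : (fun t => sqmod (a t - b t)) = (fun t => (complex.Re (a t) - complex.Re (b t)) ^+ 2 + (complex.Im (a t) - complex.Im (b t)) ^+ 2).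
    by apply/funext => t; case: (a t) (b t) => ? ? [? ?].
  by apply: measurable_funD; apply: measurable_funX; exact: measurable_funB.
have mu_ n : measurable_fun setT (fun t => complex.Re (u n t)) /\ measurable_fun setT (fun t => complex.Im (u n t)).
  by case: (L2P (u n)).
(* Fatou's lemma along the subsequence; [M k >= k] puts its tail beyond [K]. *)
have fu n e : 0 < e -> (exists K, forall m, (K <= m)%N -> rnorm (u m - u n) <= e) ->
    (\int[mu]_t (sqmod (f t - u n t))%:E <= (e ^+ 2)%:E)%E.
  move=> e0 [K hK].
  have lim t : limn_einf (fun k => (sqmod (h k t - u n t))%:E) = (sqmod (f t - u n t))%:E.
    apply: (cvg_limn_einf_sup _).1; apply/cvg_EFin; first by near=> k.
    have -> : fine \o (fun k => (sqmod (h k t - u n t))%:E) =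
        (fun k => (complex.Re (h k t) - complex.Re (u n t)) ^+ 2 + (complex.Im (h k t) - complex.Im (u n t)) ^+ 2).
      by apply/funext => k /=; case: (h k t) (u n t) => ? ? [? ?].
    have -> : sqmod (f t - u n t) = (complex.Re (f t) - complex.Re (u n t)) ^+ 2 + (complex.Im (f t) - complex.Im (u n t)) ^+ 2.
      by case: (f t) (u n t) => ? ? [? ?].
    apply: cvgD; under eq_fun do rewrite expr2; rewrite expr2.
      by apply: cvgM; (apply: cvgB; [exact: (ch t).1|exact: cvg_cst]).
    by apply: cvgM; (apply: cvgB; [exact: (ch t).2|exact: cvg_cst]).
  have := @fatou _ _ _ mu setT measurableT (fun k t => (sqmod (h k t - u n t))%:E).
  under eq_integral do rewrite lim.
  move=> /(_ _ _)/le_trans; apply.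
  - by move=> k; apply/measurable_EFinP/msq.
  - by move=> k t _; rewrite lee_fin sqmod_ge0.
  rewrite limn_einf_lim; apply: lime_le; first exact: is_cvg_einfs.
  near=> k.
  apply: (@le_trans _ _ (\int[mu]_t (sqmod (h (maxn k K) t - u n t))%:E)%E).
    apply: ereal_inf_lbound; exists (maxn k K) => //=; exact: leq_maxl.
  have -> : (\int[mu]_t (sqmod (h (maxn k K) t - u n t))%:E = \int[mu]_t (sqmod (g (maxn k K) t - u n t))%:E)%E.
    apply: ae_eq_integral => //; try by apply/measurable_EFinP/msq.
    by apply: filterS aeE => t tE _; rewrite /h tE.
  rewrite L2_rnormB lee_fin ler_pXn2r ?nnegrE ?rnorm_ge0 ?(ltW e0)//.
  apply: hK; apply: leq_trans (leq_maxr k K) _; exact: leq_addr.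
have sfu n e : 0 < e -> (exists K, forall m, (K <= m)%N -> rnorm (u m - u n) <= e) ->
    square_integrable mu (fun t => f t - u n t).
  move=> e0 hK; have [f1 f2] := mf; have [u1 u2] := mu_ n; split.
  - have -> : (fun t => complex.Re (f t - u n t)) = (fun t => complex.Re (f t) - complex.Re (u n t)).
      by apply/funext => t; case: (f t) (u n t) => ? ? [? ?].
    exact: measurable_funB.
  - have -> : (fun t => complex.Im (f t - u n t)) = (fun t => complex.Im (f t) - complex.Im (u n t)).
      by apply/funext => t; case: (f t) (u n t) => ? ? [? ?].
    exact: measurable_funB.
  - by apply: le_lt_trans (fu n e e0 hK) _; rewrite ltry.
have sf : square_integrable mu f.
  have [K hK] := cu 1 ltr01.
  have s1 : square_integrable mu (fun t => f t - u K t).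
    by apply: (sfu K 1) => //; exists K => m Km; apply: ltW; apply: hK.
  have := square_integrable_lin 1 s1 (L2P (u K)).
  by congr square_integrable; apply/funext => t; rewrite mul1r subrK.
exists (toL2 sf) => e e0.
have e2 : 0 < e / 2 by rewrite divr_gt0.
have [K hK] := cu _ e2; exists K => n Kn.
rewrite rnormB; have : rnorm (toL2 sf - u n) <= e / 2.
  rewrite -(@ler_pXn2r _ 2)// ?nnegrE ?rnorm_ge0 ?(ltW e2)//.
  rewrite -lee_fin -L2_rnormB.
  have <- : (\int[mu]_t (sqmod (f t - u n t))%:E = \int[mu]_t (sqmod (toL2 sf t - u n t))%:E)%E.
    apply: ae_eq_integral => //; try by apply/measurable_EFinP/msq => //; case: (L2P (toL2 sf)).
    by apply: filterS (toL2E sf) => t -> _.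
  by apply: fu => //; exists K => m Km; apply: ltW; apply: hK.
by move=> fun_le; apply: le_lt_trans fun_le _; lra.
Unshelve. all: by end_near. Qed.
End L2_complete.

Section real_multiplication.
Context d (T : measurableType d) (R : realType) (mu : {measure set T -> \bar R}).

Lemma sqmodZ (a : R) (c : R[i]) : sqmod (a%:C * c) = a ^+ 2 * sqmod c.
Proof. by case: c => x y; rewrite /sqmod /=; ring. Qed.

Lemma square_integrableM (c : T -> R) (C : R) (f : T -> R[i]) :
  measurable_fun setT c -> (forall t, `|c t| <= C) ->
  square_integrable mu f -> square_integrable mu (fun t => (c t)%:C * f t).
Proof.
move=> mc cC [fr fi ff].
have e1 : (fun t => complex.Re ((c t)%:C * f t)) = (fun t => c t * complex.Re (f t)).
  by apply/funext => t; case: (f t) => ? ? /=; ring.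
have e2 : (fun t => complex.Im ((c t)%:C * f t)) = (fun t => c t * complex.Im (f t)).
  by apply/funext => t; case: (f t) => ? ? /=; ring.
have msq : measurable_fun setT (fun t => sqmod (f t)).
  by apply: measurable_funD; apply: measurable_funX.
split; [by rewrite e1; exact: measurable_funM|by rewrite e2; exact: measurable_funM|].
apply: (@le_lt_trans _ _ (\int[mu]_t ((C ^+ 2)%:E * (sqmod (f t))%:E))%E).
  apply: ge0_le_integral => //.
  - by move=> t _; rewrite lee_fin addr_ge0 ?sqr_ge0.
  - apply/measurable_EFinP; apply: measurable_funD; apply: measurable_funX.
      by rewrite e1; exact: measurable_funM.
    by rewrite e2; exact: measurable_funM.
  - by apply: measurable_funeM; exact/measurable_EFinP.
  move=> t _; rewrite -EFinM lee_fin -/(sqmod _) sqmodZ ler_wpM2r ?sqmod_ge0//.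
  by rewrite -real_normK ?num_real// lerXn2r ?nnegrE// (le_trans _ (cC t)).
rewrite ge0_integralZl//.
- by rewrite lte_mul_pinfty ?lee_fin ?sqr_ge0.
- exact/measurable_EFinP.
- by move=> t _; rewrite lee_fin sqmod_ge0.
- by rewrite lee_fin sqr_ge0.
Qed.

(** The real and imaginary parts are dominated by [1 + |f|^2], which is integrable for a finite
    measure. *)
Lemma square_integrable_RL1 (f : T -> R[i]) : (mu setT < +oo)%E ->
  square_integrable mu f ->
  mu.-integrable setT (EFin \o (fun t => complex.Re (f t))) /\
  mu.-integrable setT (EFin \o (fun t => complex.Im (f t))).
Proof.
move=> mufin [fr fi ff].
have msq : measurable_fun setT (fun t => sqmod (f t)).
  by apply: measurable_funD; apply: measurable_funX.
have i1 : mu.-integrable setT (EFin \o (fun t => 1 + sqmod (f t))).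
  have : mu.-integrable setT (EFin \o (fun t => sqmod (f t))).
    apply/integrableP; split; first exact/measurable_EFinP.
    by under eq_integral do rewrite gee0_abs ?lee_fin ?sqmod_ge0//.
  have i2 : mu.-integrable setT (EFin \o (fun _ : T => 1 : R)).
    apply: measurable_bounded_integrable => //.
    by exists 1; split => // x x1 y _ /=; rewrite normr1 ltW.
  by move=> i3; have := integrableD measurableT i2 i3.
split; apply: le_integrable i1 => //; try exact/measurable_EFinP.
  move=> t _ /=; rewrite lee_fin [leRHS]ger0_norm ?addr_ge0 ?sqr_ge0// ler_norml /sqmod.
  by apply/andP; split; nra.
move=> t _ /=; rewrite lee_fin [leRHS]ger0_norm ?addr_ge0 ?sqr_ge0// ler_norml /sqmod.
by apply/andP; split; nra.
Qed.

End real_multiplication.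

Section polynomial_density.
Context {R : realType} (s : {finite_measure set (measurableTypeR R) -> \bar R}).
Let D : set (measurableTypeR R) := `]0, 1]%classic.
Hypothesis sD : s (~` D) = 0%E.

Let mD : measurable D.
Proof. exact: measurable_itv. Qed.

Let mpoly (p : {poly R}) : measurable_fun setT (fun x : measurableTypeR R => p.[x] : R).
Proof. exact: (continuous_measurable_fun (@continuous_horner _ p)). Qed.

(** The sets over which [v] integrates to 0 form a Dynkin class. Half-lines are stable under
    intersection and generate the Borel sets, so only half-lines have to be treated. *)
Lemma moment_unique (v : R -> R) :
  s.-integrable setT (EFin \o v) ->
  (forall p : {poly R}, \int[s]_(x in D) (p.[x] * v x)%:E = 0)%E ->
  {ae s, forall x, v x = 0}.
Proof.
move=> iv hv.
have mv : measurable_fun setT (v : measurableTypeR R -> R).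
  by apply/measurable_EFinP; exact: measurable_int iv.
have ivD : s.-integrable D (EFin \o v) by exact: integrableS iv.
(* v integrates to zero over half-lines, by approximating their indicator
   functions boundedly and pointwise by polynomials. *)
have half c : (\int[s]_(x in D `&` `]-oo, c[) (v x)%:E = 0)%E.
  have [c0|c0] := lerP c 0.
    rewrite (_ : _ `&` _ = set0) ?integral_set0//.
    apply/seteqP; split=> // x /=; rewrite /D/= !in_itv/= => -[/andP[x0 _] xc].
    by have := lt_trans x0 (lt_le_trans xc c0); rewrite ltxx.
  (* The ramps descend between [a n] and [c]. As [a n] increases to [c], they tend to the indicator
     function of the open half-line at every point of ]0, 1]. *)
  pose a (n : nat) := Num.max 0 (c - n.+1%:R^-1).
  have a0 n : 0 <= a n by rewrite le_max lexx.
  have ac n : a n < c by rewrite gt_max c0/= ltrBlDr ltrDl invr_gt0.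
  have /choice[r hr] : forall n, exists r : {poly R}, forall x, 0 <= x <= 1 ->
    [/\ 0 <= r.[x] <= 1, x <= a n -> 1 - n.+1%:R^-1 <= r.[x] & c <= x -> r.[x] <= n.+1%:R^-1].
    by move=> n; apply: ramp_poly => //; rewrite invr_gt0.
  rewrite integral_mkcondr.
  have Dx x : D x -> 0 <= x <= 1 by rewrite /D/= in_itv/= => /andP[/ltW -> ->].
  have cvg : (\int[s]_(x in D) ((r n).[x] * v x)%:E @[n --> \oo] -->
      \int[s]_(x in D) (((fun x => (v x)%:E) \_ `]-oo, c[) x))%E.
    apply: (@dominated_cvg _ _ _ s D mD _ _ (fun x => `|v x|%:E)) => //.
    - move=> n; apply/measurable_funTS/measurable_EFinP.
      by apply: measurable_funM => //; exact: mpoly.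
    - move=> x /Dx x01.
      have -> : ((fun x => (v x)%:E) \_ `]-oo, c[) x = ((if x < c then 1 else 0) * v x)%:E.
        by rewrite /patch mem_setE in_itv/=; case: ifP; rewrite ?mul1r ?mul0r.
      apply/cvg_EFin; first by near=> n.
      rewrite /comp/=; apply: cvgMl; apply/cvgrPdist_le => e e0.
      case: ifPn => [xc|].
        have cx : 0 < c - x by rewrite subr_gt0.
        near=> n; have [/andP[r0 r1] rl _] := hr n _ x01.
        rewrite ger0_norm ?subr_ge0//.
        have xa : x <= a n.
          rewrite le_max lerBrDr -lerBrDl; apply/orP; right.
          by apply: ltW; near: n; exact: near_infty_natSinv_lt (PosNum cx).
        have ne : n.+1%:R^-1 <= e by apply: ltW; near: n; exact: near_infty_natSinv_lt (PosNum e0).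
        have := rl xa; move: ne; set y := _^-1; lra.
      rewrite -leNgt => xc; near=> n; have [/andP[r0 r1] _ rg] := hr n _ x01.
      rewrite sub0r normrN ger0_norm//; apply: le_trans (rg xc) _.
      by apply: ltW; near: n; exact: near_infty_natSinv_lt (PosNum e0).
    - exact: (integrable_abse ivD).
    - move=> n x /Dx x01; have [/andP[r0 r1] _ _] := hr n _ x01.
      by rewrite lee_fin normrM ger0_norm// ler_piMl.
  have : (\int[s]_(x in D) ((r n).[x] * v x)%:E @[n --> \oo] --> 0)%E.
    by under eq_fun do rewrite hv; exact: cvg_cst.
  by move/cvg_unique: cvg => /(_ _) h; move=> /h => ->.
have fin A : measurable A -> (\int[s]_(x in D `&` A) (v x)%:E \is a fin_num)%E.
  move=> mA; have mDA : measurable (D `&` A) by exact: measurableI.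
  by apply: integrable_fin_num => //; apply: integrableS ivD => //; exact: subIsetl.
pose C : set (set (measurableTypeR R)) :=
  [set B | measurable B /\ (\int[s]_(x in D `&` B) (v x)%:E = 0)%E].
have dC : dynkin C.
  have intD : (\int[s]_(x in D) (v x)%:E = 0)%E.
    have := hv 1; under eq_integral do rewrite hornerC mul1r; by [].
  split.
  - by split => //; rewrite setIT.
  - move=> B [mB B0]; have mBC := measurableC mB; split => //.
    have : (\int[s]_(x in (D `&` B) `|` (D `&` ~` B)) (v x)%:E = 0)%E.
      by rewrite -setIUr setUv setIT.
    rewrite integral_setU//.
    + by rewrite B0 add0e.
    + exact: measurableI.
    + exact: measurableI.
    + by apply: measurable_funTS; exact/measurable_EFinP.
    + by apply/disj_setPS => x [[_ Bx] [_ /(_ Bx)]].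
  - move=> F tF CF; have mF k : measurable (F k) by case: (CF k).
    split; first exact: bigcupT_measurable.
    rewrite setI_bigcupr integral_bigcup//.
    + by rewrite eseries0// => k _ _; case: (CF k).
    + exact: trivIset_setIl.
    + by move=> k; exact: measurableI.
    + apply: integrableS ivD => //; last by rewrite -setI_bigcupr; exact: subIsetl.
      by apply: bigcupT_measurable => k; exact: measurableI.
have allC B : measurable B -> C B.
  move=> mB; have : <<s @RGenInftyO.G R >> B.
    have := RGenInftyO.measurableE R; rewrite /measurable/= => <-; exact: mB.
  rewrite -setI_closed_g_dynkin_g_sigma_algebra.
    apply; split => // _ [c ->]; split; [exact: measurable_itv|exact: half].
  move=> _ _ [x ->] [y ->]; exists (Num.min x y).
  by apply/seteqP; split=> t /=; rewrite !in_itv/= lt_min => /andP.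
have ae0 : ae_eq s D (EFin \o v) (cst 0%E).
  apply: integral_ae_eq => // E ED mE.
  have [_] := allC E mE; rewrite setIidr// => ->.
  by rewrite integral0.
have aeD : {ae s, forall x, D x}.
  by exists (~` D); split => //; exact: measurableC.
by apply: filterS2 ae0 aeD => x h Dx; have := h Dx => -[].
Unshelve. all: by end_near. Qed.

End polynomial_density.

Section L2_multiplication.
Context d (T : measurableType d) (R : realType) (mu : {measure set T -> \bar R}).

Lemma L2_dotp_ae (f g : L2 mu) (f' g' : T -> R[i]) :
  square_integrable mu f' -> square_integrable mu g' ->
  {ae mu, forall t, f t = f' t} -> {ae mu, forall t, g t = g' t} ->
  dotp f g = l2form mu f' g'.
Proof.
move=> sf sg ff gg; transitivity (l2form mu f' g).
  exact: (l2form_ae (L2P f) sf (L2P g) ff).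
by rewrite (l2formC sf (L2P g)) (l2form_ae (L2P g) sg sf gg) -l2formC.
Qed.

Lemma L2_eq_ae (f : L2 mu) (g : T -> R[i]) (sg : square_integrable mu g) :
  {ae mu, forall t, f t = g t} -> f = toL2 sg.
Proof.
by move=> fg; apply/L2_eqP; apply: filterS2 fg (toL2E sg) => t -> ->.
Qed.

Variables (c : T -> R) (C : R).
Hypothesis mc : measurable_fun setT c.
Hypothesis cC : forall t, `|c t| <= C.

Definition L2mul (f : L2 mu) : L2 mu := toL2 (square_integrableM mc cC (L2P f)).

Lemma L2mulE f : {ae mu, forall t, L2mul f t = (c t)%:C * f t}.
Proof. exact: toL2E. Qed.

Lemma L2mul_linear : linear L2mul.
Proof.
suff H (a : R[i]) (f g : L2 mu) : L2mul (a *: f + g) = a *: L2mul f + L2mul g by exact: H.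
apply/L2_eqP.
have h : {ae mu, forall t, (a *: L2mul f + L2mul g : L2 mu) t = (c t)%:C * (a * f t + g t)}.
  apply: filterS3 (L2_linE a (L2mul f) (L2mul g)) (L2mulE f) (L2mulE g) => t -> -> ->.
  by rewrite mulrDr mulrCA.
apply: filterS3 h (L2mulE (a *: f + g)) (L2_linE a f g) => t -> -> ->.
by [].
Qed.

HB.instance Definition _ :=
  GRing.isLinear.Build R[i] (L2 mu) (L2 mu) _ L2mul L2mul_linear.

Lemma L2mul_selfadjoint (f g : L2 mu) : dotp (L2mul f) g = dotp f (L2mul g).
Proof.
have sf := square_integrableM mc cC (L2P f).
have sg := square_integrableM mc cC (L2P g).
rewrite (L2_dotp_ae sf (L2P g) (L2mulE f)); last exact: aeW.
rewrite (L2_dotp_ae (L2P f) sg _ (L2mulE g)); last exact: aeW.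
rewrite /l2form; congr (Complex _ _); apply: eq_Rintegral => t _;
  by case: (f t) (g t) => ? ? [? ?] /=; ring.
Qed.

Lemma L2mul_le (f : L2 mu) : rnorm (L2mul f) <= C * rnorm f.
Proof.
(* The bound [cC] forces [C >= 0] only when [T] has a point. *)
have [t0|T0] := pselect (exists t : T, True); last first.
  have -> : L2mul f = f.
    by apply/L2_eqP; apply: aeW => t; case: T0; exists t.
  have -> : f = 0 by apply/L2_eqP; apply: aeW => t; case: T0; exists t.
  by rewrite rnorm0 mulr0.
have C0 : 0 <= C by case: t0 => t _; exact: le_trans (cC t).
rewrite -(@ler_pXn2r _ 2)// ?nnegrE ?mulr_ge0 ?rnorm_ge0// exprMn.
rewrite -lee_fin [leRHS]EFinM -!L2_rnorm.
rewrite -ge0_integralZl//; last 3 first.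
- exact/measurable_EFinP/square_integrable_measurable/L2P.
- by move=> t _; rewrite lee_fin sqmod_ge0.
- by rewrite lee_fin sqr_ge0.
have sf := square_integrableM mc cC (L2P f).
apply: (@le_trans _ _ (\int[mu]_t (sqmod ((c t)%:C * f t))%:E)%E).
  rewrite le_eqVlt; apply/orP; left; apply/eqP; apply: ae_eq_integral => //.
  - exact/measurable_EFinP/square_integrable_measurable/L2P.
  - exact/measurable_EFinP/(square_integrable_measurable sf).
  - by apply: filterS (L2mulE f) => t -> _.
apply: ge0_le_integral => //.
- by move=> t _; rewrite lee_fin sqmod_ge0.
- exact/measurable_EFinP/(square_integrable_measurable sf).
- by apply: measurable_funeM; exact/measurable_EFinP/square_integrable_measurable/L2P.
- move=> t _; rewrite -EFinM lee_fin sqmodZ ler_wpM2r ?sqmod_ge0//.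
  by rewrite -real_normK ?num_real// lerXn2r ?nnegrE.
Qed.

End L2_multiplication.

Section monomials.
Context {R : realType} (s : {finite_measure set (measurableTypeR R) -> \bar R}).
Let D : set (measurableTypeR R) := `]0, 1]%classic.
Hypothesis sD : s (~` D) = 0%E.
Hypothesis ipoly : forall p : {poly R}, s.-integrable setT (EFin \o horner p).

Let mD : measurable D.
Proof. exact: measurable_itv. Qed.

Let mpoly (p : {poly R}) : measurable_fun setT (fun x : measurableTypeR R => p.[x] : R).
Proof. exact: (continuous_measurable_fun (@continuous_horner _ p)). Qed.

(* The identity, cut off so that multiplication by it is bounded on all of L_2. *)
Definition chi (x : R) : R := if 0 < x <= 1 then x else 0.

Lemma measurable_chi : measurable_fun setT (chi : measurableTypeR R -> R).
Proof.
have -> : chi = (fun x => \1_D x * x).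
  by apply/funext => x; rewrite /chi indicE mem_setE /D/= in_itv/=; case: ifP => _; rewrite ?mul1r ?mul0r.
by apply: measurable_funM => //; exact: measurable_indic.
Qed.

Lemma chi_le1 x : `|chi x| <= 1.
Proof. by rewrite /chi; case: ifP => [/andP[x0 x1]|_]; rewrite ?normr0// gtr0_norm. Qed.

Definition mulx : L2 s -> L2 s := L2mul measurable_chi chi_le1.

HB.instance Definition _ := GRing.Linear.on mulx.

Lemma square_integrable_mono m : square_integrable s (fun x : measurableTypeR R => (x ^+ m)%:C).
Proof.
have mX : measurable_fun setT (fun x : measurableTypeR R => x ^+ m : R).
  by have := mpoly 'X^m; apply: eq_measurable_fun => x _; rewrite hornerXn.
split => //=.
have /integrableP[_] := ipoly 'X^(m.*2).
apply: le_lt_trans; apply: ge0_le_integral => //.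
- by move=> x _; rewrite lee_fin addr_ge0 ?sqr_ge0.
- by apply/measurable_EFinP; apply: measurable_funD; apply: measurable_funX.
- by apply: measurableT_comp => //; apply/measurable_EFinP; exact: mpoly.
- move=> x _ /=; rewrite lee_fin hornerXn expr0n/= addr0 -exprM muln2.
  exact: ler_norm.
Qed.

Definition mono m : L2 s := toL2 (square_integrable_mono m).

Lemma monoE m : {ae s, forall x, mono m x = (x ^+ m)%:C}.
Proof. exact: toL2E. Qed.

Let aeD : {ae s, forall x, D x}.
Proof. by exists (~` D); split => //; exact: measurableC. Qed.

Lemma mulx_mono m : mulx (mono m) = mono m.+1.
Proof.
apply: L2_eq_ae; apply: filterS3 (L2mulE measurable_chi chi_le1 (mono m)) (monoE m) aeD.
move=> x -> ->; rewrite /D/= in_itv/= /chi => ->.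
by rewrite -rmorphM/= -exprS.
Qed.

Lemma dotp_mono m n : dotp (mono m) (mono n) = (\int[s]_x 'X^(m + n).[x])%:C.
Proof.
rewrite (L2_dotp_ae (square_integrable_mono m) (square_integrable_mono n) (monoE m) (monoE n)).
apply/eqP; rewrite eq_complex/=; apply/andP; split; apply/eqP.
  by apply: eq_Rintegral => x _; rewrite hornerXn exprD /=; ring.
rewrite /Rintegral integral0_eq// => x _; congr EFin; ring.
Qed.

(** If [g] is orthogonal to all monomials, all moments of its real and imaginary parts vanish. These
    parts are integrable because [s] is finite, so [moment_unique] applies. *)
Lemma mono_dense (h : L2 s) : closure (lin_span (range mono)) h.
Proof.
apply: orthogonal_dense; first exact: L2_complete.
suff H (g : L2 s) : (forall y, range mono y -> dotp g y = 0) -> g = 0 by exact: H.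
move=> hm.
have sfin : (s setT < +oo)%E by rewrite ltey_eq fin_num_measure.
have [ir ii] := square_integrable_RL1 sfin (L2P g).
have key m : \int[s]_x (x ^+ m * complex.Re (g x)) = 0 /\ \int[s]_x (x ^+ m * complex.Im (g x)) = 0.
  split.
    have := hm (mono m) (ex_intro2 _ _ m I erefl).
    rewrite (L2_dotp_ae (L2P g) (square_integrable_mono m) _ (monoE m)); last exact: aeW.
    move=> -[<- _]; apply: eq_Rintegral => x _; case: (g x) => ? ? /=; ring.
  have := hm (mono m) (ex_intro2 _ _ m I erefl).
  rewrite (L2_dotp_ae (L2P g) (square_integrable_mono m) _ (monoE m)); last exact: aeW.
  move=> -[_ <-]; apply: eq_Rintegral => x _; case: (g x) => ? ? /=; ring.
have vanish (v : R -> R) : s.-integrable setT (EFin \o v) ->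
    (forall m, \int[s]_x (x ^+ m * v x) = 0) -> {ae s, forall x : measurableTypeR R, v x = 0}.
  move=> iv v0; apply: (moment_unique sD iv) => p.
  have mv : measurable_fun setT (v : measurableTypeR R -> R).
    by apply/measurable_EFinP; exact: measurable_int iv.
  have mX m : measurable_fun setT (fun x : measurableTypeR R => x ^+ m : R).
    by have := mpoly 'X^m; apply: eq_measurable_fun => x _; rewrite hornerXn.
  have imD m : s.-integrable D (EFin \o (fun x => x ^+ m * v x)).
    have ivD : s.-integrable D (EFin \o v) by exact: integrableS iv.
    apply: (le_integrable mD _ _ ivD).
      by apply/measurable_EFinP/measurable_funTS/measurable_funM.
    move=> x; rewrite /D/= in_itv/= => /andP[/ltW x0 x1].
    by rewrite lee_fin normrM ger0_norm ?exprn_ge0// ler_piMl// exprn_ile1.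
  have mDC := measurableC mD.
  have im m : s.-integrable setT (EFin \o (fun x => x ^+ m * v x)).
    apply: (negligible_integrable mDC measurableT _ sD).2; last by rewrite setTD setCK.
    by apply/measurable_EFinP/measurable_funM.
  have {}v0 m : (\int[s]_(x in D) (x ^+ m * v x)%:E = 0)%E.
    have := negligible_integral mDC measurableT (im m) sD; rewrite setTD setCK => <-.
    rewrite -[LHS]fineK; first by congr EFin; exact: v0.
    exact: integrable_fin_num.
  transitivity (\int[s]_(x in D) (\sum_(i < size p) ((p`_i)%:E * (x ^+ i * v x)%:E)))%E.
    apply: eq_integral => x _; rewrite horner_coef mulr_suml -sumEFin.
    by apply: eq_bigr => i _; rewrite -EFinM mulrA.
  rewrite integral_sum// => [|i]; last exact: (integrableZl mD _ (imD i)).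
  apply: big1 => i _; rewrite (integralZl mD (imD i)).
  by rewrite -[RHS](mule0 (p`_i)%:E); congr (_ * _)%E; exact: v0.
have re0 := vanish _ ir (fun m => (key m).1).
have im0 := vanish _ ii (fun m => (key m).2).
apply/L2_eqP; apply: filterS3 re0 im0 (L2_0E s) => x; case: (g x) => a b /= -> -> ->.
by [].
Qed.

End monomials.

(** * Cyclic subspaces as multiplication operators *)

Section cyclic_model.
Context {R : realType} {K : innerProductType R}.
Variables (A : {linear K -> K}) (q : R).
Hypotheses (q01 : 0 < q < 1) (cK : seq_complete K) (cA : continuous A).
Hypothesis sA : forall x y, dotp (A x) y = dotp x (A y).
Hypothesis spA : forall l, spectrum A l -> exists2 r : R, l = r%:C & q <= r <= 1.
Hypothesis eigA : ~ Defs.eigenvalue A q%:C.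

Let iterA m n x : dotp (iter m A x) (iter n A x) = dotp (iter (m + n) A x) x.
Proof. by elim: n m => [|n IH] m; rewrite ?addn0//= -sA -iterS IH addSnnS. Qed.

Let iterA_real m x : dotp (iter m A x) x = (complex.Re (dotp (iter m A x) x))%:C.
Proof.
have : dotp (iter m A x) x = Num.conj (dotp (iter m A x) x).
  have /= e := iterA 0 m x; rewrite add0n in e.
  by rewrite -[LHS]e dotpC.
case: (dotp (iter m A x) x) => a b /= -[] b0.
by congr Complex; lra.
Qed.

Let L (x : K) (p : {poly R}) : R := complex.Re (dotp (polyop A (map_poly (@real_complex R) p) x) x).

Let L_linear x : linear (L x : {poly R} -> R^o).
Proof.
move=> a p r; rewrite /L rmorphD/= map_polyZ polyopD polyopZ dotpAl dotpZl.
by case: (dotp _ x) (dotp _ x) => ? ? [? ?] /=; rewrite mul0r subr0.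
Qed.

Let L_Xn x m : L x 'X^m = complex.Re (dotp (iter m A x) x).
Proof.
rewrite /L map_polyXn; congr (complex.Re (dotp _ x)).
elim: m => [|m IH]; first by rewrite expr0 polyopC scale1r.
by rewrite exprSr polyopMX IH.
Qed.

(** By self-adjointness the inner product of [A^m x] and [A^n x] depends only on [m + n], and it is
    the moment of order [m + n] of [s]. So monomials and iterates have the same Gram matrix, and [V]
    sends one family to the other. *)
Lemma cyclic_model (x : K) :
  exists s : {finite_measure set (measurableTypeR R) -> \bar R},
    s (~` `]q, 1]%classic) = 0%E /\
    exists V : {linear L2 s -> K}, [/\ isometric V,
      forall h, V (mulx h) = A (V h),
      forall m, exists h, V h = iter m A x &
      forall h, closure (lin_span (range (fun m => iter m A x))) (V h)].
Proof.
have [q0 q1] := andP q01.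
have posL p : (forall t, q <= t <= 1 -> 0 <= p.[t]) -> 0 <= L x p.
  by move=> p0; apply: polyop_ge0 cA sA spA p0 x; exact: ltW.
have [s [s0 sq ip sL]] := moment_measure q01 (L_linear x) posL.
exists s.
have gram m n : dotp (iter m A x) (iter n A x) = dotp (mono ip m) (mono ip n).
  by rewrite dotp_mono sL L_Xn iterA iterA_real.
have [V [iV VA]] := gram_extension gram (mono_dense s0 ip) cK.
have VM h : V (mulx h) = A (V h).
  have [b b0 hb] := continuous_bounded_op cA.
  apply: eq_of_rnorm => e e0.
  have b1 : 0 < 1 + b by rewrite addr_gt0.
  (* The intertwining relation holds on combinations of monomials. The error at [h - h'] is at most
     [1 + b] times its norm, since [mulx] is a contraction. *)
  have [h' sh' hh'] := (closureP _ _).1 (@mono_dense _ _ s0 ip h) _ (divr_gt0 e0 b1).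
  have Vh' : V (mulx h') = A (V h').
    suff sub : linear_subspace [set k : L2 s | V (mulx k) = A (V k)].
      apply: (lin_span_min sub _ sh') => _ [m _ <-] /=.
      by rewrite mulx_mono// !VA.
    split=> [|a u v] /=; first by rewrite !linear0.
    by move=> hu hv; rewrite !linearP/= hu hv.
  have -> : V (mulx h) - A (V h) = V (mulx (h - h')) - A (V (h - h')).
    have -> : V (mulx (h - h')) = V (mulx h) - A (V h') by rewrite !linearB/= Vh'.
    have -> : A (V (h - h')) = A (V h) - A (V h') by rewrite !linearB.
    by rewrite opprB addrA subrK.
  rewrite ltr_pdivlMr// in hh'; apply: le_lt_trans hh'.
  apply: le_trans (rnormD _ _) _; rewrite rnormN mulrDr mulr1; apply: lerD.
    rewrite (isometric_rnorm _ iV); have := L2mul_le (measurable_chi (R := R)) (@chi_le1 R) (h - h').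
    by rewrite mul1r.
  by apply: le_trans (hb _) _; rewrite (isometric_rnorm _ iV) mulrC.
split; last first.
  exists V; split => //; first by move=> m; exists (mono ip m).
  move=> h; apply/closureP => e e0.
  have [h' sh' hh'] := (closureP _ _).1 (@mono_dense _ _ s0 ip h) _ e0.
  exists (V h'); last by rewrite -linearB (isometric_rnorm _ iV).
  apply: (lin_span_min (preimage_subspace V (lin_span_subspace _)) _ sh').
  by move=> _ [m _ <-]; rewrite /= VA; apply: sub_lin_span; exists m.
have negl_q : s.-negligible [set q].
  have m1 : measurable_fun setT (\1_[set q] : measurableTypeR R -> R).
    by apply: measurable_indic; exact: measurable_set1.
  have b1 (t : measurableTypeR R) : `|\1_[set q] t : R| <= 1.
    by rewrite indicE; case: (_ \in _); rewrite ?normr1 ?normr0.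
  (* The indicator function of {q} is an eigenvector of multiplication by the variable. Its image
     under [V] would be an eigenvector of [A] for [q], so it vanishes and {q} has mass 0. *)
  pose h := L2mul m1 b1 (mono ip 0).
  have hE : {ae s, forall t, h t = (\1_[set q] t)%:C}.
    by apply: filterS2 (L2mulE m1 b1 (mono ip 0)) (monoE ip 0) => t -> ->; rewrite expr0 mulr1.
  have Mh : mulx h = q%:C *: h.
    apply/L2_eqP; apply: filterS3 (L2mulE (@measurable_chi R) (@chi_le1 R) h) (L2_scaleE q%:C h) hE.
    move=> t -> -> ->; rewrite indicE; have [|_] := boolP (t \in [set q]); last by rewrite !mulr0.
    by rewrite inE /= => ->; rewrite /chi q0 (ltW q1).
  have Vh : V h = 0.
    by apply: contrapT => Vh0; apply: eigA; exists (V h); rewrite -VM Mh linearZ.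
  have h0 : h = 0 by apply: (isometric_inj iV); rewrite Vh linear0.
  have : {ae s, forall t, ~ [set q] t}.
    apply: filterS2 hE (L2_0E s) => t; rewrite h0 => -> + tq.
    rewrite indicE mem_set// => -[] /eqP; by rewrite oner_eq0.
  by apply: negligibleS => t /= tq; apply.
have negl_lt : s.-negligible `]0, q[%classic.
  (* The mass of ]0, c] is known to vanish only for [c < q], so ]0, q[ is exhausted by countably
     many such intervals. *)
  apply: (@negligibleS _ _ _ s (\bigcup_n `]0, q * (1 - n.+1%:R^-1)]%classic)).
    move=> t /=; rewrite in_itv/= => /andP[t0 tq].
    have d0 : 0 < 1 - t / q by rewrite subr_gt0 ltr_pdivrMr// mul1r.
    have [N hN] := inv_natS_lt d0; exists N => //=.
    rewrite in_itv/= t0/= mulrC -ler_pdivrMr//.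
    by have := hN _ (leqnn N); set y := _^-1; lra.
  apply: negligible_bigcup => n; apply/negligibleP; first exact: measurable_itv.
  have n0 : 0 < n.+1%:R^-1 :> R by rewrite invr_gt0.
  have n1 : n.+1%:R^-1 <= 1 :> R by rewrite invf_le1// ler1n.
  by apply: sq; rewrite mulr_ge0 ?subr_ge0 ?(ltW q0)//= gtr_pMr// ltrBlDr ltrDl.
have mC : measurable (~` `]q, 1]%classic : set (measurableTypeR R)).
  by apply: measurableC; exact: measurable_itv.
have mC0 : measurable (~` `]0, 1]%classic : set (measurableTypeR R)).
  by apply: measurableC; exact: measurable_itv.
apply/negligibleP => //.
apply: (@negligibleS _ _ _ s (~` `]0, 1]%classic `|` (`]0, q[%classic `|` [set q]))).
  move=> t /=; rewrite !in_itv/= => /negP tq.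
  have [t1|t1] := boolP (0 < t <= 1); last by left; exact/negP.
  right; move: tq; rewrite negb_and -!ltNge -leNgt; case/andP: t1 => t0 t1.
  rewrite (ltNge 1) t1 orbF le_eqVlt => /orP[/eqP ->|tq]; [by right|left].
  by rewrite t0.
by apply: negligibleU; [exact/negligibleP|exact: negligibleU].
Qed.

End cyclic_model.

(** * The q-invariant extension *)

Section pushforward.
Context d d' (T1 : measurableType d) (T2 : measurableType d') (R : realType).

Definition pushforward_measure (m : {measure set T1 -> \bar R}) (f : T1 -> T2)
  (mf : measurable_fun setT f) : {measure set T2 -> \bar R}.
Proof. by unshelve refine (pushforward m f : {measure set T2 -> \bar R}); exact: mf. Defined.

End pushforward.

(** Series of measures are indexed by the naturals; this enumeration of Z lets one run over all
    dilation exponents. *)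
Definition int_enum (n : nat) : int := if odd n then Negz n./2 else Posz n./2.

Lemma int_enum_bij : bijective int_enum.
Proof.
exists (fun z => match z with Posz n => n.*2 | Negz n => n.*2.+1 end) => [n|[n|n]] /=.
- rewrite /int_enum -[RHS]odd_double_half; case: ifP => _ /=; lia.
- by rewrite /int_enum odd_double doubleK.
- by rewrite /int_enum /= odd_double /= uphalf_double.
Qed.

Section invariant_extension.
Context {R : realType} (q : R) (s : {finite_measure set (measurableTypeR R) -> \bar R}).
Hypothesis q01 : 0 < q < 1.
Hypothesis sq : s (~` `]q, 1]%classic) = 0%E.

Let q0 : 0 < q. Proof. by case/andP: q01. Qed.
Let q_neq0 : q != 0. Proof. by rewrite gt_eqF. Qed.
Let qX_gt0 (m : int) : 0 < q ^ m. Proof. exact: exprz_gt0. Qed.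

Definition dilate (m : int) (x : measurableTypeR R) : measurableTypeR R := q ^ (- m) * x.

Lemma measurable_dilate m : measurable_fun setT (dilate m).
Proof. by apply: measurable_funM => //; exact: measurable_cst. Qed.

(** This is the interval ]q^(1-m), q^(-m)], the image of ]q, 1] under [dilate m]. *)
Definition annulus (m : int) : set (measurableTypeR R) := dilate (- m) @^-1` `]q, 1]%classic.

Lemma dilateK m : cancel (dilate m) (dilate (- m)).
Proof. by move=> x; rewrite /dilate mulrA -expfzDr// opprK subrr mul1r. Qed.
Lemma dilateKV m : cancel (dilate (- m)) (dilate m).
Proof. by move=> x; rewrite /dilate mulrA -expfzDr// opprK addNr mul1r. Qed.

Lemma annulus_disjoint m m' x : annulus m x -> annulus m' x -> m = m'.
Proof.
wlog : m m' / m < m' => [hw am am'|mm'].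
  have [/hw h|/hw h|//] := ltgtP m m'; first exact: h.
  by apply/esym/h.
rewrite /annulus /dilate/= !in_itv/= !opprK => /andP[h1 h2] /andP[h3 h4].
have : q ^ m' * x <= q * (q ^ m * x).
  have [k ->] : exists k : nat, m' = k%:Z + (1 + m) by exists (absz (m' - m - 1)%R); lia.
  rewrite expfzDr// expfzDr// expr1z -!mulrA -exprnP; apply: ler_piMl.
    by apply: mulr_ge0; [exact: ltW|apply: ltW; exact: lt_trans h1].
  by rewrite exprn_ile1 ?ltW//; case/andP: q01.
by move=> /(lt_le_trans h3); rewrite ltNge -[leRHS]mulr1 ler_pM2l// h2.
Qed.

(* ]q, 1] is a fundamental domain for the dilations by powers of q. *)
Definition invariant_ext : set (measurableTypeR R) -> \bar R :=
  mseries (fun n => pushforward_measure s (measurable_dilate (int_enum n))) 0.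

HB.instance Definition _ := Measure.on invariant_ext.

Lemma invariant_extE A : invariant_ext A = \esum_(m in setT) s (dilate m @^-1` A).
Proof.
rewrite /invariant_ext /= /mseries nneseries_esumT; last first.
  move=> n; exact: measure_ge0.
rewrite [RHS](@reindex_esum _ _ _ setT _ int_enum)//.
by rewrite setTT_bijective; exact: int_enum_bij.
Qed.

Let s0 A : measurable A -> A `<=` ~` `]q, 1]%classic -> s A = 0%E.
Proof.
move=> mA Aq; apply/eqP; rewrite -measure_le0 -sq; apply: le_measure; rewrite ?inE//.
by apply: measurableC; exact: measurable_itv.
Qed.

Lemma invariant_ext_annulus m A : measurable A -> A `<=` annulus m ->
  invariant_ext A = s (dilate m @^-1` A).
Proof.
move=> mA Am; rewrite invariant_extE (esumID [set m])//.
rewrite setTI esum_set1 ?measure_ge0// esum1 ?adde0// => i [_ /= im].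
apply: s0; first by rewrite -[X in measurable X]setTI; exact: measurable_dilate.
move=> x /= /Am am xq; apply: im; apply: (annulus_disjoint _ am).
by rewrite /annulus/= dilateK.
Qed.

Lemma invariant_ext0 A : measurable A -> (forall m, A `&` annulus m = set0) ->
  invariant_ext A = 0%E.
Proof.
move=> mA Am; rewrite invariant_extE esum1// => i _.
apply: s0; first by rewrite -[X in measurable X]setTI; exact: measurable_dilate.
move=> x /= Ax xq; have : (A `&` annulus i) (dilate i x) by split => //; rewrite /annulus/= dilateK.
by rewrite Am.
Qed.

Lemma measurable_annulus m : measurable (annulus m).
Proof.
rewrite /annulus -[X in measurable X]setTI; apply: measurable_dilate => //.
Qed.

Lemma exists_annulus x : 0 < x -> exists m, annulus m x.
Proof.
move=> x0; have [_ q1] := andP q01.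
have q01' : 0 <= q < 1 by rewrite ltW.
have [N qN] := expr_lt q01' x0.
(* Scaling [x] to some [y > 1] makes the least [n] with [q^n y <= 1] positive; minimality then gives
   [q < q^n y]. *)
pose y := x / q ^+ N.+1.
have qN0 : 0 < q ^+ N.+1 by rewrite exprn_gt0.
have y1 : 1 < y by rewrite ltr_pdivlMr// mul1r.
have y0 : 0 < y by apply: lt_trans y1.
have exn : exists n, q ^+ n * y <= 1.
  have yV : 0 < y^-1 by rewrite invr_gt0.
  have [n qn] := expr_lt q01' yV; exists n.+1.
  by rewrite -ler_pdivlMr// div1r ltW.
have [n qn nmin] := ex_minnP exn.
case: n qn nmin => [|n] qn nmin; first by move: qn; rewrite expr0 mul1r leNgt y1.
exists (n.+1%:Z - N.+1%:Z); rewrite /annulus /dilate /= in_itv/= opprK expfzDr//.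
have -> : q ^ n.+1%:Z * q ^ (- N.+1%:Z) * x = q ^+ n.+1 * y.
  by rewrite /y -exprnP -exprnN; ring.
rewrite qn andbT exprS -mulrA ltr_pMr// ltNge; apply/negP => /nmin.
by rewrite ltnn.
Qed.

Lemma invariant_ext_sigma_finite : sigma_finite setT invariant_ext.
Proof.
exists (fun n => annulus (int_enum n) `|` [set x | x <= 0]).
  apply/seteqP; split => // x _; have [x0|x0] := lerP x 0.
    by exists 0%N => //; right.
  have [m mx] := exists_annulus x0; have [g ge eg] := int_enum_bij.
  by exists (g m) => //; left; rewrite eg.
have m0 : measurable ([set x | x <= 0] : set (measurableTypeR R)).
  by rewrite -set_itvNyc; exact: measurable_itv.
move=> n; split; first by apply: measurableU => //; exact: measurable_annulus.
have ma := measurable_annulus (int_enum n).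
apply: (@le_lt_trans _ _ (invariant_ext (annulus (int_enum n)) + invariant_ext [set x | (x <= 0)%R])%E).
  exact: measureU2.
rewrite (@invariant_ext_annulus (int_enum n) _ ma (fun _ => id)) (invariant_ext0 m0) ?adde0.
  rewrite ltey_eq fin_num_measure//.
  rewrite -[X in measurable X]setTI; exact: measurable_dilate.
move=> m; apply/seteqP; split=> // x [/= x0]; rewrite /annulus /dilate/= in_itv/= => /andP[xq _].
by have := lt_trans q0 xq; rewrite pmulr_rgt0// ltNge x0.
Qed.

Definition invariant_measure : {sigma_finite_measure set (measurableTypeR R) -> \bar R} :=
  HB.pack invariant_ext
    (@Measure_isSigmaFinite.Build _ _ _ invariant_ext invariant_ext_sigma_finite).

(** Replacing [M] by its image under multiplication by [q] shifts the summation index by 1. *)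
Lemma invariant_ext_q_invariant : q_invariant q invariant_ext.
Proof.
split.
  have m0 : measurable ([set x | x < 0] : set (measurableTypeR R)).
    by rewrite -set_itvNyo; exact: measurable_itv.
  rewrite (invariant_ext0 m0)// => m.
  apply/seteqP; split=> // x [/= x0]; rewrite /annulus /dilate/= in_itv/= => /andP[xq _].
  by have := lt_trans q0 xq; rewrite pmulr_rgt0// ltNge (ltW x0).
move=> M mM _; rewrite !invariant_extE.
rewrite [RHS](@reindex_esum _ _ _ setT _ (fun m : int => m + 1))//; last first.
  by rewrite setTT_bijective; exists (fun m => m - 1) => m; rewrite ?subrK ?addrK.
apply: eq_esum => m _; congr (s _); apply/seteqP; split=> x /=.
  move=> [y My yx]; suff <- : y = dilate (m + 1) x by [].
  apply: (mulfI q_neq0); rewrite yx /dilate opprD expfzDr// mulrCA !mulrA.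
  by rewrite -[q ^ (- 1)]/(q^-1); field.
move=> Mx; exists (dilate (m + 1) x) => //.
by rewrite /dilate opprD expfzDr// -[q ^ (- 1)]/(q^-1); field.
Qed.
End invariant_extension.

(** * The shells of the model space *)

Section shells.
Context {R : realType} (q : R) (s : {finite_measure set (measurableTypeR R) -> \bar R}).
Hypothesis q01 : 0 < q < 1.
Hypothesis sq : s (~` `]q, 1]%classic) = 0%E.
Local Notation T := (measurableTypeR R).
Local Notation nu := (invariant_measure q01 sq).

(* The point (q^-i_1, ..., q^-i_k, q^-i_(k+1) x), where i_(l+1) = i.1 l + 1 and i_(k+1) = i.2. *)
Definition shell_point k (i : multi_index k) (x : T) : k.+1.-tuple T :=
  [tuple if unlift ord_max m is Some l then q ^- (i.1 l).+1 else dilate q i.2 x | m < k.+1].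

Definition shell k (i : multi_index k) : set (k.+1.-tuple T) :=
  [set t | (forall l : 'I_k, tnth t (lift ord_max l) = q ^- (i.1 l).+1) /\
           annulus q i.2 (tnth t ord_max)].

Definition shell_coord k (i : multi_index k) (t : k.+1.-tuple T) : T :=
  dilate q (- i.2) (tnth t ord_max).

Lemma tnth_shell_point k (i : multi_index k) x l : tnth (shell_point i x) (lift ord_max l) = q ^- (i.1 l).+1.
Proof. by rewrite tnth_mktuple liftK. Qed.

Lemma tnth_shell_point_max k (i : multi_index k) x : tnth (shell_point i x) ord_max = dilate q i.2 x.
Proof. by rewrite tnth_mktuple unlift_none. Qed.

Lemma shell_pointK k (i : multi_index k) : cancel (shell_point i) (shell_coord i).
Proof. by move=> x; rewrite /shell_coord tnth_shell_point_max dilateK. Qed.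

Lemma shell_coordK k (i : multi_index k) t : shell i t -> shell_point i (shell_coord i t) = t.
Proof.
move=> [ti _]; apply: eq_from_tnth => m.
case: (unliftP ord_max m) => [l|] ->; first by rewrite tnth_shell_point ti.
by rewrite tnth_shell_point_max /shell_coord dilateKV.
Qed.

Lemma shell_coord_in k (i : multi_index k) t : shell i t -> `]q, 1]%classic (shell_coord i t).
Proof. by case. Qed.

Lemma shell_point_in k (i : multi_index k) x : `]q, 1]%classic x -> shell i (shell_point i x).
Proof.
move=> xq; split; first exact: tnth_shell_point.
by rewrite tnth_shell_point_max /annulus /= dilateK.
Qed.

Lemma shell_inj k (i j : multi_index k) t : shell i t -> shell j t -> i = j.
Proof.
case: i j => [i1 i2] [j1 j2] [ti ai] [tj aj]; congr pair; last exact: (annulus_disjoint q01 ai aj).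
apply/ffunP => l; have := ti l; rewrite tj /= => /invr_inj.
have [q0 q1] := andP q01.
by move=> /(ieexprIn q0); rewrite lt_eqF// => /(_ isT) [].
Qed.

Lemma measurable_shell_point k (i : multi_index k) : measurable_fun setT (shell_point i).
Proof.
apply/measurable_fun_tnthP => m.
case: (unliftP ord_max m) => [l|] ->.
  have -> : (@tnth _ T ^~ (lift ord_max l)) \o shell_point i = cst (q ^- (i.1 l).+1).
    by apply/funext => x /=; rewrite tnth_shell_point.
  exact: measurable_cst.
have -> : (@tnth _ T ^~ ord_max) \o shell_point i = dilate q i.2.
  by apply/funext => x /=; rewrite tnth_shell_point_max.
exact: measurable_dilate.
Qed.

Lemma measurable_shell_coord k (i : multi_index k) : measurable_fun setT (shell_coord i).
Proof. by apply: measurableT_comp; [exact: measurable_dilate|exact: measurable_tnth]. Qed.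

Lemma measurable_shell k (i : multi_index k) : measurable (shell i).
Proof.
have -> : shell i = (\bigcap_(l in [set: 'I_k]) ((@tnth _ T ^~ (lift ord_max l)) @^-1` [set q ^- (i.1 l).+1]))
    `&` ((@tnth _ T ^~ ord_max) @^-1` annulus q i.2).
  apply/seteqP; split=> t [h1 h2]; split=> //.
    by move=> l _; exact: h1.
  by move=> l; exact: (h1 l I).
apply: measurableI.
  apply: fin_bigcap_measurable => [|l _]; first exact: finite_finset.
  rewrite -[X in measurable X]setTI; apply: measurable_tnth => //; exact: measurable_set1.
rewrite -[X in measurable X]setTI; apply: measurable_tnth => //; exact: measurable_annulus.
Qed.

(** The product measure is built by prepending coordinates, so inductions on [k] remove the first
    discrete index and keep the integer one. *)
Definition tail_index k (i : multi_index k.+1) : multi_index k :=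
  ([ffun l => i.1 (lift ord0 l)], i.2).

Lemma shell_cons k (i : multi_index k.+1) (x : T) (t : k.+1.-tuple T) :
  shell i (tuple_cons (x, t)) <-> x = q ^- (i.1 ord0).+1 /\ shell (tail_index i) t.
Proof.
have l0 : lift ord_max (ord0 : 'I_k.+1) = ord0 by apply: val_inj.
have lS (l : 'I_k) : lift ord_max (lift ord0 l) = lift ord0 (lift ord_max l).
  by apply: val_inj => /=; rewrite /bump /=; have := ltn_ord l; lia.
have lm : ord_max = lift ord0 (ord_max : 'I_k.+1) by apply: val_inj.
split=> [[h1 h2]|[xE [h1 h2]]]; split.
- by have := h1 ord0; rewrite l0.
- split; last by move: h2; rewrite lm tnthS.
  by move=> l; have := h1 (lift ord0 l); rewrite lS tnthS ffunE.
- move=> l; case: (unliftP ord0 l) => [l'|] ->; last by rewrite l0.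
  by rewrite lS tnthS h1 ffunE.
- by rewrite lm tnthS.
Qed.

Lemma shell_point_cons k (i : multi_index k.+1) x :
  shell_point i x = tuple_cons (q ^- (i.1 ord0).+1 : T, shell_point (tail_index i) x).
Proof.
have l0 : lift ord_max (ord0 : 'I_k.+1) = ord0 by apply: val_inj.
have lS (l : 'I_k) : lift ord_max (lift ord0 l) = lift ord0 (lift ord_max l).
  by apply: val_inj => /=; rewrite /bump /=; have := ltn_ord l; lia.
have lm : ord_max = lift ord0 (ord_max : 'I_k.+1) by apply: val_inj.
apply: eq_from_tnth => m; case: (unliftP ord_max m) => [l|] ->; last first.
  by rewrite tnth_shell_point_max lm tnthS tnth_shell_point_max.
rewrite tnth_shell_point; case: (unliftP ord0 l) => [l'|] ->; last by rewrite l0.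
by rewrite lS tnthS tnth_shell_point ffunE.
Qed.

Lemma cons_measureE k (m1 : {sigma_finite_measure set T -> \bar R})
    (m2 : {sigma_finite_measure set (k.-tuple T) -> \bar R}) A :
  (cons_measure m1 m2 A = \int[m1]_x m2 [set t | A (tuple_cons (x, t))])%E.
Proof.
rewrite /cons_measure /pushforward /product_measure1; apply: eq_integral => x _.
by congr (m2 _); apply/seteqP; split=> t; rewrite /xsection/= inE.
Qed.

Lemma Iq_counting1 m : Iq_counting q [set q ^- m.+1 : T] = 1%E.
Proof.
rewrite /Iq_counting /mrestr setIidl; last by move=> _ ->; exists m.+1.
by rewrite /counting asboolT ?finite_set1// fset_set1 finmap.cardfs1.
Qed.

(** [model_measure] restated for an arbitrary family of factors: this property, unlike the defining
    expression, passes to the tail of the family. *)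
Let is_model k (m : 'I_k.+1 -> {sigma_finite_measure set T -> \bar R}) :=
  forall j, m j = if j == ord_max then nu else (Iq_counting q : {sigma_finite_measure set T -> \bar R}).

Let model_tail k (m : 'I_k.+2 -> {sigma_finite_measure set T -> \bar R}) :
  is_model m -> is_model (fun j => m (lift ord0 j)).
Proof.
move=> hm j; rewrite hm; congr (if _ then _ else _).
Qed.

Let measurable_tcons k : measurable_fun setT (@tuple_cons _ T k).
Proof. exact: (@measurable_cons _ _ (T * k.-tuple T)%type T fst k snd). Qed.

Let mcons k (A : set (k.+1.-tuple T)) : measurable A -> measurable (@tuple_cons _ T k @^-1` A).
Proof. by move=> mA; rewrite -[X in measurable X]setTI; exact: measurable_tcons. Qed.

Let msection k (A : set (k.+1.-tuple T)) x : measurable A -> measurable [set t | A (tuple_cons (x, t))].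
Proof.
move=> /mcons /measurable_xsection -/(_ x); congr measurable.
by apply/seteqP; split=> t; rewrite /xsection/= inE.
Qed.

Lemma tuple_measure0E (m : 'I_1 -> {sigma_finite_measure set T -> \bar R}) A :
  measurable A -> tuple_measure m A = m ord0 [set x | A (tuple_cons (x, [tuple]))].
Proof.
move=> mA; have mB : measurable [set x | A (tuple_cons (x, [tuple] : 0.-tuple T))].
  have := measurable_ysection [tuple] (mcons mA); congr measurable.
  by apply/seteqP; split=> t; rewrite /ysection/= inE.
rewrite [LHS]cons_measureE.
transitivity (\int[m ord0]_x (\1_[set x | A (tuple_cons (x, [tuple] : 0.-tuple T))] x)%:E)%E; last first.
  by rewrite integral_indic// setIT.
apply: eq_integral => x _ /=; rewrite diracE indicE; congr (_%:R%:E).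
Qed.

(** Of the sections of [A] along the first coordinate only the one at [q^-i_1] is nonempty, and the
    counting measure gives this point mass 1. At the last coordinate, [A] lies in one annulus, where
    the invariant measure is a dilate of [s]. *)
Lemma tuple_measure_shell k m (i : multi_index k) A : @is_model k m -> measurable A -> A `<=` shell i ->
  tuple_measure m A = s (shell_point i @^-1` A).
Proof.
elim: k m i A => [|k IH] m i A hm mA Ai.
  rewrite tuple_measure0E//; have -> : m ord0 = nu by rewrite hm.
  have mB : measurable [set x | A (tuple_cons (x, [tuple] : 0.-tuple T))].
    have := measurable_ysection [tuple] (mcons mA); congr measurable.
    by apply/seteqP; split=> t; rewrite /ysection/= inE.
  rewrite [LHS](@invariant_ext_annulus _ q s q01 sq i.2)//; last by move=> x /= /Ai[_ h]; exact: h.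
  congr (s _); apply/seteqP; suff e x : tuple_cons (dilate q i.2 x, [tuple] : 0.-tuple T) = shell_point i x.
    by split=> x /=; rewrite e.
  apply: eq_from_tnth => j; have -> : j = ord_max by rewrite (ord1 j); apply: val_inj.
  by rewrite tnth_shell_point_max (tnth_nth 0).
pose mt := tuple_measure (fun j => m (lift ord0 j)).
transitivity (\int[m ord0]_x mt [set t | A (tuple_cons (x, t))])%E.
  exact: cons_measureE.
pose x0 : T := q ^- (i.1 ord0).+1.
have secE x : mt [set t | A (tuple_cons (x, t))] =
    (s (shell_point i @^-1` A) * (\1_[set x0] x)%:E)%E.
  rewrite indicE; have [|xx0] := boolP (x \in [set x0]).
    rewrite inE => ->; rewrite mule1.
    rewrite (IH _ (tail_index i) _ (model_tail hm) (msection x0 mA)).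
      by congr (s _); apply/seteqP; split=> y; rewrite /= shell_point_cons.
    by move=> t /= /Ai/shell_cons[].
  rewrite mule0 (_ : [set t | _] = set0) ?measure0//.
  apply/seteqP; split=> // t /= /Ai/shell_cons[xE _].
  by move: xx0 => /negP; apply; apply: mem_set; rewrite xE.
under eq_integral do rewrite secE.
have m1 : measurable_fun setT (\1_[set x0] : T -> R).
  by apply: measurable_indic; exact: measurable_set1.
rewrite ge0_integralZl//; last first.
  exact/measurable_EFinP.
rewrite integral_indic// setIT.
have -> : m ord0 = Iq_counting q by rewrite hm.
by rewrite -[RHS]mule1; congr (_ * _)%E; exact: Iq_counting1.
Qed.

(** The complement of I_q is null for the counting measure, and the sections over points of I_q meet
    no shell of one dimension less. At the last coordinate, a set that meets no annulus is null. *)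
Lemma tuple_measure_noshell k m A : @is_model k m -> measurable A ->
  (forall i, A `&` shell i = set0) -> tuple_measure m A = 0%E.
Proof.
elim: k m A => [|k IH] m A hm mA Ai.
  rewrite tuple_measure0E//; have -> : m ord0 = nu by rewrite hm.
  have mB : measurable [set x | A (tuple_cons (x, [tuple] : 0.-tuple T))].
    have := measurable_ysection [tuple] (mcons mA); congr measurable.
    by apply/seteqP; split=> t; rewrite /ysection/= inE.
  apply: (invariant_ext0 q01 sq mB) => j; apply/seteqP; split=> // x [/= Ax jx].
  have : (A `&` shell ([ffun=> 0%N], j)) (tuple_cons (x, [tuple])) by split=> //; split=> // -[].
  by rewrite Ai.
pose mt := tuple_measure (fun j => m (lift ord0 j)).
transitivity (\int[m ord0]_x mt [set t | A (tuple_cons (x, t))])%E.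
  exact: cons_measureE.
transitivity (\int[m ord0]_x (cst 0%E x))%E; last by rewrite integral0.
apply: ae_eq_integral => //.
  have := measurable_fun_xsection mt (mcons mA); congr measurable_fun.
  by apply/funext => x /=; congr (mt _); apply/seteqP; split=> t; rewrite /xsection/= inE.
have mIq : measurable (Iq q : set T).
  apply: countable_measurable; first exact: measurable_set1.
  by apply: card_le_trans (card_image_le _ _) _; exact: countableP.
have -> : m ord0 = Iq_counting q by rewrite hm.
exists (~` (Iq q)); split; first exact: measurableC.
  transitivity (@counting T R (~` Iq q `&` Iq q)); first by [].
  by rewrite setICl; exact: measure0.
apply: subsetC => x [j j0 <-] _ /=; case: j j0 => // j _.
apply: (IH _ _ (model_tail hm) (msection _ mA)) => i.
apply/seteqP; split=> // t [/= At ti].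
pose i' : multi_index k.+1 :=
  ([ffun l : 'I_k.+1 => if unlift ord0 l is Some l' then i.1 l' else j], i.2).
have : (A `&` shell i') (tuple_cons (q ^- j.+1 : T, t)).
  split=> //; apply/shell_cons; split; first by rewrite ffunE unlift_none.
  suff -> : tail_index i' = i by [].
  case: (i) @i' => [i1 i2] i'; congr pair.
  by apply/ffunP => l; rewrite !ffunE liftK.
by rewrite Ai.
Qed.

End shells.

Section almost_everywhere_combination.
Context d (T : measurableType d) (R : realType) (m : {measure set T -> \bar R}).
Implicit Types P : T -> Prop.

Lemma aeS1 P Q : {ae m, forall t, P t} -> (forall t, P t -> Q t) -> {ae m, forall t, Q t}.
Proof. by move=> p h; apply: filterS p. Qed.
Lemma aeS2 P1 P2 Q : {ae m, forall t, P1 t} -> {ae m, forall t, P2 t} ->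
  (forall t, P1 t -> P2 t -> Q t) -> {ae m, forall t, Q t}.
Proof. by move=> p1 p2 h; apply: filterS2 p1 p2. Qed.
Lemma aeS3 P1 P2 P3 Q : {ae m, forall t, P1 t} -> {ae m, forall t, P2 t} -> {ae m, forall t, P3 t} ->
  (forall t, P1 t -> P2 t -> P3 t -> Q t) -> {ae m, forall t, Q t}.
Proof. by move=> p1 p2 p3 h; apply: filterS3 p1 p2 p3. Qed.
Lemma aeI P1 P2 : {ae m, forall t, P1 t} -> {ae m, forall t, P2 t} -> {ae m, forall t, P1 t /\ P2 t}.
Proof. by move=> p1 p2; apply: aeS2 p1 p2 _ => t. Qed.
End almost_everywhere_combination.

(** * The model space as the orthogonal sum of its shells *)

Section model_space.
Context {R : realType} (q : R) (s : {finite_measure set (measurableTypeR R) -> \bar R}).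
Hypothesis q01 : 0 < q < 1.
Hypothesis sq : s (~` `]q, 1]%classic) = 0%E.
Variable k : nat.
Local Notation T := (measurableTypeR R).
Local Notation nu := (invariant_measure q01 sq).
Local Notation mu := (model_measure q k nu).
Implicit Types i j : multi_index k.

Lemma mu_shell i A : measurable A -> A `<=` shell q i -> mu A = s (shell_point q i @^-1` A).
Proof. exact: tuple_measure_shell. Qed.

Lemma mu_noshell A : measurable A -> (forall i, A `&` shell q i = set0) -> mu A = 0%E.
Proof. by move=> mA Ai; exact: (tuple_measure_noshell (q01 := q01) (sq := sq)). Qed.

Let mq : measurable (`]q, 1]%classic : set T).
Proof. exact: measurable_itv. Qed.

Lemma ae_in_q1 : {ae s, forall x : T, `]q, 1]%classic x}.
Proof. by exists (~` `]q, 1]%classic); split => //; exact: measurableC. Qed.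

(** There are countably many shells, their complement is null, and [shell_point i] carries [s] to
    the restriction of [mu] to the shell [i]. Almost everywhere statements on the model space are
    thus checked shell by shell. *)
Lemma mu_aeP (P : k.+1.-tuple T -> Prop) :
  {ae mu, forall t, P t} <-> forall i, {ae s, forall x : T, P (shell_point q i x)}.
Proof.
split=> [[N [mN N0 PN]] i|h].
  have mNi : measurable (N `&` shell q i) by apply: measurableI => //; exact: measurable_shell.
  have : {ae s, forall x : T, ~ (N `&` shell q i) (shell_point q i x)}.
    exists (shell_point q i @^-1` (N `&` shell q i)); split.
    - by rewrite -[X in measurable X]setTI; exact: (measurable_shell_point q i).
    - rewrite -(@mu_shell i)//; apply/eqP; rewrite -measure_le0 -N0.
      by apply: le_measure; rewrite ?inE.
    - by move=> x /= nn; apply: contrapT => h; apply: nn.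
  move=> h; apply: (aeS2 ae_in_q1 h) => x xq nN; apply: contrapT => nP; apply: nN.
  by split; [exact: PN|exact: shell_point_in].
have /choice[N hN] i : exists N : set T, [/\ measurable N, s N = 0%E & forall x, ~ P (shell_point q i x) -> N x].
  by have [N [mN N0 PN]] := h i; exists N; split=> // x nP; apply: PN.
(* The exceptional set of the shell [i], enlarged by everything outside that shell. The intersection
   of all [B i] then contains every exceptional point and meets each shell in a null set. *)
pose B i : set (k.+1.-tuple T) := ~` shell q i `|` shell_coord q i @^-1` N i.
have mB i : measurable (B i).
  apply: measurableU; first by apply: measurableC; exact: measurable_shell.
  rewrite -[X in measurable X]setTI; apply: measurable_shell_coord => //.
  by case: (hN i).
have mcap (F : multi_index k -> set (k.+1.-tuple T)) :
    (forall i, measurable (F i)) -> measurable (\bigcap_i F i).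
  move=> mF; rewrite -[X in measurable X]setCK setC_bigcap; apply: measurableC.
  by apply: countable_bigcupT_measurable => [|i]; [exact: (@countableP ({ffun 'I_k -> nat} * int)%type)|exact: measurableC].
have mBc := mcap _ mB.
exists (\bigcap_i B i); split => //; last first.
  move=> t nP i _; have [ti|ti] := pselect (shell q i t); [right|by left].
  case: (hN i) => _ _; apply; rewrite /= in nP.
  by rewrite shell_coordK// => Pt; apply: nP.
have shell0 i : mu ((\bigcap_i B i) `&` shell q i) = 0%E.
  have mi : measurable ((\bigcap_i B i) `&` shell q i) by apply: measurableI => //; exact: measurable_shell.
  rewrite (@mu_shell i)//; apply/eqP; rewrite -measure_le0; have [mN N0 _] := hN i; rewrite -N0.
  apply: le_measure; rewrite ?inE//.
    by rewrite -[X in measurable X]setTI; exact: (measurable_shell_point q i).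
  move=> x /= [Bx ix]; case: (Bx i I) => [//|]; by rewrite /= shell_pointK.
have mO : measurable (\bigcap_i (B i `&` ~` shell q i)).
  apply: mcap => i; by apply: measurableI => //; apply: measurableC; exact: measurable_shell.
apply/negligibleP => //.
apply: (@negligibleS _ _ _ mu ((\bigcap_i (B i `&` ~` shell q i)) `|`
    \bigcup_n (if unpickle n is Some i then (\bigcap_i B i) `&` shell q i else set0))).
  move=> t Bt; have [[i ti]|nt] := pselect (exists i, shell q i t).
    by right; exists (pickle i) => //; rewrite pickleK.
  by left => i _; split; [exact: Bt|move=> ti; apply: nt; exists i].
apply: negligibleU.
  apply/negligibleP => //; apply: mu_noshell => // i.
  by apply/seteqP; split=> // t [/(_ i I)[_ nt]].
apply: negligible_bigcup => n; case: unpickle => [i|]; last exact: negligible_set0.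
by apply/negligibleP; [apply: measurableI => //; exact: measurable_shell|exact: shell0].
Qed.

Lemma measurable_shell_indic i : measurable_fun setT (\1_(shell q i) : k.+1.-tuple T -> R).
Proof. by apply: measurable_indic; exact: measurable_shell. Qed.

Lemma indic_le1 (U : Type) (A : set U) (t : U) : `|\1_A t : R| <= 1.
Proof. by rewrite indicE; case: (_ \in _); rewrite ?normr1 ?normr0. Qed.

Definition shell_proj i : L2 mu -> L2 mu :=
  L2mul (measurable_shell_indic i) (@indic_le1 _ (shell q i)).
HB.instance Definition _ i := GRing.Linear.on (shell_proj i).

(** On the shell, [mu] is the image of [s]; the points outside ]q, 1], which [shell_point i] does
    not send into the shell, are [s]-null. *)
Lemma shell_integral i (F : k.+1.-tuple T -> \bar R) : measurable_fun setT F ->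
  (forall t, 0 <= F t)%E ->
  (\int[mu]_(t in shell q i) F t = \int[s]_x F (shell_point q i x))%E.
Proof.
move=> mF F0; have mi := measurable_shell q i.
transitivity (\int[pushforward_measure s (measurable_shell_point q i)]_(t in shell q i) F t)%E.
  by apply: eq_measure_integral => A mA Ai; exact: (@mu_shell i A mA Ai).
have mFT : measurable_fun (shell q i) F by exact: measurable_funTS.
rewrite [LHS](ge0_integral_pushforward (measurable_shell_point q i) s mi mFT (fun t _ => F0 t)).
pose Q : set T := `]q, 1]%classic.
have -> : shell_point q i @^-1` shell q i = Q.
  apply/seteqP; split=> x; last exact: shell_point_in.
  by move=> /shell_coord_in; rewrite shell_pointK.
rewrite [RHS](_ : _ = \int[s]_(x in Q `|` ~` Q) F (shell_point q i x))%E; last by rewrite setUv.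
have mFi : measurable_fun setT (F \o shell_point q i).
  by apply: measurableT_comp => //; exact: (measurable_shell_point q i).
rewrite ge0_integral_setU//; last 2 first.
- by rewrite setUv.
- by apply/disj_setPS => x [].
rewrite -[LHS]adde0; congr (_ + _)%E; apply/esym; apply: null_set_integral => //.
  exact: measurableC.
exact: measurable_funTS.
exact: measurableC.
Qed.

Lemma square_integrable_slice i (f : L2 mu) : square_integrable s (fun x => f (shell_point q i x)).
Proof.
have [fr fi ff] := L2P f; split.
- exact: (measurableT_comp fr (measurable_shell_point q i)).
- exact: (measurableT_comp fi (measurable_shell_point q i)).
have mf : measurable_fun setT (fun t => (sqmod (f t))%:E).
  exact/measurable_EFinP/square_integrable_measurable/L2P.
apply: le_lt_trans ff.
have := shell_integral i mf (fun t => sqmod_ge0 (f t)); rewrite /sqmod => <-.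
apply: ge0_subset_integral => //; first exact: measurable_shell.
by move=> t _; rewrite lee_fin sqmod_ge0.
Qed.

(* On the shell [i], L_2(mu) is a copy of L_2(s): [slice i] restricts to it, [emb i] extends by 0. *)
Definition slice i (f : L2 mu) : L2 s := toL2 (square_integrable_slice i f).

Lemma square_integrable_emb i (h : L2 s) :
  square_integrable mu (fun t => (\1_(shell q i) t)%:C * h (shell_coord q i t)).
Proof.
have [hr hi hh] := L2P h.
have mr := measurableT_comp hr (measurable_shell_coord q i).
have mi := measurableT_comp hi (measurable_shell_coord q i).
have m1 := measurable_shell_indic i.
have e1 : (fun t => complex.Re ((\1_(shell q i) t)%:C * h (shell_coord q i t))) =
          (fun t => \1_(shell q i) t * complex.Re (h (shell_coord q i t))).
  by apply/funext => t; case: (h _) => a b /=; ring.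
have e2 : (fun t => complex.Im ((\1_(shell q i) t)%:C * h (shell_coord q i t))) =
          (fun t => \1_(shell q i) t * complex.Im (h (shell_coord q i t))).
  by apply/funext => t; case: (h _) => a b /=; ring.
split; [by rewrite e1; exact: measurable_funM|by rewrite e2; exact: measurable_funM|].
have mh : measurable_fun setT (fun t => (sqmod (h (shell_coord q i t)))%:E).
  by apply/measurable_EFinP; apply: measurable_funD; apply: measurable_funX.
have hE : (\int[mu]_(t in shell q i) (sqmod (h (shell_coord q i t)))%:E = \int[s]_x (sqmod (h x))%:E)%E.
  rewrite (shell_integral i mh) => [|t]; last by rewrite lee_fin sqmod_ge0.
  by apply: eq_integral => x _; rewrite shell_pointK.
have hh' : (\int[s]_x (sqmod (h x))%:E < +oo)%E by [].
rewrite -hE integral_mkcond in hh'; apply: le_lt_trans hh'.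
rewrite le_eqVlt; apply/orP; left; apply/eqP; apply: eq_integral => t _.
rewrite -/(sqmod _) sqmodZ patchE indicE; case: ifP => _; rewrite ?expr1n ?mul1r//.
by rewrite expr0n mul0r.
Qed.

Definition emb i (h : L2 s) : L2 mu := toL2 (square_integrable_emb i h).

Lemma embE i h : {ae mu, forall t, emb i h t = (\1_(shell q i) t)%:C * h (shell_coord q i t)}.
Proof. exact: toL2E. Qed.

Lemma emb_linear i : linear (emb i).
Proof.
suff H (a : R[i]) (f g : L2 s) : emb i (a *: f + g) = a *: emb i f + emb i g by exact: H.
apply/L2_eqP/mu_aeP => j.
have ef := embE i f; have eg := embE i g; have el := L2_linE a (emb i f) (emb i g).
have elE : {ae mu, forall t, (a *: emb i f + emb i g : L2 mu) t = (\1_(shell q i) t)%:C * (a * f (shell_coord q i t) + g (shell_coord q i t))}.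
  by apply: (aeS3 ef eg el) => t e1 e2 ->; rewrite e1 e2 mulrDr mulrCA.
have e1 := (mu_aeP _).1 (embE i (a *: f + g)) j.
have e2 := (mu_aeP _).1 elE j.
apply: (aeS3 (aeI e1 e2) (L2_linE a f g) ae_in_q1) => x [-> ->] e3 xq.
have [ij|] := pselect (shell q i (shell_point q j x)); last first.
  by move=> ni; rewrite indicE memNset// !mul0r.
have -> : i = j by exact: (shell_inj q01 ij (shell_point_in q01 j xq)).
by rewrite shell_pointK// e3.
Qed.

HB.instance Definition _ i :=
  GRing.isLinear.Build R[i] (L2 s) (L2 mu) _ (emb i) (emb_linear i).

Lemma emb_point i h j : {ae s, forall x : T, emb i h (shell_point q j x) = if i == j then h x else 0}.
Proof.
apply: (aeS2 ((mu_aeP _).1 (embE i h) j) ae_in_q1) => x -> xq.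
have jx := shell_point_in q01 j xq.
have [->|ij] := eqVneq i j; first by rewrite indicE mem_set// mul1r shell_pointK.
rewrite indicE memNset ?mul0r// => ix.
by move: ij; rewrite (shell_inj q01 ix jx) eqxx.
Qed.

Lemma emb_rnorm i h : rnorm (emb i h) = rnorm h.
Proof.
apply/eqP; rewrite -(@eqrXn2 _ 2) ?rnorm_ge0//; apply/eqP/EFin_inj.
rewrite -!L2_rnorm.
have mh : measurable_fun setT (fun t => (sqmod (h (shell_coord q i t)))%:E).
  have := square_integrable_measurable (L2P h) => m.
  by apply/measurable_EFinP; apply: (measurableT_comp m); exact: measurable_shell_coord.
transitivity (\int[mu]_(t in shell q i) (sqmod (h (shell_coord q i t)))%:E)%E; last first.
  rewrite (shell_integral i mh) => [|t]; last by rewrite lee_fin sqmod_ge0.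
  by apply: eq_integral => x _; rewrite shell_pointK.
rewrite [RHS]integral_mkcond; apply: ae_eq_integral => //.
- exact/measurable_EFinP/square_integrable_measurable/L2P.
- apply/(measurable_restrictT _ _).1 => //; first exact: measurable_shell.
  exact: measurable_funTS.
- apply: (aeS1 (embE i h)) => t -> _; rewrite sqmodZ patchE indicE.
  by case: ifP => _; rewrite ?expr1n ?mul1r// expr0n mul0r.
Qed.

Lemma emb_isometric i : isometric (emb i).
Proof. by apply: isometric_of_rnorm => h; exact: emb_rnorm. Qed.

Lemma emb_orthogonal i j (h h' : L2 s) : i <> j -> dotp (emb i h) (emb j h') = 0.
Proof.
move=> ij; rewrite (L2_dotp_ae (square_integrable_emb i h) (square_integrable_emb j h') (embE i h) (embE j h')).
have zero t : (\1_(shell q i) t)%:C * h (shell_coord q i t) *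
    ((\1_(shell q j) t)%:C * h' (shell_coord q j t))^*%C = 0.
  rewrite !indicE; have [it|_] := boolP (t \in shell q i); last by rewrite !mul0r.
  rewrite (@memNset _ (shell q j)) => [|jt]; first by rewrite mul0r conjc0 mulr0.
  by apply: ij; exact: (shell_inj q01 (set_mem it) jt).
by apply/eqP; rewrite eq_complex/= /Rintegral !integral0_eq ?eqxx// => t _; rewrite zero.
Qed.

Lemma emb_slice i f : emb i (slice i f) = shell_proj i f.
Proof.
apply/L2_eqP/mu_aeP => j.
have e2 := (mu_aeP _).1 (L2mulE (measurable_shell_indic i) (@indic_le1 _ (shell q i)) f) j.
apply: (aeS3 (aeI (emb_point i (slice i f) j) e2) ae_in_q1 (toL2E (square_integrable_slice i f))).
move=> x [-> ->] xq e3; have jx := shell_point_in q01 j xq.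
have [ij|ij] := eqVneq i j; first by subst j; rewrite indicE mem_set// mul1r e3.
rewrite indicE memNset ?mul0r// => ix.
by move: ij; rewrite (shell_inj q01 ix jx) eqxx.
Qed.

Lemma shell_proj_idem i f : shell_proj i (shell_proj i f) = shell_proj i f.
Proof.
pose m1 := measurable_shell_indic i; pose b1 := @indic_le1 _ (shell q i).
apply/L2_eqP; apply: (aeS2 (L2mulE m1 b1 (shell_proj i f)) (L2mulE m1 b1 f)) => t -> ->.
by rewrite indicE; case: (_ \in _); rewrite ?mul1r ?mul0r.
Qed.

(** [emb i (slice i f)] is the orthogonal projection of [f] to the shell [i], so its squared norm is
    its inner product with [f], which is 0. A function that vanishes on all shells is 0. *)
Lemma emb_ortho_eq0 f : (forall i h, dotp f (emb i h) = 0) -> f = 0.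
Proof.
move=> hf; have P0 i : shell_proj i f = 0.
  apply: dotp_self_eq0; rewrite -[RHS](hf i (slice i f)) emb_slice.
  by rewrite [LHS]L2mul_selfadjoint; congr dotp; exact: shell_proj_idem.
apply/L2_eqP/mu_aeP => i.
have e1 := (mu_aeP _).1 (L2mulE (measurable_shell_indic i) (@indic_le1 _ (shell q i)) f) i.
have e0 := (mu_aeP _).1 (L2_0E mu) i.
apply: (aeS3 e1 e0 ae_in_q1) => x; rewrite -/(shell_proj i f) P0 => -> e xq.
by move: e; rewrite indicE mem_set ?mul1r//; exact: shell_point_in.
Qed.

Lemma emb_dense (f : L2 mu) : closure (lin_span (\bigcup_i range (emb i))) f.
Proof.
apply: orthogonal_dense; first exact: L2_complete.
by move=> {}f hf; apply: emb_ortho_eq0 => i h; apply: hf; exists i => //; exists h.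
Qed.

End model_space.

Section model_slices.
Context {R : realType} (q : R) (s : {finite_measure set (measurableTypeR R) -> \bar R}).
Hypothesis q01 : 0 < q < 1.
Hypothesis sq : s (~` `]q, 1]%classic) = 0%E.
Variable k : nat.
Local Notation T := (measurableTypeR R).
Local Notation nu := (invariant_measure q01 sq).
Local Notation mu := (model_measure q k nu).
Implicit Types (i j : multi_index k) (f g : L2 mu).

Lemma sliceE i f : {ae s, forall x, slice i f x = f (shell_point q i x)}.
Proof. exact: toL2E. Qed.

Lemma slice_linear i : linear (@slice _ _ _ q01 sq k i).
Proof.
suff H (a : R[i]) (f g : L2 mu) : slice i (a *: f + g) = a *: slice i f + slice i g by exact: H.
apply/L2_eqP; have e := (mu_aeP q01 sq _).1 (L2_linE a f g) i.
have e' := aeI (sliceE i (a *: f + g)) (L2_linE a (slice i f) (slice i g)).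
by apply: (aeS3 (aeI (sliceE i f) (sliceE i g)) e' e) => x [e1 e2] [-> ->] ->; rewrite e1 e2.
Qed.
HB.instance Definition _ i := GRing.isLinear.Build R[i] (L2 mu) (L2 s) _ (slice i) (slice_linear i).

Lemma slice_inj f g : (forall i, slice i f = slice i g) -> f = g.
Proof.
move=> fg; apply/L2_eqP/mu_aeP => i.
by apply: (aeS2 (sliceE i f) (sliceE i g)) => x <- <-; rewrite fg.
Qed.

Lemma slice_eq0P i f : slice i f = 0 <-> {ae s, forall x : T, f (shell_point q i x) = 0}.
Proof.
split=> [f0|f0].
  by apply: (aeS2 (sliceE i f) (L2_0E s)) => x <-; rewrite f0.
by apply/L2_eqP; apply: (aeS3 (sliceE i f) (L2_0E s) f0) => x -> ->.
Qed.

Lemma slice_emb i j (h : L2 s) : slice j (emb q01 sq i h) = if i == j then h else 0.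
Proof.
apply/L2_eqP; apply: (aeS3 (sliceE j (emb q01 sq i h)) (emb_point q01 sq i h j) (L2_0E s)) => x -> ->.
by case: ifP.
Qed.

Lemma sum_slices f (S : seq (multi_index k)) : uniq S -> (forall i, i \notin S -> slice i f = 0) ->
  f = \sum_(i <- S) emb q01 sq i (slice i f).
Proof.
move=> uS fS; apply: slice_inj => j; rewrite linear_sum/=.
under eq_bigr do rewrite slice_emb.
have [jS|jS] := boolP (j \in S).
  rewrite (bigD1_seq j)//= eqxx big1 ?addr0// => i /negPf -> //.
by rewrite fS// big_seq big1// => i iS; case: eqVneq => // ij; move: jS; rewrite -ij iS.
Qed.

End model_slices.

(** * The model operators *)

Section shifts.
Context {R : realType} (q : R).
Hypothesis q01 : 0 < q < 1.
Variable k : nat.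
Implicit Types (i j : multi_index k) (l : 'I_k.+1).

(** A uniform treatment of the two nonzero cases of the action: [unlift ord_max] separates the last
    index, which runs over Z, from the others. *)
Definition shift_index l i : multi_index k :=
  if unlift ord_max l is Some l' then incr_index l' i else incr_last i.

Definition shift_coef l i : R :=
  if unlift ord_max l is Some l' then std_coef q l' i else q ^ (- i.2).

Lemma shift_inj l : injective (shift_index l).
Proof.
move=> [i1 i2] [j1 j2]; rewrite /shift_index; case: unlift => [l'|] [] /=; last by move=> -> /addIr ->.
move=> /ffunP e ->; congr pair; apply/ffunP => m; have := e m; rewrite !ffunE/=.
by case: eqP => // _ [].
Qed.

Lemma tnth_scale_coord l (t : k.+1.-tuple R) m :
  tnth (scale_coord q l t) m = if m == l then q * tnth t m else tnth t m.
Proof. by rewrite tnth_mktuple. Qed.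

Let q_neq0 : q != 0. Proof. by rewrite gt_eqF//; case/andP: q01. Qed.

Lemma mulq_dilate m x : q * dilate q (m + 1) x = dilate q m x.
Proof. by rewrite /dilate mulrA opprD expfzDr// exprN1 mulrCA mulfV// mulr1. Qed.

Lemma mulq_exprN m : q * q ^- m.+1 = q ^- m.
Proof. by rewrite exprS invfM mulrA mulfV// mul1r. Qed.

Lemma scale_coord_shift l i x : scale_coord q l (shell_point q (shift_index l i) x) = shell_point q i x.
Proof.
apply: eq_from_tnth => m; rewrite tnth_scale_coord /shift_index.
case: (unliftP ord_max l) => [l'|] ->; case: (unliftP ord_max m) => [m'|] ->.
- rewrite !tnth_shell_point /= ffunE (inj_eq lift_inj).
  by case: eqP => // _; rewrite mulq_exprN.
- by rewrite !tnth_shell_point_max -if_neg neq_lift.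
- by rewrite !tnth_shell_point -if_neg eq_sym neq_lift.
- by rewrite !tnth_shell_point_max eqxx mulq_dilate.
Qed.

(** On the shifted shell, [q t_l] is the coordinate before the shift, so every coordinate in the
    coefficient is a power of [q] except the last one, which contributes the single factor [x]. *)
Lemma model_action_shift l i f x :
  model_action q l f (shell_point q (shift_index l i) x) = (shift_coef l i * x)%:C * f (shell_point q i x).
Proof.
rewrite /model_action scale_coord_shift; case: ifP => [/eqP ->|lm]; congr (_%:C * _).
  rewrite tnth_shell_point_max /shift_index /shift_coef unlift_none /incr_last /=.
  exact: mulq_dilate.
rewrite /shift_index /shift_coef; case: (unliftP ord_max l) lm => [l'|] ->; last by rewrite eqxx.
move=> _; rewrite /std_coef tnth_shell_point /= ffunE eqxx mulq_exprN -mulrA; congr (_ * _).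
  by congr (Num.sqrt (_ - 1)); rewrite -exprVn -exprM mulrC [LHS]exprnP exprz_inv; congr (_ ^ _); lia.
rewrite big_mkcond big_ord_recr/= tnth_shell_point_max.
have bE (m : 'I_k) : bump k m = m by rewrite /bump leqNgt ltn_ord.
rewrite !(bE l') ltn_ord /dilate /= opprD expfzDr// mulrA; congr (_ * _ * _).
rewrite [X in q ^ (- X)]big_mkcond -sumrN.
elim/big_rec2 : _ => [|m u v _ ->]; first by rewrite expr0z.
rewrite expfzDr//; congr (_ * _).
have -> : widen_ord (leqnSn k) m = lift ord_max m by apply: val_inj; rewrite /= bE.
case: ltnP => // lm; rewrite tnth_shell_point/= ffunE.
by rewrite -if_neg neq_ltn lm orbT exprnN.
Qed.

(** Only the smallest value of a discrete index is not a shift. There [t_l = 1 / q] and the square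
    root vanishes. The last index, ranging over Z, is always a shift. *)
Lemma model_action_noshift l j f x : (forall i, j <> shift_index l i) ->
  model_action q l f (shell_point q j x) = 0.
Proof.
move=> hj; have := hj; rewrite /model_action /shift_index; case: (unliftP ord_max l) => [l'|] -> h.
  rewrite eq_sym -if_neg neq_lift.
  have j0 : j.1 l' = 0%N.
    case jl : (j.1 l') => [//|m]; exfalso.
    apply: (h ([ffun o => if o == l' then m else j.1 o], j.2)).
    case: j {hj h} jl => j1 j2 /= jl; congr pair; apply/ffunP => o; rewrite !ffunE.
    by case: eqP => // ->.
  by rewrite tnth_shell_point j0 expr1 mulfV// expr1n subrr sqrtr0 mul0r mul0r.
exfalso; apply: (h (j.1, j.2 - 1)); rewrite /incr_last /= subrK.
by case: j {hj h}.
Qed.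

End shifts.

(** * The domain of the model operators *)

Section multi_index_box.
Variable k : nat.
Implicit Types i : multi_index k.

Definition index_box b : seq (multi_index k) :=
  codom (fun u : {ffun 'I_k -> 'I_b.+1} * 'I_(b.*2.+1) =>
    ([ffun l => u.1 l : nat], (u.2 : nat)%:Z - b%:Z) : multi_index k).

Lemma notin_index_box b i : i \notin index_box b -> (exists l, (b < i.1 l)%N) \/ (b < `|i.2|)%N.
Proof.
move=> ib; apply: contrapT => /not_orP[h1 h2]; move: ib => /negP; apply.
have i1b l : (i.1 l < b.+1)%N by rewrite ltnS leqNgt; apply/negP => h; apply: h1; exists l.
have i2b : (absz (i.2 + b%:Z)%R < b.*2.+1)%N by move/negP : h2; lia.
apply/codomP; exists ([ffun l => Ordinal (i1b l)], Ordinal i2b).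
case: i h1 h2 i1b i2b => i1 i2 /= h1 h2 i1b i2b; congr pair; first by apply/ffunP => l; rewrite !ffunE.
by move/negP : h2; lia.
Qed.
End multi_index_box.

Section model_domain.
Context {R : realType} (q : R) (s : {finite_measure set (measurableTypeR R) -> \bar R}).
Hypothesis q01 : 0 < q < 1.
Hypothesis sq : s (~` `]q, 1]%classic) = 0%E.
Context {n : nat} (k : 'I_n).
Local Notation T := (measurableTypeR R).
Local Notation nu := (invariant_measure q01 sq).
Local Notation mu := (model_measure q k nu).
Implicit Types (i j : multi_index k) (f g : L2 mu).

Let q0 : 0 < q. Proof. by case/andP: q01. Qed.
Let q1 : q < 1. Proof. by case/andP: q01. Qed.

Let row_point i (x : R) : 'rV[R]_k.+1 := \row_m tnth (shell_point q i x) m.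

Let row_point_continuous i : continuous (row_point i).
Proof.
pose M0 : 'rV[R]_k.+1 := row_point i 0.
pose M1 : 'rV[R]_k.+1 := q ^ (- i.2) *: delta_mx 0 ord_max.
have -> : row_point i = (fun x => M0 + x *: M1).
  apply/funext => x; apply/rowP => m; rewrite !mxE.
  case: (unliftP ord_max m) => [l|] ->.
    by rewrite !tnth_shell_point /= eq_sym (negPf (neq_lift _ _)) !mulr0 addr0.
  by rewrite !tnth_shell_point_max !eqxx mulr1 /dilate mulr0 add0r mulrC.
by move=> x; apply: cvgD; [exact: cvg_cst|apply: cvgZr_tmp; exact: cvg_id].
Qed.

(** Near each point of [C] both bounds hold for all large [N], and compactness makes [N] uniform. *)
Let box_bound (C : set 'rV[R]_k.+1) : compact C -> C `<=` [set v | 0 < v 0 ord_max] ->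
  exists N : nat, forall v, C v -> (forall m, v 0 m < N%:R) /\ N.+1%:R^-1 < v 0 ord_max.
Proof.
move=> /compact_near_coveringP cC C0.
pose P (N : nat) (v : 'rV[R]_k.+1) := (forall m, v 0 m < N%:R) /\ N.+1%:R^-1 < v 0 ord_max.
have : \forall N \near \oo, C `<=` P N.
  apply: cC => v Cv.
  have H1 m : filter_prod (nbhs v) \oo [set p : 'rV[R]_k.+1 * nat | p.1 0 m < p.2%:R].
    have [N hN] : exists N : nat, v 0 m + 1 < N%:R.
      exists (Num.truncn `|v 0 m + 1|).+1; apply: le_lt_trans (ler_norm _) _; exact: truncnS_gt.
    exists ([set w : 'rV[R]_k.+1 | w 0 m < v 0 m + 1], [set N' | (N <= N')%N]) => /=; first split.
    - by apply: (@coord_continuous R 1 k.+1 0 m v [set r | r < v 0 m + 1]); apply: lt_nbhsl; rewrite ltrDl.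
    - by exists N.
    - by move=> [w N'] [/= h1 h2]; apply: lt_trans h1 _; apply: lt_le_trans hN _; rewrite ler_nat.
  have H2 : filter_prod (nbhs v) \oo [set p : 'rV[R]_k.+1 * nat | p.2.+1%:R^-1 < p.1 0 ord_max].
    have v0 : 0 < v 0 ord_max by exact: C0.
    have v2 : 0 < v 0 ord_max / 2 by rewrite divr_gt0.
    have [N hN] := inv_natS_lt v2.
    exists ([set w : 'rV[R]_k.+1 | v 0 ord_max / 2 < w 0 ord_max], [set N' | (N <= N')%N]) => /=; first split.
    - by apply: (@coord_continuous R 1 k.+1 0 ord_max v [set r | v 0 ord_max / 2 < r]); apply: lt_nbhsr; lra.
    - by exists N.
    - move=> [w N'] [/= h1 h2]; exact: lt_trans (hN _ h2) h1.
  have H := filter_forall (filter_prod_filter _ _) H1.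
  by apply: (@filterS2 _ _ (filter_prod_filter _ _) _ _ _ _ (H _ _) H2) => p.
by move=> [N _ hN]; exists N => v Cv; exact: (hN N (leqnn N) v Cv).
Qed.

(** A large positive index makes a coordinate at least [q^-b > N]; a large negative last index makes
    the last coordinate at most [q^b < 1 / (N + 1)]. *)
Let far_point i (N b : nat) (x : R) : q <= x <= 1 -> q ^+ b < N.+1%:R^-1 ->
  (exists l, (b < i.1 l)%N) \/ (b < `|i.2|)%N ->
  ~ ((forall m, row_point i x 0 m < N%:R) /\ N.+1%:R^-1 < row_point i x 0 ord_max).
Proof.
move=> /andP[qx x1] qb h [h1 h2].
have qbN : N%:R < q ^- b.
  rewrite -[N%:R]invrK; apply: lt_trans (_ : N.+1%:R < _); first by rewrite invrK ltr_nat.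
  by rewrite -[ltLHS]invrK ltf_pV2// posrE ?invr_gt0 ?exprn_gt0.
have qV (m m' : int) : m <= m' -> q ^ m' <= q ^ m.
  move=> mm'; have -> : m' = m + `|m' - m|%N by lia.
  by rewrite expfzDr ?gt_eqF// ger_pMr ?exprz_gt0// -exprnP exprn_ile1// ltW.
case: h => [[l bl]|bi].
  have := h1 (lift ord_max l); rewrite mxE tnth_shell_point; apply/negP; rewrite -leNgt.
  apply: le_trans (ltW qbN) _; rewrite !exprnN; apply: qV; lia.
have [i0|i0] := leP 0 i.2; last first.
  move: h2; rewrite mxE tnth_shell_point_max; apply/negP; rewrite -leNgt.
  apply: le_trans _ (ltW qb); rewrite /dilate -[leRHS]mulr1 ler_pM ?exprz_ge0 ?(ltW q0)//.
    exact: le_trans (ltW q0) qx.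
  by rewrite exprnP; apply: qV; lia.
have := h1 ord_max; rewrite mxE tnth_shell_point_max; apply/negP; rewrite -leNgt.
apply: le_trans (ltW qbN) _; rewrite /dilate.
apply: le_trans (_ : q ^ (- i.2) * q <= _); last by rewrite ler_wpM2l// exprz_ge0// ltW.
by rewrite -[X in _ * X]expr1z -expfzDr ?gt_eqF// exprnN; apply: qV; lia.
Qed.

(** Each point of the closed segment over the shell has a neighbourhood on which [f] vanishes almost
    everywhere, and by compactness finitely many of them suffice. *)
Let ae_of_cover i f : (forall x : R, q <= x <= 1 -> ~ ess_supp mu f (row_point i x)) -> slice i f = 0.
Proof.
move=> h; apply/slice_eq0P.
have /compact_near_coveringP cI := @segment_compact R q 1.
(* The covering form of compactness concerns a fixed parameter [y] and all [x] of the segment; the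
   premise [y = x] makes the parameter range over the segment itself. *)
have := cI T (almost_everywhere s) (fun y x => y = x -> f (shell_point q i y) = 0) _.
move=> /(_ (ae_filter_ringOfSetsType s)) H.
have {}H : {ae s, forall y : T, forall x, `[q, 1]%classic x -> y = x -> f (shell_point q i y) = 0}.
  apply: H => x /= xq; rewrite in_itv/= in xq.
  have /existsNP[U /not_implyP[vU /contrapT fU]] := h x xq.
  exists (row_point i @^-1` U, [set y | U (row_point i y) -> f (shell_point q i y) = 0]) => /=.
    split; first exact: (row_point_continuous vU).
    exact: ((mu_aeP q01 sq _).1 fU i).
  by move=> [y z] [/= Uy fz] zy; apply: fz; rewrite zy.
apply: (aeS2 (ae_in_q1 sq) H) => x xq hx; apply: (hx x) => //.
by move: xq; rewrite /= !in_itv/= => /andP[/ltW -> ->].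
Qed.

Let exprn_lt e : 0 < e -> exists b, q ^+ b < e.
Proof.
by move=> e0; have [|b hb] := @expr_lt _ q e _ e0; [rewrite (ltW q0)|exists b.+1].
Qed.

(** A compact set in the region where the last coordinate is positive is bounded and stays away from
    0 in that coordinate, so it misses the closed segments of all shells outside a finite box.
    Conversely, finitely many closed segments form a compact set that contains the support. *)
Lemma model_domainP f : model_domain q k nu f <->
  exists S : seq (multi_index k), forall i, i \notin S -> slice i f = 0.
Proof.
split=> [[cf sf]|[S fS]].
  have [|N hN] := box_bound cf; first by move=> v /sf[].
  have [|b hb] := @exprn_lt N.+1%:R^-1; first by rewrite invr_gt0.
  exists (index_box k b) => i /notin_index_box ib; apply: ae_of_cover => x xq /hN.
  exact: far_point xq hb ib.
pose C := \bigcup_(i in [set` S]) (row_point i @` `[q, 1]).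
have cC : compact C.
  rewrite /C bigcup_seq; apply: bigsetU_compact => i _; apply: continuous_compact; last exact: segment_compact.
  by apply: continuous_subspaceT => x; exact: row_point_continuous.
have fC : ess_supp mu f `<=` C.
  move=> v vf; apply: contrapT => nC; apply: (vf (~` C)).
    by apply: open_nbhs_nbhs; split => //; apply: closed_openC; apply: compact_closed => //; exact: norm_hausdorff.
  apply/mu_aeP => i; have [iS|iS] := boolP (i \in S); last first.
    by apply: (aeS1 ((slice_eq0P _ _).1 (fS i iS))).
  apply: (aeS1 (ae_in_q1 sq)) => x xq []; exists i => //; exists x => //.
  by move: xq; rewrite /= !in_itv/= => /andP[/ltW -> ->].
split.
  apply: subclosed_compact cC fC; rewrite -[ess_supp _ _]setCK; apply: open_closedC.
  rewrite openE => v /existsNP[U /not_implyP[vU /contrapT fU]].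
  have h := nbhs_interior vU; apply: filterS h => w wU hw.
  exact: (hw U wU).
move=> v /fC[i _ [x /=]]; rewrite in_itv/= => /andP[qx x1] <-; split=> [m|].
  rewrite mxE; case: (unliftP ord_max m) => [l|->]; last by rewrite eqxx.
  by move=> -> _; rewrite tnth_shell_point; exists (i.1 l).+1.
by rewrite mxE tnth_shell_point_max /dilate mulr_gt0 ?exprz_gt0//; exact: lt_le_trans qx.
Qed.

End model_domain.

Section model_core.
Context {R : realType} (q : R) (s : {finite_measure set (measurableTypeR R) -> \bar R}).
Hypothesis q01 : 0 < q < 1.
Hypothesis sq : s (~` `]q, 1]%classic) = 0%E.
Context {n : nat} (k : 'I_n).
Local Notation T := (measurableTypeR R).
Local Notation nu := (invariant_measure q01 sq).
Local Notation mu := (model_measure q k nu).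
Local Notation emb := (emb q01 sq).
Implicit Types (i : multi_index k) (j : 'I_n) (f g : L2 mu).

Lemma mulxE (f : L2 s) : {ae s, forall x : T, mulx f x = x%:C * f x}.
Proof.
apply: (aeS2 (L2mulE (@measurable_chi R) (@chi_le1 R) f) (ae_in_q1 sq)) => x -> xq.
congr (_%:C * _); rewrite /chi; move: xq; rewrite /= !in_itv/= => /andP[qx ->].
by rewrite (lt_trans _ qx)//; case/andP: q01.
Qed.

Lemma model_domain_subspace : linear_subspace (model_domain q k nu).
Proof.
split; first by apply/model_domainP; exists [::] => i _; rewrite linear0.
move=> a f g /model_domainP[S fS] /model_domainP[S' gS]; apply/model_domainP.
exists (S ++ S') => i; rewrite mem_cat negb_or => /andP[/fS f0 /gS g0].
by rewrite linearP/= f0 g0 scaler0 addr0.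
Qed.

Lemma model_domain_emb i h : model_domain q k nu (emb i h).
Proof.
apply/model_domainP; exists [:: i] => j; rewrite inE slice_emb eq_sym.
by move=> /negPf ->.
Qed.

(** The pointwise formula in terms of slices: up to a constant, the shifted shell receives
    multiplication by the variable, and a shell that is not a shift receives 0. *)
Lemma model_coreP j (p : L2 mu * L2 mu) : model_core q k nu j p <->
  [/\ model_domain q k nu p.1, (k < j)%N -> p.2 = 0 &
   forall l : 'I_k.+1, l = j :> nat ->
     (forall i, slice (shift_index l i) p.2 = (shift_coef q l i)%:C *: mulx (slice i p.1)) /\
     (forall i', (forall i, i' <> shift_index l i) -> slice i' p.2 = 0)].
Proof.
case: p => p1 p2.
have actP (l : 'I_k.+1) : {ae mu, forall t, p2 t = model_action q l p1 t} <->
     (forall i, slice (shift_index l i) p2 = (shift_coef q l i)%:C *: mulx (slice i p1)) /\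
     (forall i', (forall i, i' <> shift_index l i) -> slice i' p2 = 0).
  split=> [/mu_aeP h|[h1 h2]].
    split=> [i|i' hi]; last first.
      by apply/slice_eq0P; apply: (aeS1 (h i')) => x ->; rewrite model_action_noshift.
    have := L2_scaleE (shift_coef q l i)%:C (mulx (slice i p1)) => e.
    apply/L2_eqP; apply: (aeS3 (aeI (sliceE (shift_index l i) p2) (h (shift_index l i))) (aeI (mulxE (slice i p1)) (sliceE i p1)) e).
    by move=> x [-> ->] [e1 e2] ->; rewrite e1 e2 model_action_shift// mulrA -rmorphM.
  apply/mu_aeP => i'; have [[i ->]|ni] := pselect (exists i, i' = shift_index l i).
    have e : {ae s, forall x, slice (shift_index l i) p2 x = (shift_coef q l i)%:C * mulx (slice i p1) x}.
      by rewrite h1; exact: L2_scaleE.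
    apply: (aeS3 (sliceE (shift_index l i) p2) (aeI (mulxE (slice i p1)) (sliceE i p1)) e).
    by move=> x <- [e1 e2] ->; rewrite e1 e2 model_action_shift// mulrA -rmorphM.
  have ni' i : i' <> shift_index l i by move=> e; apply: ni; exists i.
  have /slice_eq0P := h2 _ ni'; move=> h; apply: (aeS1 h) => x ->.
  by rewrite model_action_noshift.
by split=> -[h1 h2 h3]; split=> // l lj; [exact: (actP l).1 (h3 l lj)|exact: (actP l).2 (h3 l lj)].
Qed.

Lemma model_core_subspace j : linear_subspace (model_core q k nu j).
Proof.
split.
  apply/model_coreP; split=> //; first by case: model_domain_subspace.
  by move=> l _; split=> *; rewrite /= !linear0 ?scaler0.
move=> a [x1 x2] [y1 y2] /model_coreP[/= x11 x12 x13] /model_coreP[/= y11 y12 y13]; apply/model_coreP; split=> /=.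
- by case: model_domain_subspace => _; exact.
- by move=> kj; rewrite x12// y12// scaler0 addr0.
move=> l lj; have [xa xb] := x13 l lj; have [ya yb] := y13 l lj; split=> i => [|hi].
  by rewrite !linearP/= xa ya.
by rewrite linearP/= xb// yb// scaler0 addr0.
Qed.

(* [insub j] is [None] exactly when the generator [j] acts by 0 on this summand. *)
Definition emb_action j i (h : L2 s) : L2 mu :=
  if insub (j : nat) is Some l then (shift_coef q l i)%:C *: emb (shift_index l i) (mulx h) else 0.

Lemma model_core_emb j i h : model_core q k nu j (emb i h, emb_action j i h).
Proof.
apply/model_coreP; split=> /=; first exact: model_domain_emb.
  by move=> kj; rewrite /emb_action insubF//; apply/negbTE; rewrite -ltnNge ltnS.
move=> l lj; rewrite /emb_action -lj valK; split=> i' => [|hi]; rewrite linearZ/= !slice_emb.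
  rewrite (inj_eq (@shift_inj k l)); case: eqP => [->//|_].
  by rewrite !linear0.
by case: eqP => [e|_]; [case: (hi i); rewrite e|rewrite scaler0].
Qed.

Lemma model_core_inj j f g g' : model_core q k nu j (f, g) -> model_core q k nu j (f, g') -> g = g'.
Proof.
move=> [/= _ h1 h2] [/= _ h1' h2']; have [kj|jk] := ltnP k j; first by rewrite h1// h1'.
have jk' : (j < k.+1)%N by [].
apply/L2_eqP; apply: (aeS2 (h2 (Ordinal jk') erefl) (h2' (Ordinal jk') erefl)) => t -> ->.
by [].
Qed.

Lemma model_domain_ind (B : set (L2 mu)) : linear_subspace B -> (forall i h, B (emb i h)) ->
  model_domain q k nu `<=` B.
Proof.
move=> sB hB f /model_domainP[S fS].
rewrite (@sum_slices _ _ _ q01 sq k f (undup S))// ?undup_uniq//; last by move=> i; rewrite mem_undup; exact: fS.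
by apply: subspace_sum.
Qed.

(** Functions on single shells span the domain, and the core is single-valued; hence a linear
    property of its pairs has to be checked on single shells only. *)
Lemma model_core_ind j (B : set (L2 mu * L2 mu)) : linear_subspace B ->
  (forall i h, B (emb i h, emb_action j i h)) -> model_core q k nu j `<=` B.
Proof.
move=> sB hB.
suff : model_domain q k nu `<=` [set f | exists g, B (f, g) /\ model_core q k nu j (f, g)].
  move=> h [f g] fg; have [|g' [Bg fg']] := h f; first by case: fg.
  by rewrite (model_core_inj fg fg').
apply: model_domain_ind => [|i h]; last by exists (emb_action j i h); split=> //; exact: model_core_emb.
have sC := model_core_subspace j; split.
  by exists 0; split; [exact: sB.1|exact: sC.1].
move=> a f f' [g [Bg Cg]] [g' [Bg' Cg']]; exists (a *: g + g').
split; [exact: (sB.2 a (f, g) (f', g'))|exact: (sC.2 a (f, g) (f', g'))].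
Qed.

End model_core.

(** * The standard representation *)

Section graphs.
Context {R : realType}.
Implicit Types H V : innerProductType R.

Lemma isometric_closure_graph V H (T : {linear V -> H}) (S : set (V * V)) (S' : set (H * H)) :
  isometric T -> closed S' -> (forall w, S w -> S' (T w.1, T w.2)) ->
  forall w, closure S w -> S' (T w.1, T w.2).
Proof.
move=> iT cS' SS' w /closure_pairP cw; apply: cS'; apply/closure_pairP => e /cw[w' Sw' [e1 e2]].
exists (T w'.1, T w'.2); first exact: SS'.
by rewrite /= -!linearB !(isometric_rnorm _ iT).
Qed.

Lemma adjoint_subspace H (S : set (H * H)) : linear_subspace (adjoint S).
Proof.
split=> [w _ /=|a [x1 x2] [y1 y2] hx hy w Sw /=]; first by rewrite !dotp0r.
by rewrite !dotpAr !dotpZr hx// hy.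
Qed.

Lemma adjoint_uniq H (S : set (H * H)) x y y' : dense [set u | exists v, S (u, v)] ->
  adjoint S (x, y) -> adjoint S (x, y') -> y = y'.
Proof.
move=> dS h h'; apply/eqP; rewrite -subr_eq0; apply/eqP/dotp_self_eq0.
apply: (@dotp_closure0 _ _ [set u | exists v, S (u, v)]) => [u [v uv]|].
  by rewrite dotpBr -(h _ uv) -(h' _ uv) subrr.
by apply/closureP => e e0; have /denseP := dS => /(_ (y - y') e e0).
Qed.

Lemma dense_sub H (A B : set H) : A `<=` B -> dense A -> dense B.
Proof. by move=> AB /denseP dA; apply/denseP => x e /(dA x)[y /AB]; exists y. Qed.

(** [T] intertwines the operators because the graphs in [H] are single-valued, and their adjoints
    because adjoints of densely defined operators are unique. The relations on [T x] then descend to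
    [x] by injectivity of [T]. *)
Lemma star_representation_transport (q : R) n V H (T : {linear V -> H})
    (z : 'I_n -> set (V * V)) (D : set V) (z' : 'I_n -> set (H * H)) (D' : set H) :
  isometric T -> linear_subspace D -> dense D ->
  (forall i, linear_subspace (z i)) -> (forall i, closed (z i)) ->
  (forall i w, z i w -> z' i (T w.1, T w.2)) -> (forall x, D x -> D' (T x)) ->
  (forall i x, D x -> exists y, D y /\ z i (x, y)) ->
  (forall i x, D x -> exists y, D y /\ adjoint (z' i) (T x, T y)) ->
  star_representation q z' D' -> star_representation q z D.
Proof.
move=> iT sD dD sz cz zz' DD' hZ hZs [sD' dD' oz' [Z' [Zs' [ZD' rel]]]].
have iTT := isometric_inj iT.
split=> //.
  move=> i; split=> //; split; first exact: sz.
  by move=> x y y' /zz'/= xy /zz'/= xy'; apply: iTT; have [[_ u] _] := oz' i; exact: u xy xy'.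
(* Outside [D] the chosen value is arbitrary. *)
have /choice[Z hZ'] (p : 'I_n * V) : exists y, D p.2 -> D y /\ z p.1 (p.2, y).
  by have [Dx|nD] := pselect (D p.2); [have [y hy] := hZ p.1 _ Dx; exists y|exists 0].
have /choice[Zs hZs'] (p : 'I_n * V) : exists y, D p.2 -> D y /\ adjoint (z' p.1) (T p.2, T y).
  by have [Dx|nD] := pselect (D p.2); [have [y hy] := hZs p.1 _ Dx; exists y|exists 0].
have TZ i x : D x -> T (Z (i, x)) = Z' i (T x).
  move=> Dx; have [_ /zz'/= h] := hZ' (i, x) Dx; have [h' _ _ _] := ZD' i _ (DD' _ Dx).
  by have [[_ u] _] := oz' i; exact: u h h'.
have TZs i x : D x -> T (Zs (i, x)) = Zs' i (T x).
  move=> Dx; have [_ h] := hZs' (i, x) Dx; have [_ h' _ _] := ZD' i _ (DD' _ Dx).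
  apply: (adjoint_uniq _ h h'); apply: dense_sub dD' => u /(ZD' i)[u' _ _ _].
  by exists (Z' i u).
have DZ i x : D x -> D (Z (i, x)) by move=> /(hZ' (i, x))[].
have DZs i x : D x -> D (Zs (i, x)) by move=> /(hZs' (i, x))[].
exists (fun i x => Z (i, x)), (fun i x => Zs (i, x)); split=> [i x Dx|x Dx].
  split; [by have [] := hZ' (i, x) Dx| |exact: DZ|exact: DZs].
  move=> w /zz' /= w'; have [_ h] := hZs' (i, x) Dx.
  by have := h _ w'; rewrite /= !iT.
have TB u v : T (u - v) = T u - T v by exact: linearB.
have TC a u : T (a *: u) = a *: T u by exact: linearZ.
have [r1 r2 r3] := rel _ (DD' _ Dx); split=> [i j ij|i j ij|i]; apply: iTT.
- by rewrite linearZ/= !TZ//; [exact: r1|exact: DZ|exact: DZ].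
- by rewrite linearZ/= TZ ?TZs ?TZ//; [exact: r2|exact: DZ|exact: DZs].
- rewrite TB !TC (linear_sum T)/= TZ; last exact: DZs.
  rewrite !TZs ?TZ//; last exact: DZ.
  rewrite r3; congr (_ - _ *: _); apply: eq_bigr => j _.
  by rewrite TZs ?TZ//; exact: DZ.
Qed.
End graphs.

Section orthogonal_sum.
Context {R : realType} (H : innerProductType R) (I : eqType) (E : I -> innerProductType R).
Variable iota : forall a, {linear E a -> H}.
Hypothesis iotaP : orthogonal_sum iota.

(** A vector of the span involves finitely many summands. Expressed through orthogonality, this is
    stable under linear combinations with no bookkeeping of coefficients. *)
Lemma orthogonal_sum_span : lin_span (\bigcup_a range (iota a)) `<=`
  [set y | exists S : seq I, forall v, (forall a u, a \in S -> dotp v (iota a u) = 0) -> dotp v y = 0].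
Proof.
apply: lin_span_min => [|_ [a _ [u _ <-]]]; last by exists [:: a] => v hv; apply: hv; exact: mem_head.
split; first by exists [::] => v _; rewrite dotp0r.
move=> c y y' [S hS] [S' hS']; exists (S ++ S') => v hv; rewrite dotpAr dotpZr.
by rewrite hS ?hS' ?mulr0 ?addr0// => a u aS; apply: hv; rewrite mem_cat aS ?orbT.
Qed.

(* The partial sums of the components are the best approximations of [x]. *)
Lemma orthogonal_sum_approx (x : H) (w : forall a, E a) (e : R) : 0 < e ->
  (forall a y, dotp (x - iota a (w a)) (iota a y) = 0) ->
  exists S : seq I, forall S', {subset S <= S'} -> uniq S' ->
    rnorm (x - \sum_(a <- S') iota a (w a)) < e.
Proof.
have [iso ort /denseP dH] := iotaP.
move=> e0 hw; have [y /orthogonal_sum_span/=[S hS] xy] := dH x e e0.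
exists S => S' SS' uS'; set P := \sum_(_ <- _) _.
have vP a u : a \in S' -> dotp (x - P) (iota a u) = 0.
  move=> aS'; rewrite /P (bigD1_seq a)//= opprD addrA dotpBl hw sub0r -big_filter dotp_suml big_filter.
  by rewrite big1 ?oppr0// => b ba; apply: ort; exact/eqP.
(* Both [y] and [P] are orthogonal to [x - P], so Cauchy-Schwarz bounds the norm of [x - P] by that
   of [x - y]. *)
have v0 : dotp (x - P) (x - y) = dotp (x - P) (x - P).
  rewrite !dotpBr [dotp _ y]hS => [|a u /SS']; last exact: vP.
  by rewrite subr0 [dotp _ P]dotp_sumr big_seq big1 ?subr0// => a aS'; exact: vP.
have := dotp_CS (x - P) (x - y); rewrite v0 dotp_rnorm rnormC ger0_norm ?sqr_ge0// expr2.
have [->|] := eqVneq (rnorm (x - P)) 0; first by [].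
move=> nz; rewrite ler_pM2l; first by move=> h; exact: le_lt_trans h xy.
by rewrite lt_def nz rnorm_ge0.
Qed.
End orthogonal_sum.

Section standard_representation.
Context {R : realType} {q : R} {n : nat} {H H0 : hilbertType R} {K : 'I_n -> hilbertType R}.
Variable A : forall k, {linear K k -> K k}.
Variable iota : forall a : std_index, {linear std_summand H0 K a -> H}.
Variable z : 'I_n -> set (H * H).
Hypothesis q01 : 0 < q < 1.
Hypothesis hrep : star_representation q z (std_domain iota).
Hypothesis hstd : standard_form q A iota z.
Local Notation vec := (std_vec iota).
Implicit Types (k j : 'I_n).

Let iotaP : orthogonal_sum iota. Proof. by case: hstd. Qed.
Let iota_iso a : isometric (iota a). Proof. by case: iotaP => + _ _; exact. Qed.

Lemma std_vec_linear k (i : multi_index k) : linear (vec i : K k -> H).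
Proof. exact: linearP. Qed.
HB.instance Definition _ k (i : multi_index k) :=
  GRing.isLinear.Build R[i] (K k) H _ (vec i) (std_vec_linear i).

Lemma std_vec_iso k (i : multi_index k) : isometric (vec i : K k -> H).
Proof. exact: (@iota_iso (Some (Tagged (fun k : 'I_n => multi_index k) i))). Qed.

Lemma std_vec_orth k (i i' : multi_index k) (h h' : K k) : i <> i' -> dotp (vec i h) (vec i' h') = 0.
Proof. by move=> ii'; case: iotaP => _ + _; apply => -[] /eqP; rewrite eq_Tagged => /eqP. Qed.

Lemma std_vec_orth_tag k k' (i : multi_index k) (i' : multi_index k') (h : K k) (h' : K k') :
  k <> k' -> dotp (vec i h) (vec i' h') = 0.
Proof. by move=> kk'; case: iotaP => _ + _; apply => -[kk _]; apply: kk'. Qed.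

Lemma std_vec_orth0 k (i : multi_index k) (h : K k) (h0 : H0) : dotp (iota None h0) (vec i h) = 0.
Proof. by case: iotaP => _ + _; exact. Qed.

Lemma iota_ortho_eq0 v : (forall h0, dotp v (iota None h0) = 0) ->
  (forall k (i : multi_index k) h, dotp v (vec i h) = 0) -> v = 0.
Proof.
move=> v0 vk; apply: dotp_self_eq0.
apply: (@dotp_closure0 _ _ (lin_span (\bigcup_a range (iota a)))) => [y hy|]; last first.
  by case: iotaP => _ _ /denseP dH; apply/closureP => e /(dH v).
apply: dotp_eq0C; move: y hy; suff : lin_span (\bigcup_a range (iota a)) `<=` [set y | dotp v y = 0] by exact.
apply: lin_span_min => [|_ [[[k i]|] _ [h _ <-]]]; [|exact: vk|exact: v0].
by split=> [|a x y /= hx hy]; rewrite /= ?dotp0r// dotpAr dotpZr hx hy mulr0 addr0.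
Qed.

(** The cases [Std_gt], [Std_eq] and [Std_lt] of the action in one formula, parallel to
    [emb_action]; [insub j] fails exactly when [k < j]. *)
Definition std_step j k (i : multi_index k) (h : K k) : H :=
  if insub (j : nat) is Some l then (shift_coef q l i)%:C *: vec (shift_index l i) (A k h) else 0.

Let z_sub j : linear_subspace (z j).
Proof. by case: hrep => _ _ h _; case: (h j) => -[]. Qed.
Let z_closed j : closed (z j).
Proof. by case: hrep => _ _ h _; case: (h j). Qed.

Let z_action j x y : std_action q A iota j x y -> z j (x, y).
Proof. by case: hstd => _ _ -> xy; apply: subset_closure; apply: sub_lin_span. Qed.

Lemma std_none j h0 : z j (iota None h0, 0).
Proof. by apply: z_action; exact: Std_zero. Qed.

Lemma std_step_in j k (i : multi_index k) h : z j (vec i h, std_step j i h).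
Proof.
apply: z_action; rewrite /std_step; case: insubP => [l _|].
  rewrite /shift_index /shift_coef; case: (unliftP ord_max l) => [l'|] -> e.
    by apply: Std_lt; rewrite -e /= /bump leqNgt ltn_ord.
  have kj : k = j by apply: val_inj.
  by subst k; exact: Std_eq.
by rewrite -leqNgt => kj; exact: Std_gt.
Qed.

Lemma std_ind j (B : set (H * H)) : linear_subspace B -> closed B ->
  (forall h0, B (iota None h0, 0)) ->
  (forall k (i : multi_index k) h, B (vec i h, std_step j i h)) -> z j `<=` B.
Proof.
move=> sB cB B0 Bk; case: hstd => _ _ -> p hp; apply: cB; apply: closureS hp.
apply: lin_span_min => // -[x y] /=; case=> [h|k i h kj|i h|k l i h lj]; first exact: B0.
- by have := Bk k i h; rewrite /std_step insubF//; apply/negbTE; rewrite -leqNgt.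
- have := Bk j i h; rewrite /std_step (_ : insub _ = Some ord_max); last exact: (valK ord_max).
  by rewrite /shift_index /shift_coef unlift_none.
- have := Bk k i h; rewrite /std_step (_ : insub _ = Some (lift ord_max l)).
    by rewrite /shift_index /shift_coef liftK.
  rewrite -(valK (lift ord_max l)); congr insub.
  by rewrite /= /bump leqNgt ltn_ord.
Qed.

Lemma adjoint_closed (y y' : H) : closed [set w : H * H | dotp w.2 y = dotp w.1 y'].
Proof.
move=> w /closure_pairP cw; apply: eq_of_rnorm => e e0.
have C0 : 0 < 2 * (1 + rnorm y + rnorm y') by rewrite mulr_gt0// -addrA ltr_wpDr ?addr_ge0 ?rnorm_ge0.
have [w' ww' [h1 h2]] := cw _ (divr_gt0 e0 C0).
have -> : dotp w.2 y - dotp w.1 y' = dotp (w.2 - w'.2) y - dotp (w.1 - w'.1) y'.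
  by rewrite !dotpBl ww' opprB; ring.
apply: le_lt_trans (rnormD _ _) _; rewrite rnormN.
apply: le_lt_trans (lerD (dotp_CS _ _) (dotp_CS _ _)) _.
rewrite ltr_pdivlMr// in h1; rewrite ltr_pdivlMr// in h2.
have := rnorm_ge0 y; have := rnorm_ge0 y'; have := rnorm_ge0 (w.1 - w'.1); have := rnorm_ge0 (w.2 - w'.2).
nra.
Qed.

(** For a fixed pair, the adjoint condition on [w] is closed and linear, so it has to be tested only
    on the pairs that generate [z j]. *)
Lemma std_adjoint j k (i : multi_index k) h y : (forall h0, dotp (iota None h0) y = 0) ->
  (forall k' (i' : multi_index k') h', dotp (std_step j i' h') (vec i h) = dotp (vec i' h') y) ->
  adjoint (z j) (vec i h, y).
Proof.
move=> y0 hy; rewrite /adjoint /=.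
suff : z j `<=` [set w | dotp w.2 (vec i h) = dotp w.1 y] by exact.
apply: std_ind; last exact: hy.
- split=> [/=|a w w' /= hw hw']; first by rewrite !dotp0l.
  by rewrite /= !dotpDl hw hw'.
- exact: adjoint_closed.
- by move=> h0; rewrite /= dotp0l y0.
Qed.


Section summand.
Context {s : {finite_measure set (measurableTypeR R) -> \bar R}} (sq : s (~` `]q, 1]%classic) = 0%E).
Context {k : 'I_n} {V : {linear L2 s -> K k}}.
Hypotheses (iV : isometric V) (VA : forall h, V (mulx h) = A k (V h)).
Local Notation nu := (invariant_measure q01 sq).
Local Notation mu := (model_measure q k nu).
Local Notation emb := (emb q01 sq).

Let sA h h' : dotp (A k h) h' = dotp h (A k h').
Proof. by case: hstd => _ + _ => /(_ k)[]. Qed.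

(** Distinct shells and distinct copies of [K k] are orthogonal, and [emb i], [V] and the inclusion
    of a copy are isometric, so the two families have the same Gram matrix. *)
Lemma exists_model_embedding : exists T : {linear L2 mu -> H},
  isometric T /\ forall (i : multi_index k) h, T (emb i h) = vec i (V h).
Proof.
have [| |T [iT hT]] := @gram_extension _ (L2 mu) H (multi_index k * L2 s)%type
    (fun p => emb p.1 p.2) (fun p => vec p.1 (V p.2)) _ _ (@complete_seq _ H).
- move=> [i h] [i' h'] /=; have [->|/eqP ii'] := eqVneq i i'.
    by rewrite std_vec_iso iV (@emb_isometric _ _ _ q01 sq).
  by rewrite std_vec_orth// (@emb_orthogonal _ _ _ q01 sq).
- move=> f; apply: closureS (@emb_dense _ _ _ q01 sq _ f).
  by apply: lin_span_mono => _ [i _ [h _ <-]]; exists (i, h).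
by exists T; split=> // i h; exact: (hT (i, h)).
Qed.

Context {T : {linear L2 mu -> H}}.
Hypotheses (iT : isometric T) (Temb : forall (i : multi_index k) h, T (emb i h) = vec i (V h)).

Let T_action j i h : T (emb_action q01 sq j i h) = std_step j i (V h).
Proof.
rewrite /emb_action /std_step; case: insub => [l|]; last by rewrite linear0.
by rewrite linearZ/= Temb VA.
Qed.

Lemma core_in_graph j w : closure (model_core q k nu j) w -> z j (T w.1, T w.2).
Proof.
apply: isometric_closure_graph => //.
suff : model_core q k nu j `<=` [set w | z j (T w.1, T w.2)] by exact.
apply: model_core_ind => [|i h]; last by rewrite /= Temb T_action; exact: std_step_in.
split=> [|a u v /= hu hv]; first by rewrite /= !linear0; exact: (z_sub j).1.
by rewrite /= !linearP; exact: ((z_sub j).2 a (T u.1, T u.2) (T v.1, T v.2)).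
Qed.

Lemma model_embedding_ortho (y : H) :
  (forall (i : multi_index k) h, dotp (vec i (V h)) y = 0) -> forall f, dotp (T f) y = 0.
Proof.
move=> hy f; have [g hg] := isometric_projection iT (@L2_complete _ _ _ mu) (@complete_seq _ H) y.
have e f' : dotp (T f') y = dotp f' g.
  rewrite -[y](subrK (T g)) dotpAr iT [X in X + _](_ : _ = 0) ?add0r//.
  exact: dotp_eq0C.
rewrite e (_ : g = 0) ?dotp0r//.
by apply: (@emb_ortho_eq0 _ _ _ q01 sq) => i h; apply: dotp_eq0C; rewrite -e Temb hy.
Qed.

(** The adjoint lowers the index: from a shell [shift_index l i0] it goes back to [i0] with the same
    real coefficient and the same self-adjoint factor, and on a shell that is not a shift it is
    0. *)
Lemma model_adjoint j f : model_domain q k nu f ->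
  exists g, model_domain q k nu g /\ adjoint (z j) (T f, T g).
Proof.
have sD := model_domain_subspace q01 sq k.
suff : model_domain q k nu `<=` [set f | exists g, model_domain q k nu g /\ adjoint (z j) (T f, T g)] by exact.
apply: model_domain_ind => [|i h].
  have sA' := adjoint_subspace (z j); split.
    by exists 0; rewrite !linear0; split; [exact: sD.1|exact: sA'.1].
  move=> a f1 f2 [g1 [D1 h1]] [g2 [D2 h2]]; exists (a *: g1 + g2); split; first exact: sD.2.
  by rewrite !linearP; exact: (sA'.2 a (T f1, T g1) (T f2, T g2)).
have [[l [i0 [lE iE]]]|nl] := pselect (exists (l : 'I_k.+1) i0, insub (j : nat) = Some l /\ i = shift_index l i0).
  exists ((shift_coef q l i0)%:C *: emb i0 (mulx h)); split.
    by apply: subspaceZ => //; exact: model_domain_emb.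
  rewrite linearZ/= !Temb VA; apply: std_adjoint => [h0|k' i' h'].
    by rewrite dotpZr std_vec_orth0 mulr0.
  have [kk|/eqP kk] := eqVneq k' k; last first.
    rewrite dotpZr std_vec_orth_tag// mulr0 /std_step; case: insub => [l'|]; last by rewrite dotp0l.
    by rewrite dotpZl std_vec_orth_tag// mulr0.
  subst k'; rewrite /std_step lE dotpZl dotpZr iE.
  have -> : Num.conj (shift_coef q l i0)%:C = (shift_coef q l i0)%:C by apply/eqP; rewrite eq_complex/= oppr0 !eqxx.
  have [->|/eqP ii] := eqVneq i' i0; first by rewrite !std_vec_iso sA.
  by rewrite !std_vec_orth// ?mulr0// => /shift_inj.
exists 0; rewrite linear0 Temb; split; first exact: sD.1.
apply: std_adjoint => [h0|k' i' h']; first by rewrite dotp0r.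
rewrite dotp0r /std_step; case lE : insub => [l|]; last by rewrite dotp0l.
have [kk|/eqP kk] := eqVneq k' k; last by rewrite dotpZl std_vec_orth_tag// mulr0.
subst k'; rewrite dotpZl std_vec_orth ?mulr0// => e.
by apply: nl; exists l, i'.
Qed.

Lemma model_star_representation :
  star_representation q (ops (model q k nu)) (model_domain q k nu).
Proof.
have sD := model_domain_subspace q01 sq k.
apply: (@star_representation_transport _ q n (L2 mu) H T _ _ z (std_domain iota)) => //.
- apply/denseP => f e e0; have /closureP := @emb_dense _ _ _ q01 sq k f => /(_ e e0)[g hg fg].
  exists g => //; apply: lin_span_min hg => // _ [i _ [h _ <-]]; exact: model_domain_emb.
- by move=> j; apply: closure_pair_subspace; exact: model_core_subspace.
- by move=> j; exact: closed_closure.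
- by move=> j w; exact: core_in_graph.
- suff : model_domain q k nu `<=` [set f | std_domain iota (T f)] by exact.
  apply: model_domain_ind => [|i h]; first exact/preimage_subspace/lin_span_subspace.
  by rewrite /= Temb; apply: sub_lin_span; exists (Some (Tagged (fun k : 'I_n => multi_index k) i)) => //; exists (V h).
- move=> j; suff : model_domain q k nu `<=` [set f | exists g, model_domain q k nu g /\ closure (model_core q k nu j) (f, g)] by exact.
  apply: model_domain_ind => [|i h].
    have sC := closure_pair_subspace (model_core_subspace q01 sq k j); split.
      by exists 0; split; [exact: sD.1|exact: sC.1].
    move=> a f1 f2 [g1 [D1 h1]] [g2 [D2 h2]]; exists (a *: g1 + g2); split; first exact: sD.2.
    exact: (sC.2 a (f1, g1) (f2, g2)).
  exists (emb_action q01 sq j i h); split; last by apply: subset_closure; exact: model_core_emb.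
  rewrite /emb_action; case: insub => [l|]; last exact: sD.1.
  by apply: subspaceZ => //; exact: model_domain_emb.
- exact: model_adjoint.
Qed.

(* The range of [T] reduces the representation. *)
Lemma model_component j p : z j p -> exists w, [/\ closure (model_core q k nu j) w,
  forall f, dotp (p.1 - T w.1) (T f) = 0 & forall f, dotp (p.2 - T w.2) (T f) = 0].
Proof.
have sC := closure_pair_subspace (model_core_subspace q01 sq k j).
move: p; suff : z j `<=` [set p | exists w, [/\ closure (model_core q k nu j) w,
  forall f, dotp (p.1 - T w.1) (T f) = 0 & forall f, dotp (p.2 - T w.2) (T f) = 0]] by exact.
have subT (u u' : H) v v' f (a : R[i]) : dotp (u - T v) (T f) = 0 -> dotp (u' - T v') (T f) = 0 ->
    dotp (a *: u + u' - T (a *: v + v')) (T f) = 0.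
  by rewrite !dotpBl linearP !dotpDl => /eqP; rewrite subr_eq0 => /eqP -> /eqP; rewrite subr_eq0 => /eqP ->; rewrite subrr.
apply: std_ind => [||h0|k' i h].
- split; first by exists 0; split; [exact: sC.1| |]; move=> f; rewrite /= linear0 subr0 dotp0l.
  move=> a p p' [w [Cw w1 w2]] [w' [Cw' w1' w2']]; exists (a *: w + w'); split; first exact: sC.2.
    by move=> f; exact: subT.
  by move=> f; exact: subT.
(* The components in the range of [T] depend contractively on the vector, so those of [p] are limits
   of pairs of the closed graph of the model. *)
- move=> p /closure_pairP cp.
  have cT := isometric_projection iT (@L2_complete _ _ _ mu) (@complete_seq _ H).
  have [w1 h1] := cT p.1; have [w2 h2] := cT p.2; exists (w1, w2); split=> //.
  apply: (@closed_closure _ (model_core q k nu j)); apply/closure_pairP => e e0.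
  have [p' [w' [Cw' h1' h2']] [e1 e2]] := cp e e0; exists w' => //=.
  have contr (u u' : H) v v' : (forall f, dotp (u - T v) (T f) = 0) -> (forall f, dotp (u' - T v') (T f) = 0) ->
      rnorm (v - v') <= rnorm (u - u').
    move=> hv hv'; rewrite -(isometric_rnorm _ iT) -(@ler_pXn2r _ 2) ?nnegrE ?rnorm_ge0//.
    have o : dotp (u - u' - T (v - v')) (T (v - v')) = 0.
      by have := subT u' u v' v (v - v') (-1) (hv' _) (hv _); rewrite !scaleN1r ![- _ + _]addrC.
    by rewrite -[u - u'](subrK (T (v - v'))) (pythagoras o) lerDr sqr_ge0.
  by split; [apply: le_lt_trans e1; exact: contr|apply: le_lt_trans e2; exact: contr].
- exists 0; split; [exact: sC.1| |]; move=> f; rewrite /= linear0 subr0 ?dotp0l//.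
  by apply: dotp_eq0C; apply: model_embedding_ortho => i h; apply: dotp_eq0C; exact: std_vec_orth0.
have [kk|/eqP kk] := eqVneq k' k; last first.
  have o i' (h' : K k') f : dotp (vec i' h') (T f) = 0.
    by apply: dotp_eq0C; apply: model_embedding_ortho => i1 h1; apply: std_vec_orth_tag => /esym.
  exists 0; split; [exact: sC.1| |]; move=> f; rewrite /= linear0 subr0//.
  by rewrite /std_step; case: insub => [l|]; rewrite ?dotp0l// dotpZl o mulr0.
(* [V g] is the component of [h] in the cyclic subspace. Self-adjointness of [A k] keeps the image
   of [h - V g] orthogonal to the range of [V]. *)
subst k'; have [g hg] := isometric_projection iV (@L2_complete _ _ _ s) (@complete_seq _ (K k)) h.
have o i' (h' : K k) f : (forall g, dotp h' (V g) = 0) -> dotp (vec i' h') (T f) = 0.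
  move=> hh; apply: dotp_eq0C; apply: model_embedding_ortho => i1 h1; apply: dotp_eq0C.
  have [->|/eqP ii] := eqVneq i' i1; last exact: std_vec_orth.
  by rewrite std_vec_iso.
exists (emb i g, emb_action q01 sq j i g); split=> /= [|f|f].
- by apply: subset_closure; exact: model_core_emb.
- by rewrite Temb -linearB; exact: o.
- rewrite T_action /std_step; case: insub => [l|]; last by rewrite subr0 dotp0l.
  rewrite -scalerBr -linearB dotpZl o ?mulr0// => g'.
  by rewrite -linearB sA -VA hg.
Qed.
End summand.

(** What the assembly uses of one summand, without reference to [s] and [V]. The last two clauses
    place the range of [T] between the iterates of [x] in all copies of [K k] and their closed
    span. *)
Definition models_summand k (x : K k) (nu : {sigma_finite_measure set (measurableTypeR R) -> \bar R})
    (T : {linear L2 (model_measure q k nu) -> H}) : Prop :=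
  [/\ q_invariant q nu, star_representation q (ops (model q k nu)) (model_domain q k nu) & isometric T] /\
  [/\ forall j w, ops (model q k nu) j w -> z j (T w.1, T w.2),
      forall j p, z j p -> exists w, [/\ ops (model q k nu) j w,
        forall f, dotp (p.1 - T w.1) (T f) = 0 & forall f, dotp (p.2 - T w.2) (T f) = 0],
      forall h0 f, dotp (T f) (iota None h0) = 0,
      forall y, (forall (i : multi_index k) m, dotp (vec i (iter m (A k) x)) y = 0) ->
        forall f, dotp (T f) y = 0 &
      forall (i : multi_index k) m, exists f, T f = vec i (iter m (A k) x)].

Lemma exists_models_summand k (x : K k) : exists nu T, @models_summand k x nu T.
Proof.
have [cA sA spA eigA] : [/\ continuous (A k),
        forall x y, dotp (A k x) y = dotp x (A k y),
        forall l, spectrum (A k) l -> exists2 r : R, l = r%:C & q <= r <= 1 &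
        ~ Defs.eigenvalue (A k) q%:C] by case: hstd.
have [s [sq [V [iV VA Vx cV]]]] := cyclic_model q01 (@complete_seq _ (K k)) cA sA spA eigA x.
have [T [iT hT]] := exists_model_embedding sq iV.
exists (invariant_measure q01 sq), T; split; split=> //.
- exact: invariant_ext_q_invariant.
- exact: (model_star_representation VA iT hT).
- by move=> j w; exact: (core_in_graph VA iT hT).
- by move=> j p; exact: (model_component iV VA iT hT).
- move=> h0; apply: (model_embedding_ortho iT hT) => i h.
  by apply: dotp_eq0C; exact: std_vec_orth0.
(* [y'] is the component of [y] in the copy [i] of [K k]. Orthogonality to the iterates passes to
   their closed span, which contains every [V h]. *)
- move=> y hy; apply: (model_embedding_ortho iT hT) => i h.
  have [y' hy'] := isometric_projection (@std_vec_iso k i) (@complete_seq _ (K k)) (@complete_seq _ H) y.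
  have e v : dotp (vec i v) y = dotp v y'.
    rewrite -[y](subrK (vec i y')) dotpAr std_vec_iso [X in X + _](_ : _ = 0) ?add0r//.
    exact: (dotp_eq0C (hy' v)).
  rewrite e; apply: dotp_closure0 (cV h).
  suff : lin_span (range (fun m => iter m (A k) x)) `<=` [set v | dotp v y' = 0] by exact.
  apply: lin_span_min => [|_ [m _ <-]]; last by rewrite /= -e hy.
  by split=> [|a u v /= hu hv]; rewrite /= ?dotp0l// dotpDl hu hv mulr0 addr0.
- by move=> i m; have [h <-] := Vx m; exists (emb q01 sq i h); rewrite hT.
Qed.

End standard_representation.

(** * Maximal cyclic families and the assembly of the summands *)

(** Zorn's lemma. By self-adjointness, a vector orthogonal to all the cyclic subspaces has its whole
    cyclic subspace orthogonal to them, so unless it belongs to the family it could be added. A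
    member is orthogonal to itself. *)
Lemma maximal_cyclic_family {R : realType} (K : innerProductType R) (A : {linear K -> K}) :
  (forall x y, dotp (A x) y = dotp x (A y)) ->
  exists X : set K, (forall x x' m m', X x -> X x' -> x <> x' -> dotp (iter m A x) (iter m' A x') = 0) /\
    forall y, (forall x m, X x -> dotp (iter m A x) y = 0) -> y = 0.
Proof.
move=> sA.
pose P (X : set K) := forall x x' m m', X x -> X x' -> x <> x' -> dotp (iter m A x) (iter m' A x') = 0.
have [F FP tF|X [PX maxX]] := @Zorn_bigcup _ P.
  move=> x x' m m' [X FX Xx] [X' FX' Xx'].
  have [XX'|X'X] := tF _ _ FX FX'; first by apply: (FP _ FX') => //; exact: XX'.
  by apply: (FP _ FX) => //; exact: X'X.
exists X; split=> // y hy.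
have sAm m u v : dotp (iter m A u) v = dotp u (iter m A v).
  by elim: m u v => // m IH u v; rewrite iterSr IH sA.
have [Xy|nXy] := pselect (X y); first by apply: dotp_self_eq0; exact: (hy y 0%N Xy).
exfalso; apply: (maxX (X `|` [set y])).
  split=> [u Xu|XX]; first by left.
  by apply: nXy; apply: XX; right.
have o x m m' : X x -> dotp (iter m A x) (iter m' A y) = 0.
  by move=> Xx; rewrite -sAm -iterD; exact: hy.
move=> x x' m m' [Xx|->] [Xx'|->] xx'; [exact: PX|exact: o| |by case: xx'].
by apply: dotp_eq0C; exact: o.
Qed.

Theorem theorem7 (R : realType) (q : R) (hq : 0 < q < 1) (n : nat)
    (hn : (0 < n)%N) (H H0 : hilbertType R) (K : 'I_n -> hilbertType R)
    (A : forall k, {linear K k -> K k})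
    (iota : forall a : std_index, {linear std_summand H0 K a -> H})
    (z : 'I_n -> set (H * H))
    (hrep : star_representation q z (std_domain iota))
    (hstd : standard_form q A iota z) :
  exists (I : Type) (k : I -> 'I_n)
      (nu : I -> {sigma_finite_measure set (measurableTypeR R) -> \bar R}),
    [/\ forall a, q_invariant q (nu a),
        forall a, star_representation q (ops (model q (k a) (nu a)))
                    (model_domain q (k a) (nu a)) &
        exists (H' : hilbertType R) (z' : 'I_n -> set (H' * H')),
          is_direct_sum z' (fun a : option I =>
            if a is Some b then model q (k b) (nu b) else zero_ops H0 n) /\
          unitarily_equivalent z z'].
Proof.
have sA k : forall x y, dotp (A k x) y = dotp x (A k y) by case: hstd => _ + _ => /(_ k)[].
have iotaP : orthogonal_sum iota by case: hstd.
have zP j : linear_subspace (z j) /\ closed (z j).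
  by case: hrep => _ _ h _; case: (h j) => -[].
pose X k := projT1 (cid (maximal_cyclic_family (sA k))).
have XP k := projT2 (cid (maximal_cyclic_family (sA k))).
pose I := {k : 'I_n & {x : K k | X k x}}.
pose k (b : I) : 'I_n := tag b.
pose x (b : I) : K (k b) := sval (tagged b).
have /choice[nu hnu] (b : I) := exists_models_summand hq hrep hstd (x b).
have [T hT] : exists T : forall b, {linear L2 (model_measure q (k b) (nu b)) -> H},
    forall b, models_summand A iota z (x b) (T b).
  by exists (fun b => projT1 (cid (hnu b))) => b; exact: projT2 (cid (hnu b)).
pose F (a : option I) := if a is Some b then model q (k b) (nu b) else zero_ops H0 n.
pose TT (a : option I) : {linear F a -> H} :=
  match a return {linear F a -> H} with Some b => T b | None => iota None end.
have vecT (b : I) (i : multi_index (k b)) m : exists f, T b f = std_vec iota i (iter m (A (k b)) (x b)).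
  by have [_ [_ _ _ _ h]] := hT b; exact: h.
have orthT (b : I) y : (forall (i : multi_index (k b)) m, dotp (std_vec iota i (iter m (A (k b)) (x b))) y = 0) ->
    forall f, dotp (T b f) y = 0.
  by have [_ [_ _ _ h _]] := hT b; exact: h.
have TTP : orthogonal_sum TT.
  split.
  - case=> [b|] u v; first by have [[_ _ h] _] := hT b; exact: h.
    by case: iotaP => h _ _; exact: (h None u v).
  - have oN b u h0 : dotp (T b u) (iota None h0) = 0.
      by have [_ [_ _ h _ _]] := hT b; exact: h.
    case=> [b|] [b'|] u v // ab; [|exact: oN|by apply: dotp_eq0C; exact: oN].
    apply: (orthT b) => i m; apply: dotp_eq0C; apply: (orthT b') => i' m'.
    rewrite /k /x in i i' *.
    case: b u ab i => k1 [x1 X1] u ab i; case: b' v ab i' => k2 [x2 X2] v ab i' /=.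
    have [kk|/eqP kk] := eqVneq k2 k1; last exact: (std_vec_orth_tag hstd).
    subst k2; have [->|/eqP ii] := eqVneq i' i; last exact: (std_vec_orth hstd).
    (* Within one copy of one K_k, distinct indices come from distinct vectors of the family, as
       membership proofs are irrelevant. *)
    rewrite (std_vec_iso hstd); apply: (XP k1).1 => // xx; apply: ab.
    move: X2 {v i'}; rewrite xx => X2; by rewrite (Prop_irrelevance X2 X1).
  apply/denseP => v e e0; suff /closureP : closure (lin_span (\bigcup_a range (TT a))) v by apply.
  apply: (@orthogonal_dense _ H _ (@complete_seq _ H)) => y hy.
  apply: (iota_ortho_eq0 hstd) => [h0|k1 i h]; first by apply: hy; exists None => //; exists h0.
  (* The component of [y] in each copy of K_k is orthogonal to all cyclic subspaces, so it vanishes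
     by maximality. *)
  have [y' hy'] := isometric_projection (std_vec_iso hstd i) (@complete_seq _ (K k1)) (@complete_seq _ H) y.
  have ey h' : dotp y (std_vec iota i h') = dotp y' h'.
    rewrite -[y](subrK (std_vec iota i y')) dotpAl (std_vec_iso hstd) (hy' h') add0r //.
  rewrite ey (_ : y' = 0) ?dotp0l//; apply: (XP k1).2 => x1 m Xx.
  apply: dotp_eq0C; rewrite -ey.
  have [f <-] := vecT (existT _ k1 (exist _ x1 Xx)) i m.
  by apply: hy; exists (Some (existT _ k1 (exist _ x1 Xx))) => //; exists f.
have TTz a j w : ops (F a) j w -> z j (TT a w.1, TT a w.2).
  case: a w => [b|] w; first by have [_ [h _ _ _ _]] := hT b; exact: h.
  by rewrite /= => ->; rewrite linear0; exact: (std_none hstd).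
exists I, k, nu; split=> [b|b|].
- by have [[h _ _] _] := hT b.
- by have [[_ h _] _] := hT b.
exists H, z; split; last by exists idfun; split=> //; exists idfun.
exists TT; split=> // j; apply/seteqP; split=> [p zp [b|]|p hp].
- have [_ [_ h _ _ _]] := hT b; exact: h.
(* On the summand H_0 the second component is 0, because the range of [z j] is orthogonal to it. *)
- have iN : isometric (iota None) by case: iotaP => + _ _; exact.
  have [h0 hh0] := isometric_projection iN (@complete_seq _ H0) (@complete_seq _ H) p.1.
  exists (h0, 0); split=> // y; rewrite /= linear0 subr0.
  move: p zp {hh0}; suff : z j `<=` [set p | dotp p.2 (iota None y) = 0] by exact.
  apply: (std_ind hstd) => [||h|k1 i h] /=.
  + by split=> [|a u v /= hu hv]; rewrite /= ?dotp0l// dotpDl hu hv mulr0 addr0.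
  + move=> p cp; have := @adjoint_closed _ H (iota None y) 0 p.
    rewrite /= dotp0r; apply; apply: closureS cp => u /= ->.
    by rewrite dotp0r.
  + by rewrite dotp0l.
  + rewrite /std_step; case: insub => [l|]; last by rewrite dotp0l.
    by rewrite dotpZl (dotp_eq0C (std_vec_orth0 hstd _ _ _)) mulr0.
- pose w a := projT1 (cid (hp a)).
  have wz a : ops (F a) j (w a) by case: (projT2 (cid (hp a))).
  have w1P a y : dotp (p.1 - TT a (w a).1) (TT a y) = 0 by case: (projT2 (cid (hp a))) => _ h _; exact: h.
  have w2P a y : dotp (p.2 - TT a (w a).2) (TT a y) = 0 by case: (projT2 (cid (hp a))) => _ _ h; exact: h.
  have [sz cz] := zP j.
  (* Finite sums of the pairs of components lie in the graph of [z j], and a finite set of summands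
     large enough for both entries brings them close to [p]; the graph is closed. *)
  apply: cz; apply/closure_pairP => e e0.
  (* [{classic option I}] equips the index type with a decidable equality. *)
  have [S1 hS1] := @orthogonal_sum_approx _ _ {classic option I} _ TT TTP p.1 (fun a => (w a).1) e e0 w1P.
  have [S2 hS2] := @orthogonal_sum_approx _ _ {classic option I} _ TT TTP p.2 (fun a => (w a).2) e e0 w2P.
  pose S := undup (S1 ++ S2).
  exists (\sum_(a <- S) TT a (w a).1, \sum_(a <- S) TT a (w a).2).
    have -> : (\sum_(a <- S) TT a (w a).1, \sum_(a <- S) TT a (w a).2) =
        \sum_(a <- S) (TT a (w a).1, TT a (w a).2) :> H * H.
      by elim/big_rec3 : _ => [//|a u v r _ <-].
    by apply: subspace_sum => // a _; exact/TTz/wz.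
  by split; [apply: hS1|apply: hS2]; rewrite ?undup_uniq// => a aS; rewrite mem_undup mem_cat aS ?orbT.
Qed.
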